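(* Let $k$ be an algebraically closed field, let $\mathcal C$ be a $k$-linear monoidal category with finite-dimensional morphism spaces, and let $X$ be an algebra object in $\mathcal C$ such that only finitely many isomorphism classes of objects occur as subobjects of $X$. Choose representatives of these isomorphism classes, discard every representative that admits no unital algebra structure with an algebra monomorphism into $X$, and let $B_1,\dots,B_N$ be the remaining ones. For each $r$ put $a_r=\dim_k\mathrm{Hom}_{\mathcal C}(B_r\otimes B_r,B_r)$, $u_r=\dim_k\mathrm{Hom}_{\mathcal C}(\mathbf 1,B_r)$, $t_r=\dim_k\mathrm{Hom}_{\mathcal C}(B_r^{\otimes 3},B_r)$, $E_r=\dim_k\mathrm{End}_{\mathcal C}(B_r)$, $h_r=\dim_k\mathrm{Hom}_{\mathcal C}(B_r,X)$, $c_r=\dim_k\mathrm{Hom}_{\mathcal C}(B_r\otimes B_r,X)$. Then the number of inner-conjugacy classes of separable algebra subobjects of $X$ is at most $$\sum_{r=1}^N 2^{\min\{a_r+u_r,\,t_r+2E_r\}+\min\{\max\{h_r-1,0\},\,c_r\}}.$$ If $X$ is connected, the same expression bounds the number of equivalence classes over $X$ of separable algebra subobjects of $X$.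
   Context: Composition and tensor product in $\mathcal C$ are $k$-bilinear; associators and unitors are suppressed; $\mathbf 1$ is the tensor unit. An algebra object $A=(A,m_A,e_A)$ has associative $m_A:A\otimes A\to A$ with unit $e_A:\mathbf 1\to A$; it is separable if $m_A$ has a section $A\to A\otimes A$ that is a morphism of $A$--$A$-bimodules (regular actions on $A$, outer actions on $A\otimes A$); it is connected if $\dim_k\mathrm{Hom}_{\mathcal C}(\mathbf 1,A)=1$. An object occurs as a subobject of $X$ if it is the source of a monomorphism into $X$ in $\mathcal C$. An algebra monomorphism is a unital algebra homomorphism that is a monomorphism in $\mathcal C$. An algebra subobject of $X$ is a pair $(A,i)$ with $A$ an algebra object and $i:A\to X$ an algebra monomorphism; it is separable if $A$ is. $\Gamma(X):=\mathrm{Hom}_{\mathcal C}(\mathbf 1,X)$ is a unital $k$-algebra with product $u\star v=m_X\circ(u\otimes v)$ and unit $e_X$; for $u\in\Gamma(X)^\times$ put $c_u:=m_X\circ(m_X\otimes\mathrm{id}_X)\circ(u\otimes\mathrm{id}_X\otimes u^{-1})$, an algebra automorphism of $X$. Algebra subobjects $(A,i)$, $(A',i')$ are inner conjugate if $c_u\circ i=i'\circ h$ for some $u\in\Gamma(X)^\times$ and algebra isomorphism $h:A\to A'$; they are equivalent over $X$ if $i=i'\circ h$ for some algebra isomorphism $h:A\to A'$. *)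

(* Defs.v *)
From mathcomp Require Import all_boot all_algebra.
From mathcomp Require Import boolp classical_sets cardinality.

Set Implicit Arguments.
Unset Strict Implicit.
Unset Printing Implicit Defensive.

(* Morphism spaces are vectTypes, hence finite-dimensional over k; dimension 0
   is allowed. *)
Record lincat (k : fieldType) := LinCat {
  obj :> Type;
  hom : obj -> obj -> vectType k;
  idm : forall A, hom A A;
  compose : forall A B D, hom B D -> hom A B -> hom A D;
  compA : forall A B D E (h : hom D E) (g : hom B D) (f : hom A B),
    compose h (compose g f) = compose (compose h g) f;
  comp1m : forall A B (f : hom A B), compose (idm B) f = f;
  compm1 : forall A B (f : hom A B), compose f (idm A) = f;
  comp_linl : forall A B D (f : hom A B),
    linear (fun g : hom B D => compose g f);
  comp_linr : forall A B D (g : hom B D),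
    linear (fun f : hom A B => compose g f)
}.

Arguments hom {k C} A B : rename.
Arguments idm {k C} A : rename.
Arguments compose {k C A B D} g f : rename.

Declare Scope mor_scope.
Delimit Scope mor_scope with mor.
Notation "g ∘ f" := (compose g f) (at level 40, left associativity) : mor_scope.
Local Open Scope mor_scope.

(* Not assumed strict: [assoc], [lunit], [runit] are the associator and the
   unitors, and [assocV], [lunitV], [runitV] their inverses. *)
Record moncat (k : fieldType) := MonCat {
  lcat :> lincat k;
  tens : lcat -> lcat -> lcat;
  one : lcat;
  tensm : forall A A' B B' : lcat,
    hom A A' -> hom B B' -> hom (tens A B) (tens A' B');
  tensm1 : forall A B : lcat, tensm (idm A) (idm B) = idm (tens A B);
  tensm_comp : forall (A A' A'' B B' B'' : lcat)
      (f' : hom A' A'') (f : hom A A') (g' : hom B' B'') (g : hom B B'),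
    tensm (f' ∘ f) (g' ∘ g) = tensm f' g' ∘ tensm f g;
  tensm_linl : forall (A A' B B' : lcat) (g : hom B B'),
    linear (fun f : hom A A' => tensm f g);
  tensm_linr : forall (A A' B B' : lcat) (f : hom A A'),
    linear (fun g : hom B B' => tensm f g);
  assoc : forall A B D : lcat,
    hom (tens (tens A B) D) (tens A (tens B D));
  assocV : forall A B D : lcat,
    hom (tens A (tens B D)) (tens (tens A B) D);
  assocK : forall A B D : lcat, assocV A B D ∘ assoc A B D = idm _;
  assocVK : forall A B D : lcat, assoc A B D ∘ assocV A B D = idm _;
  assoc_nat : forall (A A' B B' D D' : lcat)
      (f : hom A A') (g : hom B B') (h : hom D D'),
    assoc A' B' D' ∘ tensm (tensm f g) h
    = tensm f (tensm g h) ∘ assoc A B D;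
  lunit : forall A : lcat, hom (tens one A) A;
  lunitV : forall A : lcat, hom A (tens one A);
  lunitK : forall A : lcat, lunitV A ∘ lunit A = idm _;
  lunitVK : forall A : lcat, lunit A ∘ lunitV A = idm _;
  lunit_nat : forall (A A' : lcat) (f : hom A A'),
    lunit A' ∘ tensm (idm one) f = f ∘ lunit A;
  runit : forall A : lcat, hom (tens A one) A;
  runitV : forall A : lcat, hom A (tens A one);
  runitK : forall A : lcat, runitV A ∘ runit A = idm _;
  runitVK : forall A : lcat, runit A ∘ runitV A = idm _;
  runit_nat : forall (A A' : lcat) (f : hom A A'),
    runit A' ∘ tensm f (idm one) = f ∘ runit A;
  pentagon : forall A B D E : lcat,
    assoc A B (tens D E) ∘ assoc (tens A B) D E
    = tensm (idm A) (assoc B D E) ∘ assoc A (tens B D) E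
      ∘ tensm (assoc A B D) (idm E);
  triangle : forall A B : lcat,
    tensm (idm A) (lunit B) ∘ assoc A one B = tensm (runit A) (idm B)
}.

Arguments tens {k C} A B : rename.
Arguments one {k C} : rename.
Arguments tensm {k C A A' B B'} f g : rename.
Arguments assoc {k C} A B D : rename.
Arguments assocV {k C} A B D : rename.
Arguments lunit {k C} A : rename.
Arguments lunitV {k C} A : rename.
Arguments runit {k C} A : rename.
Arguments runitV {k C} A : rename.

Declare Scope obj_scope.
Delimit Scope obj_scope with obj.
Bind Scope obj_scope with obj.
Notation "A ⊗ B" := (tens A B) (at level 38, left associativity) : obj_scope.
Notation "f ⊠ g" := (tensm f g) (at level 38, left associativity) : mor_scope.
Local Open Scope obj_scope.

Definition homdim (k : fieldType) (C : lincat k) (A B : C) : nat :=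
  (\dim {:hom A B})%VS.

Definition monomorphism (k : fieldType) (C : lincat k) (A B : C) (i : hom A B) : Prop :=
  forall (Z : C) (f g : hom Z A), i ∘ f = i ∘ g -> f = g.

Definition isomorphic (k : fieldType) (C : lincat k) (A B : C) : Prop :=
  exists (f : hom A B) (g : hom B A), g ∘ f = idm A /\ f ∘ g = idm B.

Definition occurs_as_subobject (k : fieldType) (C : lincat k) (A X : C) : Prop :=
  exists i : hom A X, monomorphism i.

Record alg_struct (k : fieldType) (C : moncat k) (A : C) := AlgStruct {
  smul : hom (A ⊗ A) A;
  sunit : hom one A;
  smulA : smul ∘ (smul ⊠ idm A) = smul ∘ (idm A ⊠ smul) ∘ assoc A A A;
  smul1m : smul ∘ (sunit ⊠ idm A) = lunit A;
  smulm1 : smul ∘ (idm A ⊠ sunit) = runit A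
}.

Record algebra (k : fieldType) (C : moncat k) := Algebra {
  carrier :> C;
  struct : alg_struct carrier
}.

Definition amul (k : fieldType) (C : moncat k) (A : algebra C) :
  hom (A ⊗ A) A := smul (struct A).
Definition aunit (k : fieldType) (C : moncat k) (A : algebra C) :
  hom one A := sunit (struct A).

Section Algebras.
Variables (k : fieldType) (C : moncat k).
Implicit Types A B X : algebra C.

Definition alg_hom A B (f : hom A B) : Prop :=
  f ∘ amul A = amul B ∘ (f ⊠ f) /\ f ∘ aunit A = aunit B.

Definition alg_mono A B (f : hom A B) : Prop := alg_hom f /\ monomorphism f.

Definition alg_iso A B (f : hom A B) : Prop :=
  alg_hom f /\
  exists g : hom B A, [/\ alg_hom g, g ∘ f = idm A & f ∘ g = idm B].

Definition outer_left A : hom (A ⊗ (A ⊗ A)) (A ⊗ A) :=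
  (amul A ⊠ idm A) ∘ assocV A A A.
Definition outer_right A : hom (A ⊗ A ⊗ A) (A ⊗ A) :=
  (idm A ⊠ amul A) ∘ assoc A A A.

Definition separable_alg A : Prop :=
  exists s : hom A (A ⊗ A),
    [/\ amul A ∘ s = idm A,
        s ∘ amul A = outer_left A ∘ (idm A ⊠ s)
      & s ∘ amul A = outer_right A ∘ (s ⊠ idm A)].

Definition connected_alg A : Prop := homdim (one : C) A = 1.

Definition star X (u v : hom one X) : hom one X :=
  amul X ∘ (u ⊠ v) ∘ lunitV one.

Definition star_inverse X (u v : hom one X) : Prop :=
  star u v = aunit X /\ star v u = aunit X.

(* This is c_u, the argument v standing for the inverse of u. *)
Definition conj_by X (u v : hom one X) : hom X X :=
  amul X ∘ (amul X ⊠ idm X) ∘ (u ⊠ idm X ⊠ v) ∘ (lunitV X ⊠ idm one)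
  ∘ runitV X.

Record alg_subobject X := AlgSubobject {
  sub_alg : algebra C;
  sub_incl : hom sub_alg X;
  sub_mono : alg_mono sub_incl
}.

Definition separable_subobject X (S : alg_subobject X) : Prop :=
  separable_alg (sub_alg S).

Definition inner_conjugate X (S T : alg_subobject X) : Prop :=
  exists u v : hom one X, star_inverse u v /\
  exists h : hom (sub_alg S) (sub_alg T),
    alg_iso h /\ conj_by u v ∘ sub_incl S = sub_incl T ∘ h.

Definition equivalent_over X (S T : alg_subobject X) : Prop :=
  exists h : hom (sub_alg S) (sub_alg T),
    alg_iso h /\ sub_incl S = sub_incl T ∘ h.

Definition admits_alg_mono X (B : C) : Prop :=
  exists (s : alg_struct B) (i : hom B X), @alg_mono (Algebra s) X i.

Definition subobject_representatives X (M : nat) (Y : 'I_M -> C) : Prop :=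
  [/\ forall j, occurs_as_subobject (Y j) X,
      forall i j, isomorphic (Y i) (Y j) -> i = j
    & forall Z : C, occurs_as_subobject Z X -> exists j, isomorphic Z (Y j)].

(* The truncated predecessor is max(h - 1, 0). *)
Definition class_exponent X (B : C) : nat :=
  let a := homdim (B ⊗ B) B in
  let u := homdim one B in
  let t := homdim (B ⊗ B ⊗ B) B in
  let E := homdim B B in
  let h := homdim B X in
  let c := homdim (B ⊗ B) X in
  minn (a + u) (t + 2 * E) + minn h.-1 c.

End Algebras.

(* R is meant to be an equivalence relation on the elements satisfying P. *)
Definition rel_classes (T : Type) (P : T -> Prop) (R : T -> T -> Prop) :
    set (set T) :=
  [set D | exists2 x, P x & D = [set y | P y /\ R x y]]%classic.

Definition num_classes_le (T : Type) (P : T -> Prop) (R : T -> T -> Prop)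
    (n : nat) : Prop :=
  (rel_classes P R #<= `I_n)%card.

(* Main.v *)
Require Import Defs.
From HB Require Import structures.
From mathcomp Require Import all_boot all_algebra.
From mathcomp Require Import closed_field generic_quotient ring zify.
From mathcomp Require Import boolp classical_sets functions cardinality.

Import Defs.

(** The pairs (structure, map) that have to be classified are points of affine
varieties cut out by polynomials of degree at most 2. A separable algebra has
vanishing Hochschild cohomology in degrees 1 and 2, so it cannot be deformed:
every class fills a neighbourhood of each of its points, and the number of
classes is bounded by the number of irreducible components. A refined form of
Bezout's theorem bounds the latter by 2 to the number of unknowns and also by 2
to the number of equations.

Two such varieties occur. For a fixed object B, the algebra structures are the
pairs (m, e) in Hom(B (x) B, B) + Hom(1, B) satisfying associativity and the unit
laws; this is [structures_bound], where the classes are the orbits of the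
invertible elements of End(B) and the tangent space of an orbit is found with
H^2(A, A) = 0 ([cocycle2_trivial]). For a fixed separable algebra A, the algebra
maps A -> X lie in the affine space of maps preserving the unit, of dimension at
most max(h - 1, 0), and are cut out by the quadratic equation of multiplicativity;
this is [homs_bound], where the classes are the orbits of conjugation by
invertible elements of Gamma(X) and the tangent spaces come from H^1(A, X) = 0
([derivation_inner]). Multiplying the two bounds and summing over the objects B
gives the theorem; if X is connected, the invertible elements of Gamma(X) are
scalars, conjugation is trivial, and inner conjugacy is equivalence over X.

The geometric input is proved without dimension theory
([quadric_families_bound], [quadratic_families_bound]). Each class is the image
of a polynomial family y |-> P(y) in homogeneous coordinates, and cohomology
vanishing says that at a base point the derivative of P, together with P itself,
spans the kernel of the linearised equations. Let d be the dimension of the i-th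
class and c = n - d. Replace the equations by min(n, m) generic combinations g_j,
with g_j = 0 for the remaining j < n, choose generic linear forms l_0, ..., l_{n-1}
and consider, over polynomials in a small parameter t, the system

  g_j + t^(n-j) X_0 l_{n-1-j} + t^(n+1) X_{j+1}^2 = 0      (0 <= j < n),

the rows beyond min(n, m) being divided by X_0 and made linear.

- Each class contributes one approximate zero. By elimination theory
  ([generic_solution]) the class meets l_0 = ... = l_{d-1} = 0 transversally in
  some point, for all classes at once. Because the exponents of t decrease with
  j, the substitution X = P(y) + t^(d+1) w turns the perturbed system into one
  whose reduction at t = 0 has a nondegenerate zero: the first c rows determine w
  and the others determine y. Hensel lifting then solves the system modulo any
  power of t ([zeros_near_family]).

- There are at most 2^min(n, m) such zeros ([perturbed_zeros_bound]). The top
  power of t makes X_{j+1}^2 (or X_{j+1}) the dominant term, so monomials reduce to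
  squarefree ones in min(n, m) letters; more points than such monomials would
  admit a linear relation that is contradicted by separating the points. *)

Set Implicit Arguments.
Unset Strict Implicit.
Unset Printing Implicit Defensive.
Import GRing.Theory.

(** * Classes of a relation and pairwise unrelated families *)

Section Counting.

Lemma card_fibers (I J : finType) (f : I -> J) a b :
  (#|[set f i | i : I]| <= a)%N -> (forall j, #|[set i | f i == j]| <= b)%N ->
  (#|I| <= a * b)%N.
Proof.
move=> Ha Hb; rewrite -sum1_card (partition_big_imset f) /=.
apply: leq_trans (leq_mul Ha (leqnn b)); rewrite -sum_nat_const.
apply: leq_sum => j _; apply: leq_trans (Hb j); rewrite -sum1_card.
by rewrite leq_eqVlt; apply/orP; left; apply/eqP; apply: eq_bigl => i; rewrite !inE.
Qed.

Variables (T : Type) (P : T -> Prop) (R : T -> T -> Prop).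
Hypothesis Rsym : forall x y, R x y -> R y x.
Hypothesis Rtrans : forall x y z, R x y -> R y z -> R x z.

Definition inequivalent r (x : 'I_r -> T) :=
  (forall i, P (x i)) /\ (forall i j, i != j -> ~ R (x i) (x j)).

(** A maximal family of pairwise unrelated elements meets every class, since
otherwise it could be enlarged; so it suffices to bound such families. *)
Lemma num_classes_le_family n :
  (forall r (x : 'I_r -> T), inequivalent x -> (r <= n)%N) -> num_classes_le P R n.
Proof.
move=> H; pose ex r := `[< exists x : 'I_r -> T, inequivalent x >].
have ex0 : exists r, ex r.
  by exists 0%N; apply/asboolP; exists (fun i : 'I_0 => match i with Ordinal m lm => False_rect _ (notF lm) end); split; case.
have exn r : ex r -> (r <= n)%N by move=> /asboolP[x /H].
case: (ex_maxnP ex0 exn) => m /asboolP[x [xP xR]] mmax.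
pose F (i : nat) : set T := [set y | exists2 j : 'I_m, j = i :> nat & P y /\ R (x j) y]%classic.
have sub : (rel_classes P R `<=` F @` `I_m)%classic.
  move=> D [x0 Px0 ->].
  have [i Ri] : exists i, R (x i) x0.
    apply: contrapT => nR; have nR' i : ~ R (x i) x0 by move=> Ri; apply: nR; exists i.
    (* Otherwise x0 could be added to the family. *)
    have : ex m.+1; last by move/mmax; rewrite ltnn.
    apply/asboolP; exists (fun i => if unlift ord0 i is Some j then x j else x0); split.
      by move=> i; case: unliftP.
    move=> i j; case: unliftP => [i' ->|->]; case: unliftP => [j' ->|->] //.
    - by move=> ij; apply: xR; apply: contraNneq ij => ->.
    - by move=> _ /Rsym; apply: nR'.
  exists i; first by rewrite /= ltn_ord.
  apply/seteqP; split=> y.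
    move=> [j ji [Py Rj]]; split=> //; apply: Rtrans (Rsym Ri) _.
    by rewrite (_ : i = j) //; apply: val_inj.
  by move=> [Py Ry]; exists i => //; split=> //; apply: Rtrans Ri Ry.
apply: card_le_trans (subset_card_le sub) _.
apply: card_le_trans (card_image_le _ _) _.
apply: subset_card_le => i /= im; apply: leq_trans im (exn _ _).
by apply/asboolP; exists x.
Qed.
End Counting.

Local Open Scope ring_scope.

(** * Polynomial expressions, first-order expansions and Hensel lifting *)

(** Polynomials are kept as syntax, so that one expression can be evaluated at
points, evaluated at polynomial curves, differentiated, homogenised and turned
into a first-order term. Variables are numbered by natural numbers and an
environment assigns a value to each. *)
Inductive pex (k : Type) : Type :=
| PCst of k
| PVar of nat
| PAdd of pex k & pex k
| PMul of pex k & pex k.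
Arguments PVar {k}.

Section PolynomialExpressions.
Variable k : fieldType.
Implicit Types (x y : pex k) (p q : {poly k}).

Fixpoint pex_eval (R : comNzRingType) (phi : k -> R) x (e : nat -> R) : R :=
  match x with
  | PCst c => phi c
  | PVar i => e i
  | PAdd a b => pex_eval phi a e + pex_eval phi b e
  | PMul a b => pex_eval phi a e * pex_eval phi b e
  end.

Definition pev x (e : nat -> k) : k := pex_eval (R := k) id x e.
Definition pevX x (e : nat -> {poly k}) : {poly k} := pex_eval polyC x e.

(** The derivative at [e] in the direction [h]. *)
Fixpoint pdv x (e h : nat -> k) : k :=
  match x with
  | PCst c => 0
  | PVar i => h i
  | PAdd a b => pdv a e h + pdv b e h
  | PMul a b => pdv a e h * pev b e + pev a e * pdv b e h
  end.

Lemma eq_pex_eval (R : comNzRingType) (phi : k -> R) x e e' :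
  e =1 e' -> pex_eval phi x e = pex_eval phi x e'.
Proof. by move=> ee; elim: x => //= a -> b ->. Qed.

Lemma horner_pevX x e t : (pevX x e).[t] = pev x (fun i => (e i).[t]).
Proof.
rewrite /pevX /pev; elim: x => //=.
- by move=> c; rewrite hornerC.
- by move=> a IHa b IHb; rewrite hornerD IHa IHb.
- by move=> a IHa b IHb; rewrite hornerM IHa IHb.
Qed.

Lemma pevX_congr q x e e' :
  (forall i, q %| e i - e' i) -> q %| pevX x e - pevX x e'.
Proof.
move=> ee; rewrite /pevX; elim: x => //=.
- by move=> c; rewrite subrr dvdp0.
- move=> a IHa b IHb.
  set A := pex_eval _ _ _; set B := pex_eval _ _ _.
  by rewrite opprD addrACA dvdp_addr.
- move=> a; move: (pex_eval _ a e) (pex_eval _ a e') => A A' IHa.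
  move=> b; move: (pex_eval _ b e) (pex_eval _ b e') => B B' IHb.
  have -> : A * B - A' * B' = (A - A') * B + A' * (B - B') by ring.
  by apply: dvdp_add; [apply: dvdp_mulr | apply: dvdp_mull].
Qed.

Lemma eq_pdv x e e' h h' : e =1 e' -> h =1 h' -> pdv x e h = pdv x e' h'.
Proof.
move=> ee hh; elim: x => //= a -> b -> //.
by rewrite /pev !(eq_pex_eval _ _ ee).
Qed.

Lemma pdv0 x e : pdv x e (fun=> 0) = 0.
Proof. by elim: x => //= a -> b ->; rewrite ?addr0 // mul0r mulr0 addr0. Qed.

Lemma pdvD x e h h' : pdv x e (fun i => h i + h' i) = pdv x e h + pdv x e h'.
Proof. by elim: x => //= [c | a -> b -> | a -> b ->]; rewrite ?addr0 //; ring. Qed.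

Lemma pdvZ x e c h : pdv x e (fun i => c * h i) = c * pdv x e h.
Proof. by elim: x => //= [d | a -> b -> | a -> b ->]; rewrite ?mulr0 //; ring. Qed.

Lemma pdv_sum x e (I : finType) (h : I -> nat -> k) :
  pdv x e (fun i => \sum_j h j i) = \sum_j pdv x e (h j).
Proof.
rewrite unlock /=; elim: (index_enum I) => [|j s IHs] /=; first exact: pdv0.
by rewrite pdvD IHs.
Qed.

Lemma dvdX_horner0 p : ('X %| p) = (p.[0] == 0).
Proof. by rewrite -['X]subr0 -polyC0 dvdp_XsubCl. Qed.

Section Jets.
Variables (I : finType) (z0 : I -> k).

(** [hjet z0 F v d] says that, at curves through [z0], the map F has value [v] at
parameter 0 and that moving a curve by h X^N, with N > 0, moves F by (d h) X^N up
to higher order. This is exactly what one step of Hensel lifting uses, and it is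
stable under ring operations without any reference to partial derivatives. *)
Definition hjet (F : (I -> {poly k}) -> {poly k}) (v : k) (d : (I -> k) -> k) :=
  forall z, (forall i, (z i).[0] = z0 i) ->
    (F z).[0] = v /\
    forall N (h : I -> k), 'X^(N.+2) %| F (fun i => z i + h i *: 'X^(N.+1)) - F z - d h *: 'X^(N.+1).

Lemma hjet_eq F F' v v' d d' : hjet F v d -> F =1 F' -> v = v' -> d =1 d' ->
  hjet F' v' d'.
Proof.
move=> H FF <- dd z zz; case: (H z zz) => H1 H2; split=> [|N h].
  by rewrite -FF.
by rewrite -!FF -dd.
Qed.

Lemma hjet_const p : hjet (fun=> p) p.[0] (fun=> 0).
Proof. by move=> z zz; split=> // N h; rewrite scale0r subr0 subrr dvdp0. Qed.

Lemma hjet_var i : hjet (fun z => z i) (z0 i) (fun h => h i).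
Proof.
by move=> z zz; split=> // N h; rewrite (addrC (z i)) addrK subrr dvdp0.
Qed.

Lemma hjetD F G v w d e : hjet F v d -> hjet G w e ->
  hjet (fun z => F z + G z) (v + w) (fun h => d h + e h).
Proof.
move=> HF HG z zz; case: (HF z zz) => F0 F1; case: (HG z zz) => G0 G1.
split=> [|N h]; first by rewrite hornerD F0 G0.
have := F1 N h; have := G1 N h; set z' := fun i => _.
rewrite scalerDl => G1' F1'; rewrite -(dvdp_addr _ F1') in G1'.
by congr (_ %| _): G1'; ring.
Qed.

Lemma hjetM F G v w d e : hjet F v d -> hjet G w e ->
  hjet (fun z => F z * G z) (v * w) (fun h => d h * w + v * e h).
Proof.
move=> HF HG z zz; case: (HF z zz) => F0 F1; case: (HG z zz) => G0 G1.
split=> [|N h]; first by rewrite hornerM F0 G0.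
have := F1 N h; have := G1 N h; set z' := fun i => _.
move=> /dvdpP[b Hb] /dvdpP[a Ha].
have FE : F z' = F z + d h *: 'X^(N.+1) + a * 'X^(N.+2) by rewrite -Ha; ring.
have GE : G z' = G z + e h *: 'X^(N.+1) + b * 'X^(N.+2) by rewrite -Hb; ring.
have /dvdpP[f Hf] : 'X %| F z - v%:P by rewrite dvdX_horner0 !hornerE F0 subrr.
have /dvdpP[g Hg] : 'X %| G z - w%:P by rewrite dvdX_horner0 !hornerE G0 subrr.
have {}Hf : F z = f * 'X + v%:P by rewrite -Hf; ring.
have {}Hg : G z = g * 'X + w%:P by rewrite -Hg; ring.
rewrite FE GE scalerDl -!mul_polyC !rmorphM /=; apply/dvdpP.
exists (a * (G z + e h *: 'X^(N.+1) + b * 'X^(N.+2)) + b * (F z + d h *: 'X^(N.+1))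
  + (d h * e h)%:P * 'X^N + (d h)%:P * g + (e h)%:P * f).
rewrite -!mul_polyC Hf Hg !exprS !rmorphM /=; ring.
Qed.

Lemma hjet_sum (J : finType) (F : J -> (I -> {poly k}) -> {poly k}) v d :
  (forall j, hjet (F j) (v j) (d j)) ->
  hjet (fun z => \sum_j F j z) (\sum_j v j) (fun h => \sum_j d j h).
Proof.
move=> H; rewrite unlock /=; elim: (index_enum J) => [|j s IHs] /=.
  by apply: hjet_eq (hjet_const 0) _ _ _; rewrite ?horner0.
exact: hjetD.
Qed.

Lemma hjetZ c F v d : hjet F v d ->
  hjet (fun z => c *: F z) (c * v) (fun h => c * d h).
Proof.
move=> HF; apply: (hjet_eq (hjetM (hjet_const c%:P) HF)) => [z||h] //=.
- by rewrite mul_polyC.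
- by rewrite hornerC.
- by rewrite mul0r add0r hornerC.
Qed.

Lemma hjet_pex x F v d : (forall i, hjet (F i) (v i) (d i)) ->
  hjet (fun z => pevX x (fun i => F i z)) (pev x v)
       (fun h => pdv x v (fun i => d i h)).
Proof.
move=> H; elim: x => /=.
- by move=> c; apply: hjet_eq (hjet_const c%:P) _ _ _; rewrite ?hornerC.
- by move=> i; apply: H.
- by move=> a IHa b IHb; apply: hjetD IHa IHb.
- by move=> a IHa b IHb; apply: hjetM IHa IHb.
Qed.

(** Successive approximation: if the system vanishes modulo X^N, the
surjectivity of the differential provides a correction of order N that removes
the coefficient of X^N. *)
Lemma hensel (J : finType) (G : J -> (I -> {poly k}) -> {poly k}) d :
  (forall j, hjet (G j) 0 (d j)) ->
  (forall r : J -> k, exists h, forall j, d j h = r j) ->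
  forall N, exists2 z, (forall i, (z i).[0] = z0 i) & forall j, 'X^N %| G j z.
Proof.
move=> HG Hd; case=> [|N].
  by exists (fun i => (z0 i)%:P) => [i|j]; rewrite ?hornerC // expr0 dvd1p.
elim: N => [|N [z zz Hz]].
  exists (fun i => (z0 i)%:P) => [i|j]; first by rewrite hornerC.
  rewrite expr1 dvdX_horner0; apply/eqP.
  by case: (HG j (fun i => (z0 i)%:P)) => // i; rewrite hornerC.
have Hq j : exists q, G j z == q * 'X^(N.+1) by have /dvdpP[q ->] := Hz j; exists q.
pose q j := xchoose (Hq j).
have qE j : G j z = q j * 'X^(N.+1) by apply/eqP: (xchooseP (Hq j)).
(* The correction cancels the coefficient of X^(N+1) in every equation. *)
have [h Hh] := Hd (fun j => - (q j).[0]).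
exists (fun i => z i + h i *: 'X^(N.+1)) => [i|j].
  by rewrite !hornerE expr0n /= mulr0 addr0.
case: (HG j z zz) => _ /(_ N h); rewrite Hh qE => D.
have /dvdpP[a Ha] : 'X %| q j - (q j).[0]%:P.
  by rewrite dvdX_horner0 !hornerE subrr.
set Gz := G j _ in D *.
have -> : Gz = (Gz - q j * 'X^(N.+1) - - (q j).[0] *: 'X^(N.+1)) + a * 'X^(N.+2).
  rewrite ['X^(N.+2)]exprS mulrA -Ha -mul_polyC rmorphN /=; ring.
by apply: dvdp_add => //; apply: dvdp_mull.
Qed.
End Jets.
End PolynomialExpressions.

(** * Polynomial conditions on affine space over an algebraically closed field *)

Section Nonvanishing.
Variable k : closedFieldType.
Implicit Types (x y : pex k) (p q : {poly k}) (s e : seq k).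

Lemma poly_neq0_nonroot p : p != 0 -> exists t, p.[t] != 0.
Proof.
by move=> /closed_nonrootP[t pt]; exists t.
Qed.

Lemma poly_eq0_horner p : (forall t, p.[t] = 0) -> p = 0.
Proof.
move=> H; apply/eqP/negPn/negP => /poly_neq0_nonroot[t].
by rewrite H eqxx.
Qed.

Definition nonzero_pex x := exists s, pev x (nth 0 s) != 0.

(** Affine space is irreducible: restricted to the line through a nonzero of each
factor, both factors are nonzero polynomials in one variable. *)
Lemma nonzero_PMul x y : nonzero_pex x -> nonzero_pex y -> nonzero_pex (PMul x y).
Proof.
move=> [a Ha] [b Hb].
pose e i := (nth 0 a i)%:P + (nth 0 b i - nth 0 a i) *: 'X.
have e0 : (fun i => (e i).[0]) =1 nth 0 a by move=> i; rewrite hornerD hornerC hornerZ hornerX mulr0 addr0.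
have e1 : (fun i => (e i).[1]) =1 nth 0 b.
  by move=> i; rewrite hornerD hornerC hornerZ hornerX mulr1 addrC subrK.
have : pevX x e * pevX y e != 0.
  rewrite mulf_neq0 //; apply/eqP => E0.
    by move/eqP: Ha; rewrite /pev -(eq_pex_eval id x e0) -/(pev _ _) -horner_pevX E0 horner0.
  by move/eqP: Hb; rewrite /pev -(eq_pex_eval id y e1) -/(pev _ _) -horner_pevX E0 horner0.
case/poly_neq0_nonroot => t Ht.
exists (mkseq (fun i => (e i).[t]) (maxn (size a) (size b))).
apply: contra_neq Ht => H.
rewrite hornerM !horner_pevX -[RHS]H /pev /=.
congr (_ * _); apply: eq_pex_eval => i.
  case: (ltnP i (maxn (size a) (size b))) => im; first by rewrite nth_mkseq.
  rewrite [RHS]nth_default ?size_mkseq //; move: im; rewrite geq_max => /andP[ia ib].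
  by rewrite /e !nth_default // subrr scale0r addr0 hornerC.
case: (ltnP i (maxn (size a) (size b))) => im; first by rewrite nth_mkseq.
rewrite [RHS]nth_default ?size_mkseq //; move: im; rewrite geq_max => /andP[ia ib].
by rewrite /e !nth_default // subrr scale0r addr0 hornerC.
Qed.

Lemma common_nonzero (I : finType) (H : I -> pex k) :
  (forall i, nonzero_pex (H i)) -> exists s, forall i, pev (H i) (nth 0 s) != 0.
Proof.
move=> HH.
suff [s Hs] : exists s, forall i, i \in index_enum I -> pev (H i) (nth 0 s) != 0.
  by exists s => i; apply: Hs; rewrite mem_index_enum.
have : nonzero_pex (foldr (fun i => PMul (H i)) (PCst 1) (index_enum I)).
  elim: (index_enum I) => [|i r IHr] /=; last exact: nonzero_PMul.
  by exists [::]; rewrite /pev /= oner_eq0.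
case=> s Hs; exists s; move: Hs; elim: (index_enum I) => //= i r IHr.
rewrite {1}/pev /= mulf_eq0 => /norP[Hi Hr] j; rewrite inE => /orP[/eqP->|] //.
exact: IHr.
Qed.

Fixpoint pdeg x : nat :=
  match x with
  | PCst _ => 0
  | PVar _ => 1
  | PAdd a b => maxn (pdeg a) (pdeg b)
  | PMul a b => pdeg a + pdeg b
  end%N.

Definition pex_pow x n := iter n (PMul x) (PCst 1).

(** Homogenisation with respect to a new variable, which is given the number 0,
the others being shifted by one. *)
Fixpoint phom x : pex k :=
  match x with
  | PCst c => PCst c
  | PVar i => PVar i.+1
  | PAdd a b => PAdd (PMul (pex_pow (PVar 0) (pdeg b - pdeg a)) (phom a))
                     (PMul (pex_pow (PVar 0) (pdeg a - pdeg b)) (phom b))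
  | PMul a b => PMul (phom a) (phom b)
  end.

Definition env_cons (T : Type) (z : T) (e : nat -> T) (i : nat) : T :=
  if i is j.+1 then e j else z.

Lemma phom_eval (R : comNzRingType) (phi : {rmorphism k -> R}) x (z : R) (e : nat -> R) :
  pex_eval phi (phom x) (env_cons z (fun i => z * e i)) = z ^+ pdeg x * pex_eval phi x e.
Proof.
have powE f n : pex_eval phi (pex_pow (PVar 0) n) (env_cons z f) = z ^+ n.
  by elim: n => [|n IHn]; rewrite /pex_pow /= ?rmorph1 ?expr0 // IHn exprS.
elim: x => //=.
- by move=> c; rewrite mul1r.
- move=> a IHa b IHb; rewrite !powE IHa IHb !mulrA -!exprD mulrDr.
  by rewrite ![(_ - _ + _)%N]addnC -!maxnE [maxn (pdeg b) _]maxnC.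
- by move=> a IHa b IHb; rewrite IHa IHb exprD; ring.
Qed.

Fixpoint pex_term (f : nat -> nat) x : GRing.term k :=
  match x with
  | PCst c => GRing.Const c
  | PVar i => GRing.Var k (f i)
  | PAdd a b => GRing.Add (pex_term f a) (pex_term f b)
  | PMul a b => GRing.Mul (pex_term f a) (pex_term f b)
  end.

Lemma rterm_pex_term f x : GRing.rterm (pex_term f x).
Proof. by elim: x => //= a -> b ->. Qed.

Lemma eval_pex_term f x e : GRing.eval e (pex_term f x) = pev x (fun i => e`_(f i)).
Proof. by rewrite /pev; elim: x => //= a -> b ->. Qed.

Lemma term_pex (t : GRing.term k) : GRing.rterm t ->
  exists x, forall e, pev x (nth 0 e) = GRing.eval e t.
Proof.
elim: t => //=.
- by move=> i _; exists (PVar i).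
- by move=> c _; exists (PCst c).
- by move=> n _; exists (PCst n%:R).
- by move=> a IHa b IHb /andP[/IHa[x Hx] /IHb[y Hy]]; exists (PAdd x y) => e;
    rewrite /pev /= -/(pev _ _) Hx -/(pev _ _) Hy.
- by move=> a IHa /IHa[x Hx]; exists (PMul (PCst (-1)) x) => e;
    rewrite /pev /= -/(pev _ _) Hx mulN1r.
- by move=> a IHa n /IHa[x Hx]; exists (PMul (PCst n%:R) x) => e;
    rewrite /pev /= -/(pev _ _) Hx mulr_natl.
- by move=> a IHa b IHb /andP[/IHa[x Hx] /IHb[y Hy]]; exists (PMul x y) => e;
    rewrite /pev /= -/(pev _ _) Hx -/(pev _ _) Hy.
- move=> a IHa n /IHa[x Hx]; exists (pex_pow x n) => e.
  by rewrite -Hx /pev; elim: n => //= n IHn; rewrite exprS -IHn.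
Qed.

(** An atom is an equation between polynomials: it holds identically or fails off
a hypersurface. Connectives multiply the exceptional hypersurfaces. *)
Lemma qf_generic (f : GRing.formula k) : GRing.qf_form f -> GRing.rformula f ->
  exists2 H, nonzero_pex H &
  exists b, forall e, pev H (nth 0 e) != 0 -> GRing.qf_eval e f = b.
Proof.
have bin f1 f2 (op : bool -> bool -> bool) :
    (exists2 H, nonzero_pex H &
      exists b, forall e, pev H (nth 0 e) != 0 -> GRing.qf_eval e f1 = b) ->
    (exists2 H, nonzero_pex H &
      exists b, forall e, pev H (nth 0 e) != 0 -> GRing.qf_eval e f2 = b) ->
    exists2 H, nonzero_pex H &
      exists b, forall e, pev H (nth 0 e) != 0 ->
        op (GRing.qf_eval e f1) (GRing.qf_eval e f2) = b.
  move=> [H nH [b Hb]] [K nK [c Hc]]; exists (PMul H K); first exact: nonzero_PMul.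
  exists (op b c) => e; rewrite {1}/pev /= mulf_eq0 => /norP[He Ke].
  by rewrite Hb // Hc.
elim: f => //=.
- move=> b _ _; exists (PCst 1); last by exists b.
  by exists [::]; rewrite /pev /= oner_eq0.
- move=> t u _ /andP[/term_pex[x Hx] /term_pex[y Hy]].
  pose H := PAdd x (PMul (PCst (-1)) y).
  have HE e : pev H (nth 0 e) = GRing.eval e t - GRing.eval e u.
    by rewrite /pev /= -/(pev x _) -/(pev y _) Hx Hy mulN1r.
  case: (pselect (nonzero_pex H)) => [nH|nH].
    exists H => //; exists false => e; rewrite HE subr_eq0 => tu.
    exact: negbTE.
  exists (PCst 1); first by exists [::]; rewrite /pev /= oner_eq0.
  exists true => e _; apply: contrapT => /negP tu; apply: nH; exists e.
  by rewrite HE subr_eq0.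
- by move=> a IHa b IHb /andP[qa qb] /andP[ra rb]; apply: bin; [apply: IHa|apply: IHb].
- by move=> a IHa b IHb /andP[qa qb] /andP[ra rb]; apply: bin; [apply: IHa|apply: IHb].
- by move=> a IHa b IHb /andP[qa qb] /andP[ra rb]; apply: (bin a b implb); [apply: IHa|apply: IHb].
- move=> a IHa qa ra; case: (IHa qa ra) => H nH [b Hb]; exists H => //.
  by exists (~~ b) => e /Hb ->.
Qed.

(** Quantifier elimination over an algebraically closed field reduces any formula
to the quantifier-free case. *)
Lemma formula_generic (f : GRing.formula k) : GRing.rformula f ->
  exists2 H, nonzero_pex H &
  (forall e, pev H (nth 0 e) != 0 -> GRing.holds e f) \/
  (forall e, pev H (nth 0 e) != 0 -> ~ GRing.holds e f).
Proof.
move=> rf.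
have kcl : GRing.closed_field_axiom k by exact: solve_monicpoly.
have wf := @ClosedFieldQE.wf_ex_elim k.
have ok := ClosedFieldQE.holds_ex_elim kcl.
have /andP[qqf rqf] := GRing.quantifier_elim_wf wf rf.
case: (qf_generic qqf rqf) => H nH [b Hb]; exists H => //.
case: b Hb => Hb; [left|right] => e /Hb Hf.
  by apply/(GRing.quantifier_elim_rformP wf ok e rf).
by move/(GRing.quantifier_elim_rformP wf ok e rf); rewrite Hf.
Qed.

End Nonvanishing.

(** * Hitting a generic value *)

(** Padding by 0 makes a finite vector an environment for polynomial
expressions. *)
Definition ext (R : nmodType) (e : nat) (y : 'I_e -> R) (i : nat) : R :=
  if insub i is Some j then y j else 0.

Lemma ext_ord (R : nmodType) (e : nat) (y : 'I_e -> R) (i : 'I_e) : ext y i = y i.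
Proof. by rewrite /ext valK. Qed.

Lemma ext_out (R : nmodType) (e : nat) (y : 'I_e -> R) i : (e <= i)%N -> ext y i = 0.
Proof. by move=> ei; rewrite /ext insubF // ltnNge ei. Qed.

Lemma mkseq_env (R : nmodType) (f : nat -> R) n : (forall i, (n <= i)%N -> f i = 0) ->
  forall i, nth 0 (mkseq f n) i = f i.
Proof.
move=> fn i; case: (ltnP i n) => im; first by rewrite nth_mkseq.
by rewrite nth_default ?size_mkseq // fn.
Qed.

Section GenericSolution.
Variable k : closedFieldType.

Lemma hjet_ext (I : finType) (z0 : I -> k) e (Y : 'I_e -> (I -> {poly k}) -> {poly k}) v d :
  (forall i, hjet z0 (Y i) (v i) (d i)) ->
  forall i, hjet z0 (fun z => ext (fun j => Y j z) i) (ext v i)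
    (fun h => ext (fun j => d j h) i).
Proof.
move=> H i; rewrite /ext; case: insubP => [j _ _|_]; first exact: H.
by apply: (hjet_eq (hjet_const 0)); rewrite ?horner0.
Qed.

Lemma holds_conjunction e (I : eqType) (F : I -> GRing.formula k) (r : seq I) :
  GRing.holds e (foldr (fun i => GRing.And (F i)) (GRing.Bool true) r) <->
  (forall i, i \in r -> GRing.holds e (F i)).
Proof.
elim: r => [|i r IHr] /=; first by split.
split=> [[Fi /IHr Fr] j|H]; first by rewrite inE => /orP[/eqP->|/Fr].
split; first by apply: H; rewrite mem_head.
by apply/IHr => j jr; apply: H; rewrite inE jr orbT.
Qed.

Fixpoint pex_sub (f : nat -> pex k) (x : pex k) : pex k :=
  match x with
  | PCst c => PCst c
  | PVar i => f i
  | PAdd a b => PAdd (pex_sub f a) (pex_sub f b)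
  | PMul a b => PMul (pex_sub f a) (pex_sub f b)
  end.

Lemma pev_sub f x e : pev (pex_sub f x) e = pev x (fun i => pev (f i) e).
Proof. by rewrite /pev; elim: x => //= a -> b ->. Qed.

(** A rational map R / R0 from e-space to d-space that is submersive at one point
takes every generic value at a point where a prescribed polynomial Z does not
vanish. The property of being such a value is first order, so it holds
generically or fails generically. If it failed generically, some nonzero
polynomial H would vanish on the image; but by Hensel lifting every line through
the image of the base point is, to any order, the image of a curve, which forces
H to vanish on that line. *)
Lemma generic_solution e d (R0 : pex k) (R : 'I_d -> pex k) (Z : pex k)
    (y0 : 'I_e -> k) (U : 'I_d -> 'I_e -> k) :
  pev Z (ext y0) != 0 ->
  (forall y : 'I_e -> k, pev Z (ext y) != 0 -> pev R0 (ext y) != 0) ->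
  (forall r : 'I_d -> k, exists h : 'I_d -> k, forall j,
     let u := ext (fun i => \sum_l h l * U l i) in
     pdv (R j) (ext y0) u * pev R0 (ext y0)
     - pev (R j) (ext y0) * pdv R0 (ext y0) u = r j) ->
  exists2 H, nonzero_pex H & forall s, pev H (nth 0 s) != 0 ->
  exists2 y : 'I_e -> k, pev Z (ext y) != 0 &
    forall j, pev (R j) (ext y) = s`_j * pev R0 (ext y).
Proof.
move=> Zy0 ZR0 surj.
pose f i : pex k := if (i < e)%N then PVar (d + i)%N else PCst 0.
pose tm x := pex_term id (pex_sub f x).
pose yof (s : seq k) := fun i : 'I_e => s`_(d + i).
have tmE s x : GRing.eval s (tm x) = pev x (ext (yof s)).
  rewrite eval_pex_term pev_sub; apply: eq_pex_eval => i.
  rewrite /f; case: ltnP => ie; last by rewrite ext_out.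
  by rewrite -[i]/(val (Ordinal ie)) ext_ord.
pose body := GRing.And (GRing.Not (GRing.Equal (tm Z) (GRing.Const 0)))
  (foldr (fun j : 'I_d => GRing.And (GRing.Equal (tm (R j))
      (GRing.Mul (GRing.Var k j) (tm R0)))) (GRing.Bool true) (enum 'I_d)).
have bodyP s : GRing.holds s body <->
   (pev Z (ext (yof s)) != 0 /\
    forall j, pev (R j) (ext (yof s)) = s`_j * pev R0 (ext (yof s))).
  rewrite /body /= holds_conjunction /= tmE; split=> [[/eqP Zs H]|[/eqP Zs H]].
    by split=> // j; have := H j; rewrite mem_enum => /(_ isT); rewrite !tmE.
  by split=> // j _; rewrite !tmE.
have rbody : GRing.rformula (foldr (GRing.Exists (R := k)) body (iota d e)).
  have -> : GRing.rformula (foldr (GRing.Exists (R := k)) body (iota d e))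
            = GRing.rformula body by elim: (iota d e).
  rewrite /= rterm_pex_term /=.
  by elim: (enum 'I_d) => //= j r ->; rewrite !rterm_pex_term.
have [H nH [HT|HF]] := formula_generic rbody; exists H => // s.
  move/HT/GRing.foldExistsP => [s' ss' /bodyP[Zs' Es']].
  exists (yof s') => // j; rewrite Es' -ss' //.
  by rewrite !inE /= mem_iota negb_and -ltnNge ltn_ord.
(* It remains to exclude that the property fails generically. The line sg joins
the image s0 of the base point to a point s1 with H(s1) != 0. *)
exfalso; move: nH => [s1 Hs1].
have R0y0 := ZR0 _ Zy0.
pose s0 (j : 'I_d) := pev (R j) (ext y0) / pev R0 (ext y0).
pose sg (j : 'I_d) : {poly k} := (s0 j)%:P + (s1`_j - s0 j) *: 'X.
pose Y (z : 'I_d -> {poly k}) (i : 'I_e) : {poly k} := (y0 i)%:P + \sum_l U l i *: z l.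
pose G j z := pevX (R j) (ext (Y z)) - sg j * pevX R0 (ext (Y z)).
have jY i : hjet (fun=> 0) (fun z => ext (Y z) i) (ext y0 i)
    (fun h => ext (fun i => \sum_l h l * U l i) i).
  apply: hjet_ext => {}i; apply: hjet_eq (hjetD (hjet_const (y0 i)%:P)
    (hjet_sum (fun l => hjetZ (U l i) (hjet_var l)))) _ _ _ => //.
    by rewrite hornerC big1 ?addr0 // => l _; rewrite mulr0.
  by move=> h; rewrite add0r; apply: eq_bigr => l _; rewrite mulrC.
have jG j := hjetD (hjet_pex (R j) jY)
  (hjetZ (-1) (hjetM (hjet_const (sg j)) (hjet_pex R0 jY))).
pose u (h : 'I_d -> k) := ext (fun i => \sum_l h l * U l i).
have {}jG j : hjet (fun=> 0) (G j) 0 (fun h => pdv (R j) (ext y0) (u h)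
     - s0 j * pdv R0 (ext y0) (u h)).
  apply: hjet_eq (jG j) _ _ _ => [z||h]; first by rewrite /G scaleN1r.
    by rewrite hornerD hornerC hornerZ hornerX mulr0 addr0 mulN1r divfK // subrr.
  by rewrite hornerD hornerC hornerZ hornerX mulr0 addr0 mul0r add0r mulN1r.
pose env i : {poly k} := if insub i is Some j then sg j else (s1`_i)%:P.
pose p := pevX H env.
have p1 : p.[1] != 0.
  rewrite horner_pevX; congr (_ != 0): Hs1; apply: eq_pex_eval => i.
  rewrite /env; case: insubP => [j _ <-|_]; last by rewrite hornerC.
  by rewrite hornerD hornerC hornerZ hornerX mulr1 addrC subrK.
have p0 : p != 0 by apply: contraNneq p1 => ->; rewrite horner0.
have [|z z0 Hz] := hensel jG _ (size p).
  move=> r; have [h Hh] := surj (fun j => r j * pev R0 (ext y0)).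
  exists h => j; apply: (mulIf R0y0); rewrite -Hh mulrBl; congr (_ - _).
  by rewrite mulrAC divfK.
pose y := Y z.
pose r0 := pevX R0 (ext y).
have yt (t : k) x : (pevX x (ext y)).[t] = pev x (ext (fun i => (y i).[t])).
  rewrite horner_pevX; apply: eq_pex_eval => i.
  by rewrite /ext; case: insubP => // _; rewrite horner0.
have y0E (x : pex k) : (pevX x (ext y)).[0] = pev x (ext y0).
  rewrite yt; apply: eq_pex_eval => i; rewrite /ext; case: insubP => // j _ _.
  rewrite /y /Y hornerD hornerC horner_sum big1 ?addr0 // => l _.
  by rewrite hornerZ z0 mulr0.
(* H evaluated in homogeneous form along the image of the curve: it is 0, as
the image avoids the locus H != 0 of failure. *)
pose henv := env_cons r0 (fun i => if insub i is Some j then pevX (R j) (ext y)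
                               else s1`_i *: r0).
pose Hh := pevX (phom H) henv.
have ZHh : pevX Z (ext y) * Hh = 0.
  apply: poly_eq0_horner => t; rewrite hornerM.
  have [->|Zt] := eqVneq (pevX Z (ext y)).[t] 0; first by rewrite mul0r.
  apply/eqP; rewrite mulf_eq0 (negPf Zt) /=; apply/eqP.
  rewrite yt in Zt; have R0t := ZR0 _ Zt; rewrite -yt -/r0 in R0t.
  pose st i : k := if insub i is Some j then (pevX (R j) (ext y)).[t] / r0.[t] else s1`_i.
  (* Long enough for the value and the parameters of the family. *)
  pose M := (d + e + size s1)%N.
  have stM i : (M <= i)%N -> st i = 0.
    rewrite /M -addnA => Mi; rewrite /st insubF; last first.
      by apply/negbTE; rewrite -leqNgt; apply: leq_trans Mi; rewrite leq_addr.
    by rewrite nth_default //; apply: leq_trans Mi; rewrite addnA leq_addl.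
  have HhE : Hh.[t] = r0.[t] ^+ pdeg H * pev H st.
    rewrite horner_pevX /pev -(phom_eval idfun); apply: eq_pex_eval => -[|i] //=.
    rewrite /st; case: insubP => [j _ _|_]; first by rewrite mulrC divfK.
    by rewrite hornerZ mulrC.
  rewrite HhE; apply/eqP; rewrite mulf_eq0; apply/orP; right; apply: contraTT isT => Hst.
  have /HF : pev H (nth 0 (mkseq st M)) != 0.
    by congr (_ != 0): Hst; apply: eq_pex_eval => i; rewrite mkseq_env.
  case; apply/GRing.foldExistsP.
  pose st' i := if (d <= i < d + e)%N then ext (fun i => (y i).[t]) (i - d) else st i.
  have st'M i : (M <= i)%N -> st' i = 0.
    move=> Mi; have dei : (d + e <= i)%N by apply: leq_trans Mi; rewrite leq_addr.
    by rewrite /st' [(i < _)%N]ltnNge dei andbF stM.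
  exists (mkseq st' M) => [i|].
    by rewrite !inE mem_iota => iI; rewrite !mkseq_env // /st' (negPf iI).
  have yofE : ext (yof (mkseq st' M)) =1 ext (fun i => (y i).[t]).
    move=> i; rewrite /ext; case: insubP => // j _ _; rewrite /yof mkseq_env //.
    by rewrite /st' leq_addr ltn_add2l ltn_ord /= addKn ext_ord.
  have yofP (x : pex k) : pev x (ext (yof (mkseq st' M))) = (pevX x (ext y)).[t].
    by rewrite yt; apply: eq_pex_eval.
  apply/bodyP; split=> [|j]; first by rewrite yofP yt.
  rewrite !yofP mkseq_env // /st' leqNgt ltn_ord /= /st valK -/r0 divfK //.
have Hh0 : Hh = 0.
  apply/eqP; move/eqP: ZHh; rewrite mulf_eq0 => /orP[/eqP Z0|] //.
  by move: Zy0; rewrite -y0E Z0 horner0 eqxx.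
(* To an order beyond the degree of p the image of the curve is the line sg. *)
have : 'X^(size p) %| Hh - pevX (phom H) (env_cons r0 (fun i => r0 * env i)).
  apply: pevX_congr => -[|i] /=; first by rewrite subrr dvdp0.
  rewrite /env; case: insubP => [j _ _|_]; first by rewrite mulrC; apply: Hz.
  by rewrite mulrC mul_polyC subrr dvdp0.
rewrite Hh0 sub0r dvdpNr /pevX (phom_eval (polyC : {rmorphism k -> {poly k}})).
rewrite Gauss_dvdpr; first by move/(dvdp_leq p0); rewrite size_polyXn ltnn.
rewrite coprimep_expl // coprimep_expr // coprimep_sym -[X in coprimep _ X]subr0.
by rewrite -polyC0 coprimep_XsubC rootE y0E.
Qed.
End GenericSolution.

(** * Linear algebra over polynomials in one variable *)

Lemma fraction_num (R : idomainType) (x : {fraction R}) :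
  exists n d : R, d != 0 /\ x * FracField.tofrac d = FracField.tofrac n.
Proof.
elim/quotW: x => x; exists x.1, x.2; split; first exact: denom_ratioP.
rewrite !piE; apply/eqmodP => /=.
by rewrite FracField.equivfE /FracField.mulf !numden_Ratio
  ?oner_neq0 ?mulf_neq0 ?denom_ratioP ?oner_neq0 //= !mulr1 mulrC.
Qed.

(** Linear algebra over the field of fractions, followed by clearing
denominators. *)
Lemma rows_dependent (R : idomainType) r q (A : 'M[R]_(r, q)) : (q < r)%N ->
  exists2 c : 'rV[R]_r, c != 0 & c *m A = 0.
Proof.
move=> qr; pose B := map_mx (@FracField.tofrac R) A.
have : kermx B != 0.
  rewrite kermx_eq0 -row_leq_rank -ltnNge; apply: leq_ltn_trans qr.
  exact: rank_leq_col.
case/rowV0Pn => v /sub_kermxP vB v0.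
have /choice[num /choice[den Hnd]] : forall i : 'I_r, exists n d : R,
    d != 0 /\ v 0 i * FracField.tofrac d = FracField.tofrac n.
  by move=> i; apply: fraction_num.
pose c : 'rV[R]_r := \row_i (num i * \prod_(j | j != i) den j).
have pd : \prod_j den j != 0 by apply/prodf_neq0 => j _; case: (Hnd j).
have cE : map_mx (@FracField.tofrac R) c = FracField.tofrac (\prod_j den j) *: v.
  apply/rowP => i; rewrite !mxE [in RHS](bigD1 i) //= !tofracM.
  by case: (Hnd i) => _ <-; ring.
exists c.
  apply: contraNneq v0 => c0; apply/eqP.
  have : FracField.tofrac (\prod_j den j) *: v = 0 by rewrite -cE c0 map_mx0.
  by move/eqP; rewrite scaler_eq0 tofrac_eq0 (negPf pd) /= => /eqP.
apply/matrixP => i j.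
have := congr1 (fun M : 'M__ => M i j) (map_mxM (@FracField.tofrac R) c A).
rewrite cE -scalemxAl vB scaler0 !mxE => /eqP; rewrite tofrac_eq0 => /eqP E.
exact: E.
Qed.

Section PolyRows.
Variable k : closedFieldType.

Lemma max_dvdXn (p : {poly k}) : p != 0 -> ~~ ('X^(size p) %| p).
Proof. by move=> p0; apply/negP => /(dvdp_leq p0); rewrite size_polyXn ltnn. Qed.

(** After division by the largest common power of X the relation is still
nontrivial at X = 0. *)
Lemma poly_rows_dependent r q (A : 'M[{poly k}]_(r, q)) : (q < r)%N ->
  exists c : 'I_r -> {poly k}, (exists i, (c i).[0] != 0) /\
    forall j, \sum_i c i * A i j = 0.
Proof.
move=> qr; have [c c0 cA] := rows_dependent A qr.
have [i0 ci0] : exists i, c 0 i != 0.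
  by apply/existsP; apply: contra_neqT c0 => /existsPn H; apply/rowP => i;
    rewrite mxE; apply/eqP; move: (H i); rewrite negbK.
pose P m := [forall i, 'X^m %| c 0 i].
have P0 : exists m, P m by exists 0%N; apply/forallP => i; rewrite expr0 dvd1p.
have Pm m : P m -> (m <= size (c 0%R i0))%N.
  move=> /forallP/(_ i0)/(dvdp_leq ci0); rewrite size_polyXn; exact: ltnW.
case: (ex_maxnP P0 Pm) => m cm mmax.
exists (fun i => c 0 i %/ 'X^m); split.
  apply: contrapT => H; have : P m.+1.
    apply/forallP => i; rewrite -[c 0 i](divpK (forallP cm i)) exprS dvdp_mul //.
    by rewrite dvdX_horner0; apply/negPn/negP => Hi; apply: H; exists i.
  by move/mmax; rewrite ltnn.
have {}cm i : 'X^m %| c 0 i by move/forallP: cm.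
move=> j; have Xm0 : ('X^m : {poly k}) != 0 by rewrite monic_neq0 ?monicXn.
apply: (mulIf Xm0); rewrite mul0r mulr_suml.
have := congr1 (fun M : 'M__ => M 0 j) cA; rewrite !mxE => E; rewrite -[RHS]E.
by apply: eq_bigr => i _; rewrite mulrAC divpK ?cm.
Qed.

(** Substituting 1/t for X and multiplying by t^b turns X^b - L into a matrix of
polynomials in t that equals the identity at t = 0. *)
Lemma det_dominant m b (L : 'M[{poly k}]_m) :
  (forall i j, size (L i j) <= b)%N -> \det (('X^b)%:M - L) != 0.
Proof.
move=> sL.
pose rv (p : {poly k}) : {poly k} := \sum_(l < b) p`_l *: 'X^(b - l).
pose M' : 'M[{poly k}]_m := 1%:M - map_mx rv L.
have dM' : (\det M').[0] = 1.
  rewrite -[_.[0]]/(horner_eval 0 _) -det_map_mx -[RHS](det1 k m); congr (\det _).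
  apply/matrixP => i j; rewrite /M' !mxE /= /horner_eval hornerD hornerN.
  rewrite horner_sum big1 ?subr0 => [|l _].
    by rewrite -mulr_natr hornerM hornerC !hornerE; case: eqP; rewrite ?mulr1 ?mulr0 ?hornerC ?horner0.
  by rewrite hornerZ hornerXn expr0n subn_eq0 leqNgt ltn_ord mulr0.
have : \det M' * 'X != 0.
  by rewrite mulf_neq0 ?polyX_eq0 //; apply/eqP => H; move/eqP: dM'; rewrite H horner0 eq_sym oner_eq0.
case/poly_neq0_nonroot => t; rewrite hornerM hornerX mulf_eq0 => /norP[Mt t0].
apply: contra_neq Mt => H.
have /(congr1 (horner_eval t^-1)) := H; rewrite -det_map_mx /= => Ht.
rewrite -[_.[t]]/(horner_eval t _) -det_map_mx.
have -> : map_mx (horner_eval t) M' = t ^+ b *: map_mx (horner_eval t^-1) (('X^b)%:M - L).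
  apply/matrixP => i j; rewrite /M' !mxE /= /horner_eval !hornerD !hornerN.
  have LE : (rv (L i j)).[t] = t ^+ b * (L i j).[t^-1].
    rewrite (horner_coef_wide _ (sL i j)) horner_sum mulr_sumr.
    apply: eq_bigr => l _; rewrite hornerZ hornerXn exprVn mulrCA.
    by rewrite expfB_cond // (negPf t0) ltnW ?ltn_ord.
  rewrite LE mulrBr; congr (_ - _).
  case: eqP => _; rewrite ?mulr0n ?mulr1n; last by rewrite !horner0 mulr0.
  by rewrite hornerC hornerXn exprVn divff // expf_neq0.
by rewrite detZ Ht /horner_eval horner0 mulr0.
Qed.
End PolyRows.

(** * Counting approximate zeros of a perturbed quadratic system *)

Section Words.
Variables (n D : nat).
Notation word := {ffun 'I_D -> 'I_n.+1}.

(** Words index monomials of degree D with repetition: distinct words may give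
the same monomial. This keeps the substitution of a letter by a linear form, and
the expansion of a product of linear forms, free of multinomial coefficients. *)
Definition wmon (R : comNzRingType) (X : 'I_n.+1 -> R) (w : word) : R :=
  \prod_c X (w c).

Definition upd (w : word) (c : 'I_D) (p : 'I_n.+1) : word :=
  [ffun c' => if c' == c then p else w c'].

Lemma wmon_upd (R : comNzRingType) (X : 'I_n.+1 -> R) w c p :
  wmon X (upd w c p) = X p * \prod_(c' | c' != c) X (w c').
Proof.
rewrite /wmon (bigD1 c) //= ffunE eqxx; congr (_ * _).
by apply: eq_bigr => c' /negPf cc'; rewrite ffunE cc'.
Qed.

Lemma wmon_at (R : comNzRingType) (X : 'I_n.+1 -> R) (w : word) c :
  wmon X w = X (w c) * \prod_(c' | c' != c) X (w c').
Proof. by rewrite /wmon (bigD1 c). Qed.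

Lemma wmon_count (R : comNzRingType) (X : 'I_n.+1 -> R) (w : word) :
  wmon X w = \prod_p X p ^+ #|[pred c | w c == p]|.
Proof.
rewrite /wmon (partition_big w xpredT) //=; apply: eq_bigr => p _.
by rewrite (eq_bigr (fun=> X p)) ?prodr_const // => c /eqP->.
Qed.

Lemma count_sum (w : word) : (\sum_p #|[pred c | w c == p]| = D)%N.
Proof.
rewrite -[RHS]card_ord -sum1_card (partition_big w xpredT) //=.
by apply: eq_bigr => p _; rewrite -sum1_card.
Qed.

Lemma eq_wmon (w w' : word) :
  (forall j : 'I_n, #|[pred c | w c == lift ord0 j]| = #|[pred c | w' c == lift ord0 j]|) ->
  forall (R : comNzRingType) (X : 'I_n.+1 -> R), wmon X w = wmon X w'.
Proof.
move=> E R X; rewrite !wmon_count; apply: eq_bigr => p _; congr (_ ^+ _).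
have [j ->|->] := unliftP ord0 p; first exact: E.
have := etrans (count_sum w) (esym (count_sum w')); rewrite !big_ord_recl.
rewrite (eq_bigr (fun j => #|[pred c | w' c == lift ord0 j]|)) => [|j _]; last exact: E.
exact: addIn.
Qed.

Variable mu : nat.
Hypothesis mun : (mu <= n)%N.

(** The words to which no row of the perturbed system applies: letter 0 is free,
letters 1, ..., mu occur at most once, and the letters beyond do not occur. *)
Definition reduced (w : word) :=
  [forall c, forall j : 'I_n, (w c == lift ord0 j) ==> (j < mu)%N] &&
  [forall c, forall c', forall j : 'I_n,
     [&& w c == lift ord0 j & w c' == lift ord0 j] ==> (c == c')].

Definition letters (w : word) : {set 'I_mu} :=
  [set j | [exists c, w c == lift ord0 (widen_ord mun j)]].

(** The multiplicity of every letter but 0 is 0 or 1 and is read off from the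
set of letters; the length of the word then fixes the multiplicity of 0. *)
Lemma reduced_letters w w' : reduced w -> reduced w' -> letters w = letters w' ->
  forall (R : comNzRingType) (X : 'I_n.+1 -> R), wmon X w = wmon X w'.
Proof.
move=> rw rw' E; apply: eq_wmon => j.
suff H v : reduced v -> #|[pred c | v c == lift ord0 j]| =
    (if insub (val j) is Some j' then j' \in letters v else false) :> nat.
  by rewrite !H // E.
move=> /andP[/forallP H1 /forallP H2].
case: insubP => [j' jm jj'|jm].
  have jE : widen_ord mun j' = j by apply: val_inj.
  rewrite inE jE; case: existsP => [[c vc]|H].
    rewrite (@fintype.eq_card1 _ c) // => c'; rewrite !inE; apply/eqP/eqP => [vc'|-> //].
      apply/eqP; move: (H2 c') => /forallP/(_ c)/forallP/(_ j)/implyP; apply.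
      by rewrite vc' eqxx vc.
    exact/eqP.
  apply: fintype.eq_card0 => c; rewrite !inE; apply/negbTE/negP => vc.
  by apply: H; exists c.
apply: fintype.eq_card0 => c; rewrite !inE; apply: contraNF jm => vc.
by have := H1 c => /forallP/(_ j); rewrite vc.
Qed.

End Words.

Section WordsBound.
Variable k : closedFieldType.
Variables (n mu b r : nat).
Hypothesis mun : (mu <= n)%N.
Variables (a : 'I_n -> 'I_n.+1 -> 'I_n.+1 -> {poly k}) (l : 'I_n -> 'I_n.+1 -> {poly k}).
Hypothesis sa : forall j p q, (size (a j p q) <= b)%N.
Hypothesis sl : forall j p, (size (l j p) <= b)%N.

(** The first [mu] rows have X_{j+1}^2 as dominant term, the others X_{j+1}. *)
Definition perturbed (X : 'I_n.+1 -> {poly k}) (j : 'I_n) : {poly k} :=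
  if (j < mu)%N then
    'X^b * X (lift ord0 j) ^+ 2 + \sum_p \sum_q a j p q * (X p * X q)
  else 'X^b * X (lift ord0 j) + \sum_p l j p * X p.

Lemma sum_fibers (R : pzRingType) (P W : finType) (c : P -> R) (g : P -> W) (M : W -> R) :
  \sum_p c p * M (g p) = \sum_w (\sum_(p | g p == w) c p) * M w.
Proof.
rewrite (partition_big g xpredT) //=; apply: eq_bigr => w _.
by rewrite mulr_suml; apply: eq_bigr => p /eqP->.
Qed.

(** The row attached to a repeated or forbidden letter expresses X^b times the
monomial by monomials with coefficients of degree less than b. *)
Lemma rewrite_word D (w : {ffun 'I_D -> 'I_n.+1}) : ~~ reduced mu w ->
  exists L : {ffun 'I_D -> 'I_n.+1} -> {poly k},
    (forall w', size (L w') <= b)%N /\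
    forall N X, (forall j, 'X^N %| perturbed X j) ->
      'X^N %| 'X^b * wmon X w - \sum_w' L w' * wmon X w'.
Proof.
rewrite negb_and => /orP[/forallPn[c /forallPn[j]]|/forallPn[c /forallPn[c' /forallPn[j]]]].
  rewrite negb_imply => /andP[/eqP wc jmu].
  exists (fun w' => \sum_(p | upd w c p == w') - l j p); split=> [w'|N X HX].
    apply: leq_trans (size_sum _ _ _) _; apply/bigmax_leqP => p _.
    by rewrite size_polyN.
  rewrite -sum_fibers (wmon_at _ _ c) wc.
  under [X in _ - X]eq_bigr do rewrite wmon_upd mulrA.
  rewrite -mulr_suml mulrA -mulrBl dvdp_mulr //.
  have := HX j; rewrite /perturbed (negPf jmu); congr (_ %| _ + _).
  by rewrite -sumrN; apply: eq_bigr => p _; rewrite mulNr opprK.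
rewrite negb_imply => /andP[/andP[/eqP wc /eqP wc'] cc'].
case: (boolP (j < mu)%N) => jmu; last first.
  exists (fun w' => \sum_(p | upd w c p == w') - l j p); split=> [w'|N X HX].
    apply: leq_trans (size_sum _ _ _) _; apply/bigmax_leqP => p _.
    by rewrite size_polyN.
  rewrite -sum_fibers (wmon_at _ _ c) wc.
  under [X in _ - X]eq_bigr do rewrite wmon_upd mulrA.
  rewrite -mulr_suml mulrA -mulrBl dvdp_mulr //.
  have := HX j; rewrite /perturbed (negPf jmu); congr (_ %| _ + _).
  by rewrite -sumrN; apply: eq_bigr => p _; rewrite mulNr opprK.
exists (fun w' => \sum_(pq | upd (upd w c pq.1) c' pq.2 == w') - a j pq.1 pq.2).
split=> [w'|N X HX].
  apply: leq_trans (size_sum _ _ _) _; apply/bigmax_leqP => p _.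
  by rewrite size_polyN.
rewrite -sum_fibers.
pose rest := \prod_(e | (e != c) && (e != c')) X (w e).
have E p q : wmon X (upd (upd w c p) c' q) = (X p * X q) * rest.
  rewrite wmon_upd (bigD1 c) //= ffunE eqxx mulrA [X q * _]mulrC; congr (_ * _).
  apply: eq_big => [e|e /andP[_ /negPf ec]]; first by rewrite andbC.
  by rewrite ffunE ec.
under [X in _ - X]eq_bigr do rewrite E mulrA.
rewrite -mulr_suml (wmon_at _ _ c) wc (bigD1 c') 1?eq_sym //= wc' -/rest.
rewrite [X _ * (_ * _)]mulrA mulrA -mulrBl dvdp_mulr //.
have := HX j; rewrite /perturbed jmu; congr (_ %| _ * _ + _).
rewrite -sumrN (eq_bigr (fun pq => a j pq.1 pq.2 * (X pq.1 * X pq.2))).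
  by rewrite -(pair_bigA _ (fun p q => a j p q * (X p * X q))).
by move=> pq _; rewrite mulNr opprK.
Qed.

Variable x : 'I_r -> 'I_n.+1 -> k.
Hypothesis x0 : forall i, x i ord0 != 0.
Hypothesis xx : forall i j, i != j ->
  exists p, x i p * x j ord0 != x j p * x i ord0.
Hypothesis near : forall N, exists X : 'I_r -> 'I_n.+1 -> {poly k},
  (forall i p, (X i p).[0] = x i p) /\
  forall i j, 'X^N %| perturbed (X i) j.

(** If there were more than 2^mu points, some nontrivial combination of the
corresponding evaluation functionals would vanish on all monomials of reduced
words. The perturbed system relates the values on all words by the matrix
X^b - L, which is nonsingular by [det_dominant]; hence at parameter 0 the
combination vanishes on all words of length r, that is on all products of r
linear forms, and such products separate the points. *)
Lemma perturbed_zeros_bound : (r <= 2 ^ mu)%N.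
Proof.
rewrite leqNgt; apply/negP => rmu.
pose W := {ffun 'I_r -> 'I_n.+1} : finType.
have /choice[L HL] : forall w : W, exists L : W -> {poly k},
    (forall w', size (L w') <= b)%N /\ (reduced mu w -> forall w', L w' = 0) /\
    (~~ reduced mu w -> forall N X, (forall j, 'X^N %| perturbed X j) ->
      'X^N %| 'X^b * wmon X w - \sum_w' L w' * wmon X w').
  move=> w; case: (boolP (reduced mu w)) => rw.
    by exists (fun=> 0); split=> // w'; rewrite size_poly0.
  by have [L [sL HL]] := rewrite_word rw; exists L.
pose ML : 'M[{poly k}]_#|W| := \matrix_(i, j) L (enum_val i) (enum_val j).
have sML i j : (size (ML i j) <= b)%N by rewrite mxE; case: (HL (enum_val i)).
have det0 := det_dominant sML.
set Delta := \det _ in det0.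
(* This power of X exceeds the degree of Delta, hence does not divide it. *)
have [X [X0 HX]] := near (size Delta).
(* By reduced_letters there are only 2^mu conditions on the coefficients c. *)
pose redval i (T : {set 'I_mu}) : {poly k} :=
  if [pick w : W | reduced mu w && (letters mun w == T)] is Some w then wmon (X i) w else 0.
pose A : 'M[{poly k}]_(r, #|{set 'I_mu}|) := \matrix_(i, j) redval i (enum_val j).
have [|c [[i0 ci0] cA]] := poly_rows_dependent A.
  by rewrite -cardsT -powersetT card_powerset cardsT card_ord.
pose S (w : W) := \sum_i c i * wmon (X i) w.
have Sred w : reduced mu w -> S w = 0.
  move=> rw; rewrite -[RHS](cA (enum_rank (letters mun w))).
  apply: eq_bigr => i _; rewrite mxE enum_rankK /redval.
  case: pickP => [w' /andP[rw' /eqP lw']|/(_ w)]; last by rewrite rw eqxx.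
  by congr (_ * _); exact: (reduced_letters rw rw' (esym lw')).
have SL w : 'X^(size Delta) %| 'X^b * S w - \sum_w' L w w' * S w'.
  case: (boolP (reduced mu w)) => rw.
    rewrite Sred // mulr0 big1 ?subr0 ?dvdp0 // => w' _.
    by case: (HL w) => _ [/(_ rw)-> _]; rewrite mul0r.
  have -> : 'X^b * S w - \sum_w' L w w' * S w' =
      \sum_i c i * ('X^b * wmon (X i) w - \sum_w' L w w' * wmon (X i) w').
    rewrite mulr_sumr; under eq_bigr do rewrite mulrCA.
    under [X in _ - X]eq_bigr do rewrite mulr_sumr.
    rewrite exchange_big -sumrB; apply: eq_bigr => i _.
    rewrite mulrBr mulr_sumr; congr (_ - _); apply: eq_bigr => w' _.
    by rewrite mulrCA.
  apply: (big_ind (fun p => 'X^(size Delta) %| p)) => [|p q|i _];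
    [exact: dvdp0|exact: dvdp_add|].
  by apply: dvdp_mull; case: (HL w) => _ [_ ->].
have S0 w : (S w).[0] = 0.
  pose v : 'cV[{poly k}]_#|W| := \col_i S (enum_val i).
  pose M := ('X^b)%:M - ML.
  have Mv i : 'X^(size Delta) %| (M *m v) i 0.
    rewrite mulmxBl mxE mul_scalar_mx !mxE.
    have := SL (enum_val i); congr (_ %| _ - _).
    rewrite (reindex (@enum_val W xpredT)) /=; last first.
      by apply: onW_bij; apply: enum_val_bij.
    by apply: eq_bigr => j _; rewrite !mxE.
  have : 'X^(size Delta) %| Delta * S w.
    have -> : Delta * S w = (\adj M *m (M *m v)) (enum_rank w) 0.
      by rewrite mulmxA mul_adj_mx mul_scalar_mx !mxE enum_rankK.
    rewrite mxE; apply: (big_ind (fun p => 'X^(size Delta) %| p)) => [|p q|i _];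
    [exact: dvdp0|exact: dvdp_add|].
    exact: dvdp_mull.
  move=> dv; apply: contrapT => /eqP Sw0.
  move: dv; rewrite Gauss_dvdpl; first by apply/negP/max_dvdXn.
  rewrite coprimep_expl // coprimep_sym -[X in coprimep _ X]subr0.
  by rewrite -polyC0 coprimep_XsubC.
pose y i p := x i p.
pose c0 i := (c i).[0].
have S0' (w : W) : \sum_i c0 i * wmon (x i) w = 0.
  rewrite -[RHS](S0 w) /S horner_sum; apply: eq_bigr => i _.
  by rewrite hornerM /wmon horner_prod; congr (_ * _); apply: eq_bigr => e _; rewrite X0.
have mult (lam : 'I_r -> 'I_n.+1 -> k) :
    \sum_i c0 i * \prod_e (\sum_p lam e p * x i p) = 0.
  under eq_bigr do rewrite bigA_distr_bigA mulr_sumr.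
  rewrite exchange_big big1 //= => w _.
  transitivity ((\prod_e lam e (w e)) * \sum_i c0 i * wmon (x i) w); last first.
    by rewrite S0' mulr0.
  rewrite mulr_sumr; by apply: eq_bigr => i _; rewrite big_split /= mulrCA.
(* For e != i0 the factor lam e is a linear form that vanishes at x e but not at
x i0; the factor lam i0 is the coordinate 0, which vanishes nowhere. *)
have /choice[pp Hpp] : forall i, exists p, i != i0 -> x i p * x i0 ord0 != x i0 p * x i ord0.
  move=> i; have [->|ii] := eqVneq i i0; first by exists ord0.
  by have [p Hp] := xx ii; exists p.
pose lam (e : 'I_r) (p : 'I_n.+1) : k :=
  if e == i0 then (p == ord0)%:R
  else (p == pp e)%:R * x e ord0 - (p == ord0)%:R * x e (pp e).
have delta (p0 : 'I_n.+1) (f : 'I_n.+1 -> k) : \sum_p (p == p0)%:R * f p = f p0.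
  rewrite (bigD1 p0) //= eqxx mul1r big1 ?addr0 // => p /negPf->.
  by rewrite mul0r.
have lamE e i : \sum_p lam e p * x i p =
    if e == i0 then x i ord0 else x e ord0 * x i (pp e) - x e (pp e) * x i ord0.
  rewrite /lam; case: eqP => _; first exact: delta.
  under eq_bigr do rewrite mulrBl -!mulrA.
  by rewrite sumrB (delta _ (fun p => x e ord0 * x i p)) (delta _ (fun p => x e (pp e) * x i p)).
have := mult lam; rewrite (bigD1 i0) //= [X in _ + X]big1 ?addr0 => [|i ii]; last first.
  rewrite (bigD1 i) //= lamE (negPf ii) mulrC -!mulrA.
  by rewrite [x i ord0 * _]mulrC subrr mul0r.
move/eqP; rewrite mulf_eq0 (negPf ci0) /= => /prodf_eq0[e _].
rewrite lamE; case: (eqVneq e i0) => [_|ei]; first by rewrite (negPf (x0 i0)).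
rewrite subr_eq0 => /eqP H; have := Hpp e ei.
by rewrite -H mulrC eqxx.
Qed.
End WordsBound.

(** * Approximate zeros near a smooth family *)

Section LocalSolution.
Variable k : closedFieldType.
Variables (n mu c d e : nat).
Hypothesis ecd : (c + d = n)%N.
Hypothesis cmu : (c <= mu)%N.
Variables (g : 'I_n -> 'I_n.+1 -> 'I_n.+1 -> k) (ll : nat -> 'I_n.+1 -> k).

Definition quad (R : lalgType k) (j : 'I_n) (X : 'I_n.+1 -> R) : R :=
  \sum_p \sum_q g j p q *: (X p * X q).
Definition polar (R : lalgType k) (j : 'I_n) (X V : 'I_n.+1 -> R) : R :=
  \sum_p \sum_q g j p q *: (X p * V q + V p * X q).
Definition linf (R : lalgType k) (j : nat) (X : 'I_n.+1 -> R) : R :=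
  \sum_p ll j p *: X p.

Definition pert_quad (j : 'I_n) (p q : 'I_n.+1) : {poly k} :=
  (g j p q)%:P + 'X^(n - j) * ((p == ord0)%:R * ll (n.-1 - j) q)%:P.
Definition pert_lin (j : 'I_n) (p : 'I_n.+1) : {poly k} :=
  'X^(n - j) * (ll (n.-1 - j) p)%:P.

Lemma pert_quadE (X : 'I_n.+1 -> {poly k}) j :
  \sum_p \sum_q pert_quad j p q * (X p * X q) =
  quad j X + 'X^(n - j) * (X ord0 * linf (n.-1 - j) X).
Proof.
rewrite /quad /linf [X in _ + _ * (_ * X)](eq_bigr _ (fun p _ => esym (mul_polyC _ _))).
rewrite (bigD1 ord0) //= [in RHS](bigD1 ord0) //= addrAC mulr_sumr mulr_sumr.
rewrite -big_split /=; congr (_ + _).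
  by apply: eq_bigr => q _; rewrite /pert_quad eqxx mul1r -mul_polyC; ring.
apply: eq_bigr => p /negPf p0; apply: eq_bigr => q _.
by rewrite /pert_quad p0 mul0r polyC0 mulr0 addr0 mul_polyC.
Qed.

Lemma pert_linE (X : 'I_n.+1 -> {poly k}) j :
  \sum_p pert_lin j p * X p = 'X^(n - j) * linf (n.-1 - j) X.
Proof.
rewrite /linf mulr_sumr; apply: eq_bigr => p _.
by rewrite /pert_lin -mulrA mul_polyC.
Qed.

Lemma quad_shift (X V : 'I_n.+1 -> {poly k}) (t : {poly k}) j :
  quad j (fun p => X p + t * V p) =
  quad j X + t * (polar j X V + t * quad j V).
Proof.
rewrite /quad /polar mulrDr addrA !mulr_sumr -!big_split /=.
apply: eq_bigr => p _; rewrite !mulr_sumr -!big_split /=.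
by apply: eq_bigr => q _; rewrite -!mul_polyC; ring.
Qed.

Variables (P : 'I_n.+1 -> pex k) (y : 'I_e -> k).
Variables (U : 'I_d -> 'I_e -> k) (W : 'I_c -> 'I_n.+1 -> k).
Let pt (y' : 'I_e -> k) p : k := pev (P p) (ext y').
Let x := pt y.
Let dP (h : 'I_d -> k) p : k := pdv (P p) (ext y) (ext (fun i => \sum_l h l * U l i)).
Let dW (h : 'I_c -> k) p : k := \sum_b h b * W b p.

Hypothesis x0 : x ord0 != 0.
Hypothesis Pquad : forall y' j, \sum_p \sum_q g j p q * (pt y' p * pt y' q) = 0.
Hypothesis Plin : forall l : 'I_d, \sum_p ll l p * x p = 0.
Hypothesis surjU : forall r : 'I_d -> k, exists h, forall l : 'I_d,
  \sum_p ll l p * dP h p = r l.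
Hypothesis surjW : forall r : 'I_n -> k, exists h, forall j : 'I_n, (j < c)%N ->
  \sum_p \sum_q g j p q * (x p * dW h q + dW h p * x q) = r j.

Section WithPoint.
Variable z0 : 'I_d + 'I_c -> k.
Hypothesis z0l : forall l, z0 (inl l) = 0.

Lemma hjet_mulXn m F v D : hjet z0 F v D ->
  hjet z0 (fun z => 'X^m * F z) ((m == 0)%:R * v) (fun h => (m == 0)%:R * D h).
Proof.
move=> HF; apply: hjet_eq (hjetM (hjet_const 'X^m) HF) _ _ _ => [//||h].
  by rewrite hornerXn expr0n.
by rewrite mul0r add0r hornerXn expr0n.
Qed.

Definition curve_param (z : 'I_d + 'I_c -> {poly k}) : 'I_e -> {poly k} :=
  fun i => (y i)%:P + \sum_l U l i *: z (inl l).
Definition curve_base z p : {poly k} := pevX (P p) (ext (curve_param z)).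
Definition curve_offset (z : 'I_d + 'I_c -> {poly k}) p : {poly k} := \sum_b W b p *: z (inr b).
(** The offset is of order d + 1: just beyond the powers of t in the rows that
constrain the parameter of the family, and no more than those in the rows that
constrain the offset. *)
Definition curve_point z p : {poly k} := curve_base z p + 'X^(d.+1) * curve_offset z p.

Lemma hjet_curve_base p : hjet z0 (fun z => curve_base z p) (x p) (fun h => dP (fun l => h (inl l)) p).
Proof.
have jY i : hjet z0 (fun z => ext (curve_param z) i) (ext y i)
    (fun h => ext (fun i => \sum_l h (inl l) * U l i) i).
  apply: hjet_ext => {}i; apply: hjet_eq (hjetD (hjet_const (y i)%:P)
    (hjet_sum (fun l => hjetZ (U l i) (hjet_var (inl l))))) _ _ _ => //.
    by rewrite hornerC big1 ?addr0 // => l _; rewrite z0l mulr0.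
  by move=> h; rewrite add0r; apply: eq_bigr => l _; rewrite mulrC.
exact: (hjet_pex (P p) jY).
Qed.

Lemma hjet_curve_offset p : hjet z0 (fun z => curve_offset z p) (dW (fun b => z0 (inr b)) p)
   (fun h => dW (fun b => h (inr b)) p).
Proof.
apply: hjet_eq (hjet_sum (fun b => hjetZ (W b p) (hjet_var (inr b)))) _ _ _ => //.
  by apply: eq_bigr => b _; rewrite mulrC.
by move=> h; apply: eq_bigr => b _; rewrite mulrC.
Qed.

Lemma hjet_curve_point p : hjet z0 (fun z => curve_point z p) (x p) (fun h => dP (fun l => h (inl l)) p).
Proof.
apply: hjet_eq (hjetD (hjet_curve_base p) (hjet_mulXn d.+1 (hjet_curve_offset p))) _ _ _ => //.
  by rewrite mul0r addr0.
by move=> h; rewrite mul0r addr0.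
Qed.

Lemma hjet_linf j : hjet z0 (fun z => linf j (curve_point z)) (\sum_p ll j p * x p)
   (fun h => \sum_p ll j p * dP (fun l => h (inl l)) p).
Proof. by apply: hjet_sum => p; apply: hjetZ; apply: hjet_curve_point. Qed.

Lemma hjet_quad (F : 'I_n.+1 -> _ -> {poly k}) v D j : (forall p, hjet z0 (F p) (v p) (D p)) ->
  hjet z0 (fun z => quad j (fun p => F p z)) (\sum_p \sum_q g j p q * (v p * v q))
   (fun h => \sum_p \sum_q g j p q * (D p h * v q + v p * D q h)).
Proof.
by move=> H; apply: hjet_sum => p; apply: hjet_sum => q; apply: hjetZ; apply: hjetM.
Qed.

Lemma hjet_polar j : hjet z0 (fun z => polar j (curve_base z) (curve_offset z))
   (\sum_p \sum_q g j p q * (x p * dW (fun b => z0 (inr b)) q + dW (fun b => z0 (inr b)) p * x q))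
   (fun h => \sum_p \sum_q g j p q * (x p * dW (fun b => h (inr b)) q + dW (fun b => h (inr b)) p * x q)
    + \sum_p \sum_q g j p q * (dP (fun l => h (inl l)) p * dW (fun b => z0 (inr b)) q
                               + dW (fun b => z0 (inr b)) p * dP (fun l => h (inl l)) q)).
Proof.
apply: hjet_eq (hjet_sum (fun p => hjet_sum (fun q => hjetZ (g j p q)
  (hjetD (hjetM (hjet_curve_base p) (hjet_curve_offset q)) (hjetM (hjet_curve_offset p) (hjet_curve_base q)))))) _ _ _ => // h.
rewrite -big_split /=; apply: eq_bigr => p _.
rewrite -big_split /=; apply: eq_bigr => q _; ring.
Qed.

Definition reduced_eq (j : 'I_n) (z : 'I_d + 'I_c -> {poly k}) : {poly k} :=
  if (j < c)%N then
    polar j (curve_base z) (curve_offset z) + 'X^(d.+1) * quad j (curve_offset z)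
    + 'X^(n - j - d.+1) * (curve_point z ord0 * linf (n.-1 - j) (curve_point z))
    + 'X^(n - d) * (curve_point z (lift ord0 j) * curve_point z (lift ord0 j))
  else if (j < mu)%N then
    'X^(d.+1 - (n - j)) * (polar j (curve_base z) (curve_offset z) + 'X^(d.+1) * quad j (curve_offset z))
    + curve_point z ord0 * linf (n.-1 - j) (curve_point z)
    + 'X^(j.+1) * (curve_point z (lift ord0 j) * curve_point z (lift ord0 j))
  else linf (n.-1 - j) (curve_point z) + 'X^(j.+1) * curve_point z (lift ord0 j).

(** The identity holds at every value of the parameter t, hence as polynomials. *)
Lemma quad_curve_base z j : quad j (curve_base z) = 0.
Proof.
apply: poly_eq0_horner => t; rewrite -[RHS](Pquad (fun i => (curve_param z i).[t]) j).
have E p : (curve_base z p).[t] = pt (fun i => (curve_param z i).[t]) p.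
  rewrite /curve_base horner_pevX; apply: eq_pex_eval => i.
  by rewrite /ext; case: insubP => // _; rewrite horner0.
rewrite /quad horner_sum; apply: eq_bigr => p _.
by rewrite horner_sum; apply: eq_bigr => q _; rewrite hornerZ hornerM !E.
Qed.

Lemma perturbed_reduced j z : exists m,
  perturbed mu n.+1 pert_quad pert_lin (curve_point z) j = 'X^m * reduced_eq j z.
Proof.
have jn := ltn_ord j.
rewrite /perturbed /reduced_eq pert_quadE pert_linE quad_shift quad_curve_base add0r.
case: (ltnP j c) => jc.
  rewrite (leq_trans jc cmu); exists d.+1.
  have e1 : 'X^(n - j) = 'X^(n - j - d.+1) * 'X^(d.+1) :> {poly k}.
    by rewrite -exprD; congr ('X^_); lia.
  have e2 : 'X^(n.+1) = 'X^(n - d) * 'X^(d.+1) :> {poly k}.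
    by rewrite -exprD; congr ('X^_); lia.
  rewrite e1 e2; ring.
have e2 : 'X^(n.+1) = 'X^(j.+1) * 'X^(n - j) :> {poly k}.
  by rewrite -exprD; congr ('X^_); lia.
case: (ltnP j mu) => jm; exists (n - j)%N.
  have e1 : 'X^(d.+1) = 'X^(d.+1 - (n - j)) * 'X^(n - j) :> {poly k}.
    by rewrite -exprD; congr ('X^_); lia.
  rewrite {1}e1 e2; ring.
rewrite e2; ring.
Qed.

End WithPoint.

(** Here [x] is a point of the family [P] lying on the linear forms of index
less than d, the directions [U] make these forms independent along the family,
and the directions [W] make the first c quadrics independent transversally to
it. The terms of the perturbed system have been ordered so that, at
X = P(y) + t^(d+1) w, row j is divisible by t^(d+1) if j < c and by t^(n-j)
otherwise; what remains is the system [reduced_eq], whose differential at t = 0 is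
block triangular. *)
Lemma zeros_near_family N : exists X : 'I_n.+1 -> {poly k},
  (forall p, (X p).[0] = x p) /\
  forall j, 'X^N %| perturbed mu n.+1 pert_quad pert_lin X j.
Proof.
(* The offset at t = 0: among the rows j < c only row c - 1 has a constant term
coming from the linear forms. *)
have [w0 Hw0] := surjW (fun j => - ((n - j - d.+1 == 0)%N%:R * (x ord0 * \sum_p ll (n.-1 - j) p * x p))).
pose z0 (a : 'I_d + 'I_c) : k := if a is inr b then w0 b else 0.
have z0l l : z0 (inl l) = 0 by [].
(* The part of the differential of a row j < c that depends on the parameter. *)
pose phi (j : 'I_n) (hz : 'I_d -> k) : k :=
  \sum_p \sum_q g j p q * (dP hz p * dW w0 q + dW w0 p * dP hz q)
  + (n - j - d.+1 == 0)%N%:R * (dP hz ord0 * (\sum_p ll (n.-1 - j) p * x p)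
         + x ord0 * \sum_p ll (n.-1 - j) p * dP hz p).
pose D (j : 'I_n) (h : 'I_d + 'I_c -> k) : k :=
  let hz l := h (inl l) in let hw b := h (inr b) in
  if (j < c)%N then
    \sum_p \sum_q g j p q * (x p * dW hw q + dW hw p * x q) + phi j hz
  else if (j < mu)%N then x ord0 * \sum_p ll (n.-1 - j) p * dP hz p
  else \sum_p ll (n.-1 - j) p * dP hz p.
have lin0 (j : 'I_n) : (c <= j)%N -> \sum_p ll (n.-1 - j) p * x p = 0.
  move=> cj; have jn := ltn_ord j; have jd : (n.-1 - j < d)%N by lia.
  exact: (Plin (Ordinal jd)).
have jG j : hjet z0 (reduced_eq j) 0 (D j).
  have jn := ltn_ord j.
  have j1 := hjet_polar z0l j.
  have j2 := hjet_mulXn d.+1 (hjet_quad j (@hjet_curve_offset z0)).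
  have j3 := hjetM (hjet_curve_point z0l ord0) (hjet_linf z0l (n.-1 - j)).
  have j4 := hjetM (hjet_curve_point z0l (lift ord0 j)) (hjet_curve_point z0l (lift ord0 j)).
  rewrite /D /reduced_eq; case: (ltnP j c) => jc.
    apply: hjet_eq (hjetD (hjetD (hjetD j1 j2) (hjet_mulXn (n - j - d.+1) j3))
      (hjet_mulXn (n - d) j4)) _ _ _ => [//||h].
      rewrite Hw0 // mul0r addr0 addNr add0r.
      have -> : (n - d == 0)%N = false by lia.
      by rewrite mul0r.
    have -> : (n - d == 0)%N = false by lia.
    by rewrite !mul0r !addr0 /phi; ring.
  case: (ltnP j mu) => jm.
    apply: hjet_eq (hjetD (hjetD (hjet_mulXn (d.+1 - (n - j)) (hjetD j1 j2)) j3)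
      (hjet_mulXn j.+1 j4)) _ _ _ => [//||h].
      have -> : (d.+1 - (n - j) == 0)%N = false by lia.
      by rewrite lin0 // !mul0r mulr0 !addr0.
    have -> : (d.+1 - (n - j) == 0)%N = false by lia.
    by rewrite lin0 // !mul0r mulr0 !add0r addr0.
  apply: hjet_eq (hjetD (hjet_linf z0l (n.-1 - j)) (hjet_mulXn j.+1 (hjet_curve_point z0l (lift ord0 j)))) _ _ _.
  - by [].
  - by rewrite lin0 // mul0r addr0.
  by move=> h; rewrite mul0r addr0.
have [|z Hz0 Hz] := hensel jG _ N.
  move=> r.
  (* Block triangular solution: the rows j >= c give the parameter, after which the
  rows j < c give the offset. *)
  pose kap (j : nat) : k := if (j < mu)%N then x ord0 else 1.
  have kap0 j : kap j != 0 by rewrite /kap; case: ifP => // _; rewrite oner_eq0.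
  pose rn (j : nat) : k := if insub j is Some j' then r j' else 0.
  have [hz Hz] := surjU (fun l => rn (n.-1 - l)%N / kap (n.-1 - l)%N).
  have [hw Hw] := surjW (fun j => r j - phi j hz).
  exists (fun a => match a with inl l => hz l | inr b => hw b end) => j.
  have jn := ltn_ord j; rewrite /D; case: (ltnP j c) => jc.
    by rewrite Hw // subrK.
  have jd : (n.-1 - j < d)%N by lia.
  have := Hz (Ordinal jd); have -> : (n.-1 - Ordinal jd = j)%N by rewrite /=; lia.
  rewrite /rn valK /kap /= => ->.
  by case: (j < mu)%N; rewrite ?divr1 // mulrC divfK.
exists (curve_point z); split=> [p|j].
  by case: (hjet_curve_point z0l p Hz0).
by case: (perturbed_reduced j z) => m ->; apply: dvdp_mull.
Qed.

End LocalSolution.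

(** * A Bezout bound for disjoint smooth families *)

Section PolyFunctions.
Variable k : closedFieldType.
Implicit Types (F G : (nat -> k) -> k).

(** Polynomial functions, as opposed to expressions: enough when only values
matter. *)
Definition polyf F := exists x : pex k, forall e, F e = pev x e.

Lemma polyf_const (c : k) : polyf (fun=> c).
Proof. by exists (PCst c). Qed.
Lemma polyf_pev x : polyf (pev x).
Proof. by exists x. Qed.
Lemma polyfD F G : polyf F -> polyf G -> polyf (fun e => F e + G e).
Proof. by move=> [x Fx] [y Gy]; exists (PAdd x y) => e; rewrite Fx Gy. Qed.
Lemma polyfM F G : polyf F -> polyf G -> polyf (fun e => F e * G e).
Proof. by move=> [x Fx] [y Gy]; exists (PMul x y) => e; rewrite Fx Gy. Qed.
Lemma eq_polyf F G : F =1 G -> polyf F -> polyf G.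
Proof. by move=> FG [x Fx]; exists x => e; rewrite -FG. Qed.
Lemma polyfB F G : polyf F -> polyf G -> polyf (fun e => F e - G e).
Proof.
move=> PF PG; apply: eq_polyf (polyfD PF (polyfM (polyf_const (-1)) PG)) => e /=.
by rewrite mulN1r.
Qed.
Lemma polyf_sum (I : finType) (F : I -> (nat -> k) -> k) :
  (forall i, polyf (F i)) -> polyf (fun e => \sum_i F i e).
Proof.
move=> H; rewrite unlock; elim: (index_enum I) => [|i s IHs] /=.
  exact: polyf_const.
exact: polyfD.
Qed.
Lemma polyf_prod (I : finType) (F : I -> (nat -> k) -> k) :
  (forall i, polyf (F i)) -> polyf (fun e => \prod_i F i e).
Proof.
move=> H; rewrite unlock; elim: (index_enum I) => [|i s IHs] /=.
  exact: polyf_const.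
exact: polyfM.
Qed.
Lemma polyf_det n (F : (nat -> k) -> 'M[k]_n) :
  (forall i j, polyf (fun e => F e i j)) -> polyf (fun e => \det (F e)).
Proof.
move=> H; apply: polyf_sum => s; apply: polyfM; first exact: polyf_const.
exact: polyf_prod.
Qed.
Lemma polyf_pdv x h : polyf (fun e => pdv x e h).
Proof.
elim: x => /= [c|i|a IHa b IHb|a IHa b IHb].
- exact: polyf_const.
- exact: polyf_const.
- exact: polyfD.
- by apply: polyfD; apply: polyfM => //; apply: polyf_pev.
Qed.

Lemma pdv_comb x (e0 : nat -> k) d e (h : 'I_d -> k) (U : 'I_d -> 'I_e -> k) :
  pdv x e0 (ext (fun i => \sum_l h l * U l i)) = \sum_l h l * pdv x e0 (ext (U l)).
Proof.
under eq_bigr do rewrite -pdvZ.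
rewrite -pdv_sum; apply: eq_pdv => // i; rewrite /ext.
by case: insubP => // _; rewrite big1 // => l _; rewrite mulr0.
Qed.

Definition pex_lin n (lam : 'I_n -> k) (P : 'I_n -> pex k) : pex k :=
  foldr (fun p => PAdd (PMul (PCst (lam p)) (P p))) (PCst 0) (index_enum 'I_n).

Lemma pev_lin n lam (P : 'I_n -> pex k) e :
  pev (pex_lin lam P) e = \sum_p lam p * pev (P p) e.
Proof. by rewrite unlock /pex_lin; elim: (index_enum _) => //= p s <-. Qed.

Lemma pdv_lin n lam (P : 'I_n -> pex k) e h :
  pdv (pex_lin lam P) e h = \sum_p lam p * pdv (P p) e h.
Proof.
rewrite unlock /pex_lin; elim: (index_enum _) => //= p s <-.
by rewrite mul0r add0r.
Qed.

(** Each condition is the nonvanishing of a polynomial in the entries of A, and it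
can be met because T i has a right inverse; finitely many such conditions can be
met at once. *)
Lemma generic_matrix (I : finType) M N (c : I -> nat) (cN : forall i, (c i <= N)%N)
    (T : forall i, 'M[k]_(c i, M)) : (forall i, row_free (T i)) ->
  exists A : 'M[k]_(N, M), forall i,
    \det (T i *m (rowsub (widen_ord (cN i)) A)^T) != 0.
Proof.
move=> HT; pose idx j l := (enum_rank ((j, l) : 'I_N * 'I_M) : nat).
pose A (e : nat -> k) : 'M[k]_(N, M) := \matrix_(j, l) e (idx j l).
have /choice[H HH] : forall i, exists H : pex k, forall e,
    \det (T i *m (rowsub (widen_ord (cN i)) (A e))^T) = pev H e.
  move=> i; apply: polyf_det => a b; apply: (@eq_polyf (fun e =>
    \sum_l T i a l * pev (PVar (idx (widen_ord (cN i) b) l)) e)).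
    by move=> e; rewrite !mxE; apply: eq_bigr => l _; rewrite !mxE.
  by apply: polyf_sum => l; apply: polyfM; [apply: polyf_const|apply: polyf_pev].
have /common_nonzero[s Hs] : forall i, nonzero_pex (H i).
  move=> i; have [B TB] := row_freeP (HT i).
  pose C (j : 'I_N) (l : 'I_M) : k := if insub (val j) is Some j' then B l j' else 0.
  pose f (t : 'I_#|{: 'I_N * 'I_M}|) := C (enum_val t).1 (enum_val t).2.
  exists (mkseq (ext f) #|{: 'I_N * 'I_M}|).
  rewrite -HH (_ : _ *m _ = 1%:M) ?det1 ?oner_eq0 // -TB.
  congr (_ *m _); apply/matrixP => l j; rewrite !mxE mkseq_env => [|t]; last exact: ext_out.
  rewrite /idx ext_ord /f enum_rankK /C /=; case: insubP => [j' _ jj'|]; last by rewrite ltn_ord.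
  by congr (B l _); apply: val_inj.
by exists (A (nth 0 s)) => i; rewrite HH.
Qed.

(** The derivative of an identity is an identity. *)
Lemma hjet_zero (I : finType) (z0 : I -> k) (F : (I -> {poly k}) -> {poly k}) v d :
  hjet z0 F v d -> (forall z, F z = 0) -> forall h, d h = 0.
Proof.
move=> HF F0 h; case: (HF (fun i => (z0 i)%:P)) => [i|_ /(_ 0%N h)].
  by rewrite hornerC.
rewrite !F0 subrr sub0r dvdpNr; apply: contraTeq => dh.
rewrite dvdpZr //; apply/negP => /dvdp_leq.
by rewrite !size_polyXn expr1 polyX_eq0 => /(_ isT).
Qed.

End PolyFunctions.

Section QuadricBound.
Variable k : closedFieldType.
Variables (n m r : nat) (f : 'I_m -> 'I_n.+1 -> 'I_n.+1 -> k).
Variables (e : 'I_r -> nat) (P : 'I_r -> 'I_n.+1 -> pex k) (y0 : forall i, 'I_(e i) -> k).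

Arguments y0 : clear implicits.

Let pt i (y : 'I_(e i) -> k) p : k := pev (P i p) (ext y).
Let x i := pt (y0 i).

Hypothesis x0 : forall i, x i ord0 != 0.
Hypothesis Pquad : forall i (y : 'I_(e i) -> k) l,
  \sum_p \sum_q f l p q * (pt y p * pt y q) = 0.
Hypothesis Ptan : forall i (v : 'I_n.+1 -> k),
  (forall l, \sum_p \sum_q f l p q * (x i p * v q + v p * x i q) = 0) ->
  exists a (h : 'I_(e i) -> k), forall p,
    v p = a * x i p + pdv (P i p) (ext (y0 i)) (ext h).
Hypothesis Psep : forall i j, i != j ->
  forall (y : 'I_(e i) -> k) (y' : 'I_(e j) -> k), pt y ord0 != 0 -> pt y' ord0 != 0 ->
  exists p, pt y p * pt y' ord0 != pt y' p * pt y ord0.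

Let dPt i (y h : 'I_(e i) -> k) p := pdv (P i p) (ext y) (ext h).

Let dquad i (y h : 'I_(e i) -> k) l :
  \sum_p \sum_q f l p q * (pt y p * dPt y h q + dPt y h p * pt y q) = 0.
Proof.
pose Y (z : 'I_1 -> {poly k}) j := (y j)%:P + h j *: z ord0.
have jY j : hjet (fun=> 0) (fun z => ext (Y z) j) (ext y j)
    (fun c => ext (fun j => c ord0 * h j) j).
  apply: hjet_ext => {}j; apply: hjet_eq (hjetD (hjet_const (y j)%:P)
    (hjetZ (h j) (hjet_var ord0))) _ _ _ => //.
    by rewrite hornerC mulr0 addr0.
  by move=> c; rewrite add0r mulrC.
have jF := hjet_sum (fun p => hjet_sum (fun q => hjetZ (f l p q)
  (hjetM (hjet_pex (P i p) jY) (hjet_pex (P i q) jY)))).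
have := hjet_zero jF _ (fun=> 1); rewrite /=.
have E p : pdv (P i p) (ext y) (fun j => ext (fun j => 1 * h j) j) = dPt y h p.
  by apply: eq_pdv => // j; rewrite /ext; case: insubP => // *; rewrite mul1r.
move=> H; rewrite -[RHS]H => [|z].
  apply: eq_bigr => p _; apply: eq_bigr => q _.
  by rewrite addrC; congr (_ * (_ * _ + _ * _)); rewrite -E.
apply: poly_eq0_horner => t; rewrite -[RHS](Pquad (fun j => (Y z j).[t]) l).
rewrite horner_sum; apply: eq_bigr => p _; rewrite horner_sum; apply: eq_bigr => q _.
rewrite hornerZ hornerM !horner_pevX; congr (_ * (_ * _)); apply: eq_pex_eval => j.
  by rewrite /ext; case: insubP => // _; rewrite horner0.
by rewrite /ext; case: insubP => // _; rewrite horner0.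
Qed.

(** The matrix of v |-> (B_l(x, v))_l, with B_l the polar form of the l-th equation. *)
Let Bm i : 'M[k]_(n.+1, m) := \matrix_(q, l) \sum_p (f l p q * x i p + f l q p * x i p).
(** The derivatives of the family, projected along x to the vectors with vanishing
coordinate 0. *)
Let Nm i : 'M[k]_(e i, n.+1) := \matrix_(j, p)
  (dPt (y0 i) (fun j' => (j' == j)%:R) p * x i ord0
   - x i p * dPt (y0 i) (fun j' => (j' == j)%:R) ord0).
Let c i := \rank (Bm i).
Let d i := \rank (Nm i).
(** Directions of the parameter, and below directions W of the ambient space, whose
images under Nm and Bm are bases of the row spaces. *)
Let U i : 'M[k]_(d i, e i) := row_base (Nm i) *m pinvmx (Nm i).
Let W i : 'M[k]_(c i, n.+1) := row_base (Bm i) *m pinvmx (Bm i).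

Let polarE (g : 'I_n.+1 -> 'I_n.+1 -> k) (a b : 'I_n.+1 -> k) :
  \sum_p \sum_q g p q * (a p * b q + b p * a q) =
  \sum_q b q * \sum_p (g p q * a p + g q p * a p).
Proof.
under eq_bigr do under eq_bigr do rewrite mulrDr.
under eq_bigr do rewrite big_split /=.
rewrite big_split /= exchange_big -big_split /=; apply: eq_bigr => q _.
rewrite big_split /= mulrDr !mulr_sumr; congr (_ + _); apply: eq_bigr => p _; ring.
Qed.

Let BmE i (v : 'rV[k]_n.+1) l :
  (v *m Bm i) 0 l = \sum_p \sum_q f l p q * (x i p * v 0 q + v 0 p * x i q).
Proof. by rewrite polarE !mxE; apply: eq_bigr => q _; rewrite mxE. Qed.

Let xrow i : 'rV[k]_n.+1 := \row_p x i p.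

Let dPtE i (h : 'I_(e i) -> k) p :
  dPt (y0 i) h p = \sum_j h j * dPt (y0 i) (fun j' => (j' == j)%:R) p.
Proof.
rewrite /dPt -pdv_comb; apply: eq_pdv => // t; rewrite /ext; case: insubP => // t' _ _.
rewrite (bigD1 t') //= eqxx mulr1 big1 ?addr0 // => j /negPf tj.
by rewrite eq_sym tj mulr0.
Qed.

Let kerBm i : (kermx (Bm i) :=: xrow i + Nm i)%MS.
Proof.
apply/eqmxP/andP; split.
  apply/rV_subP => v /sub_kermxP vB.
  have [l|a [h vE]] := Ptan (i := i) (v := fun p => v 0 p).
    by rewrite -BmE vB mxE.
  apply/sub_addsmxP; exists ((a + (\sum_j h j * dPt (y0 i) (fun j' => (j' == j)%:R) ord0) / x i ord0)%:M,
     (x i ord0)^-1 *: \row_j h j).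
  apply/rowP => p; rewrite vE /= mul_scalar_mx -scalemxAl !mxE.
  rewrite -/(dPt _ _ _) dPtE [in RHS]mulr_suml mulrDl -addrA; congr (_ + _).
  rewrite !mulr_suml mulr_sumr -big_split; apply: eq_bigr => j _ /=.
  by rewrite !mxE; field; apply: x0.
rewrite addsmx_sub; apply/andP; split; apply/sub_kermxP.
  apply/rowP => l; rewrite BmE mxE -[RHS](addr0 0) -[in RHS](Pquad (y0 i) l).
  rewrite -big_split /=; apply: eq_bigr => p _; rewrite -big_split /=.
  by apply: eq_bigr => q _; rewrite !mxE mulrDr.
apply/row_matrixP => j; rewrite row_mul row0; apply/rowP => l.
rewrite BmE mxE.
pose h j' : k := (j' == j)%:R.
transitivity (x i ord0 * (\sum_p \sum_q f l p q * (pt (y0 i) p * dPt (y0 i) h q + dPt (y0 i) h p * pt (y0 i) q))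
   - dPt (y0 i) h ord0 * (\sum_p \sum_q f l p q * (x i p * x i q)) *+ 2); last first.
  by rewrite dquad Pquad !mulr0 mul0rn subr0.
rewrite -mulr_natr -mulrA mulr_suml !mulr_sumr -sumrB; apply: eq_bigr => p _.
rewrite mulr_suml !mulr_sumr -sumrB; apply: eq_bigr => q _; rewrite !mxE -/h /x; ring.
Qed.

Let ecd i : (c i + d i = n)%N.
Proof.
have : \rank (kermx (Bm i)) = (1 + d i)%N.
  rewrite kerBm; have x00 : xrow i != 0.
    by apply: contraNneq (x0 i) => /rowP/(_ ord0); rewrite !mxE => ->.
  rewrite mxrank_disjoint_sum; first by rewrite rank_rV x00.
  apply/eqP/rowV0P => v; rewrite sub_capmx => /andP[/sub_rVP[a ->] /submxP[h hE]].
  have /rowP/(_ ord0) := hE; rewrite !mxE big1 => [|j _].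
    by move/eqP; rewrite mulf_eq0 (negPf (x0 i)) orbF => /eqP->; rewrite scale0r.
  by rewrite mxE [x i ord0 * _]mulrC subrr mulr0.
rewrite mxrank_ker => E; have := rank_leq_row (Bm i); rewrite -/(c i) in E *.
lia.
Qed.

Let cn i : (c i <= n)%N. Proof. by rewrite -(ecd i) leq_addr. Qed.
Let dn i : (d i <= n)%N. Proof. by rewrite -(ecd i) leq_addl. Qed.
Let mu := minn n m.
Let cmu i : (c i <= mu)%N. Proof. by rewrite leq_min cn rank_leq_col. Qed.

Let UN i : row_free (U i *m Nm i).
Proof. by rewrite mulmxKpV ?row_base_free ?eq_row_base. Qed.
Let WB i : row_free (W i *m Bm i).
Proof. by rewrite mulmxKpV ?row_base_free ?eq_row_base. Qed.

(** The generic data are chosen in this order: combinations A of the equations,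
linear forms lam, and values s of these forms. For generic s every family has a
point on the hyperplanes lam_j = s_j, j < d i, at which the two determinants J and
K are nonzero; J expresses transversality along the family and K transversality
of the first c i combined equations. *)
Lemma quadric_families_bound : (r <= 2 ^ minn n m)%N.
Proof.
have [A HA] := generic_matrix cmu WB.
have [lam Hlam] := generic_matrix dn UN.
pose ul i l := ext (U i l).
pose R i (j : 'I_(d i)) := pex_lin (lam (widen_ord (dn i) j)) (P i).
pose g (j : 'I_n) p q : k := if insub (val j) is Some j' then \sum_l A j' l * f l p q else 0.
pose J i (e : nat -> k) : 'M[k]_(d i) := \matrix_(l, j)
  (pdv (R i j) e (ul i l) * pev (P i ord0) e - pev (R i j) e * pdv (P i ord0) e (ul i l)).
pose wc i (j : 'I_(c i)) : 'I_n := widen_ord (cn i) j.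
pose K i (e : nat -> k) : 'M[k]_(c i) := \matrix_(b, j)
  \sum_p \sum_q g (wc i j) p q * (pev (P i p) e * W i b q + W i b p * pev (P i q) e).
have /choice[Z ZE] : forall i, exists Z, forall e,
    pev (P i ord0) e * (\det (J i e) * \det (K i e)) = pev Z e.
  move=> i; apply: polyfM; first exact: polyf_pev.
  apply: polyfM; apply: polyf_det => a b.
    apply: (@eq_polyf _ (fun e => pdv (R i b) e (ul i a) * pev (P i ord0) e
       - pev (R i b) e * pdv (P i ord0) e (ul i a))); first by move=> ?; rewrite mxE.
    by apply: polyfB; apply: polyfM; (apply: polyf_pdv || apply: polyf_pev).
  apply: (@eq_polyf _ (fun e => \sum_p \sum_q g (wc i b) p q *
    (pev (P i p) e * W i a q + W i a p * pev (P i q) e))); first by move=> ?; rewrite mxE.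
  apply: polyf_sum => p; apply: polyf_sum => q; apply: polyfM; first exact: polyf_const.
  by apply: polyfD; apply: polyfM; (apply: polyf_const || apply: polyf_pev).
have J0 i : J i (ext (y0 i)) = U i *m Nm i *m (rowsub (widen_ord (dn i)) lam)^T.
  apply/matrixP => l j; rewrite !mxE pev_lin pdv_lin.
  rewrite !mulr_suml -sumrB; apply: eq_bigr => p _; rewrite !mxE.
  rewrite -mulrA -[_ * _ * pdv _ _ _]mulrA -mulrBr mulrC; congr (_ * _).
  rewrite -/(dPt _ _ _) -/(dPt _ (U i l) ord0) !dPtE mulr_suml mulr_sumr -sumrB.
  by apply: eq_bigr => t _; rewrite !mxE /x /pt; ring.
have K0 i : K i (ext (y0 i)) = W i *m Bm i *m (rowsub (widen_ord (cmu i)) A)^T.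
  apply/matrixP => b j; rewrite !mxE.
  have gE p q : g (wc i j) p q = \sum_l A (widen_ord (cmu i) j) l * f l p q.
    rewrite /g /=; case: insubP => [j' _ jj'|/=].
      by apply: eq_bigr => l _; congr (A _ _ * _); apply: val_inj.
    by rewrite (leq_trans (ltn_ord j) (cmu i)).
  under eq_bigr do under eq_bigr do rewrite gE mulr_suml.
  under eq_bigr do rewrite exchange_big.
  rewrite exchange_big; apply: eq_bigr => l _ /=.
  have -> : (W i *m Bm i) b l = (row b (W i) *m Bm i) 0 l by rewrite -row_mul [RHS]mxE.
  rewrite BmE !mxE mulr_suml; apply: eq_bigr => p _; rewrite mulr_suml.
  by apply: eq_bigr => q _; rewrite !mxE -!/(pt _ _) /x; ring.
have Z0 i : pev (Z i) (ext (y0 i)) != 0.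
  by rewrite -ZE J0 K0 !mulf_neq0 //; apply: x0.
have ZR i (y : 'I_(e i) -> k) : pev (Z i) (ext y) != 0 -> pev (P i ord0) (ext y) != 0.
  by rewrite -ZE mulf_eq0 => /norP[].
have gen i : exists2 H, nonzero_pex H & forall s : seq k, pev H (nth 0 s) != 0 ->
    exists2 y : 'I_(e i) -> k, pev (Z i) (ext y) != 0 &
    forall j, pev (R i j) (ext y) = s`_j * pev (P i ord0) (ext y).
  apply: (@generic_solution k (e i) (d i) (P i ord0) (R i) (Z i) (y0 i) (U i)) => //; [exact: ZR|move=> rr].
  have Ju : J i (ext (y0 i)) \in unitmx.
    by rewrite unitmxE unitfE J0.
  exists (fun l => (\row_j rr j *m invmx (J i (ext (y0 i)))) 0 l) => j /=.
  rewrite !pdv_comb mulr_suml mulr_sumr -sumrB.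
  have := congr1 (fun M : 'rV_ _ => M 0 j) (mulmxKV Ju (\row_j rr j)).
  rewrite [in RHS]mxE => <-; rewrite [RHS]mxE; apply: eq_bigr => l _.
  by rewrite [J _ _ _ _]mxE /ul; ring.
have /choice[H HH] : forall i, exists H, nonzero_pex H /\ forall s : seq k, pev H (nth 0 s) != 0 ->
    exists2 y : 'I_(e i) -> k, pev (Z i) (ext y) != 0 &
    forall j, pev (R i j) (ext y) = s`_j * pev (P i ord0) (ext y).
  by move=> i; have [H nH HH] := gen i; exists H.
have [s Hs] := common_nonzero (fun i => (HH i).1).
have {HH Hs}sol i : exists y : 'I_(e i) -> k, pev (Z i) (ext y) != 0 /\
    forall j, pev (R i j) (ext y) = s`_j * pev (P i ord0) (ext y).
  by have [y] := (HH i).2 s (Hs i); exists y.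
pose y i := projT1 (cid (sol i)).
have yZ i : pev (Z i) (ext (y i)) != 0 by case: (projT2 (cid (sol i))).
have yR i j : pev (R i j) (ext (y i)) = s`_j * pev (P i ord0) (ext (y i)).
  by case: (projT2 (cid (sol i))).
have yJ i : J i (ext (y i)) \in unitmx.
  by have := yZ i; rewrite -ZE !mulf_eq0 !negb_or unitmxE unitfE => /and3P[].
have yK i : K i (ext (y i)) \in unitmx.
  by have := yZ i; rewrite -ZE !mulf_eq0 !negb_or unitmxE unitfE => /and3P[].
pose lamn (l : nat) p : k := if insub l is Some l' then lam l' p else 0.
pose ll (l : nat) p : k := lamn l p - s`_l * (p == ord0)%:R.
have llE i (l : 'I_(d i)) (v : 'I_n.+1 -> k) :
    \sum_p ll l p * v p = \sum_p lam (widen_ord (dn i) l) p * v p - s`_l * v ord0.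
  have -> : s`_l * v ord0 = \sum_p s`_l * (p == ord0)%:R * v p.
    rewrite (bigD1 ord0) //= mulr1 big1 ?addr0 // => p /negPf->.
    by rewrite mulr0 mul0r.
  rewrite -sumrB; apply: eq_bigr => p _; rewrite /ll mulrBl; congr (_ * _ - _).
  rewrite /lamn; case: insubP => [l' _ ll'|]; last by rewrite (leq_trans (ltn_ord l) (dn i)).
  by congr (lam _ _); apply: val_inj.
apply: (@perturbed_zeros_bound k n mu n.+1 r (geq_minl n m) (pert_quad g ll) (pert_lin ll)
  _ _ (fun i => pt (y i))).
- move=> j p q; apply: leq_trans (size_polyD _ _) _; rewrite geq_max.
  rewrite (leq_trans (size_polyC_leq1 _)) //= mulrC mul_polyC.
  by rewrite (leq_trans (size_scale_leq _ _)) // size_polyXn ltnS leq_subr.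
- move=> j p; rewrite /pert_lin mulrC mul_polyC.
  by rewrite (leq_trans (size_scale_leq _ _)) // size_polyXn ltnS leq_subr.
- by move=> i; apply: ZR.
- by move=> i j ij; apply: Psep => //; apply: ZR.
move=> N; suff /choice[X HX] : forall i, exists X : 'I_n.+1 -> {poly k},
    (forall p, (X p).[0] = pt (y i) p) /\
    forall j, 'X^N %| perturbed mu n.+1 (pert_quad g ll) (pert_lin ll) X j.
  by exists X; split=> [i p|i j]; case: (HX i).
move=> i; apply: (@zeros_near_family k n mu (c i) (d i) (e i) (ecd i) (cmu i) g ll (P i) (y i)
  (U i) (W i)).
- exact: ZR.
- move=> y' j; rewrite /g; case: insubP => [j' _ _|_]; last first.
    by rewrite big1 // => p _; rewrite big1 // => q _; rewrite mul0r.
  under eq_bigr do under eq_bigr do rewrite mulr_suml.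
  under eq_bigr do rewrite exchange_big.
  rewrite exchange_big big1 //= => l _.
  transitivity (A j' l * \sum_p \sum_q f l p q * (pt y' p * pt y' q)); last first.
    by rewrite Pquad mulr0.
  rewrite mulr_sumr; apply: eq_bigr => p _; rewrite mulr_sumr.
  by apply: eq_bigr => q _; rewrite -[LHS]mulrA.
- by move=> l; rewrite llE -[X in X - _]pev_lin -/(R i l) yR subrr.
- move=> rr; pose h0 := \row_j rr j *m invmx (J i (ext (y i))).
  exists (fun l => pev (P i ord0) (ext (y i)) * h0 0 l) => j /=; rewrite llE.
  have := congr1 (fun M : 'rV_ _ => M 0 j) (mulmxKV (yJ i) (\row_j rr j)).
  rewrite -/h0 [in RHS]mxE => <-; rewrite [RHS]mxE.
  under eq_bigr do rewrite pdv_comb mulr_sumr.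
  rewrite exchange_big pdv_comb mulr_sumr -sumrB; apply: eq_bigr => l _.
  rewrite [J _ _ _ _]mxE yR pdv_lin mulrBr mulr_suml mulr_sumr; congr (_ - _).
    by apply: eq_bigr => p _; rewrite /ul; ring.
  by rewrite /ul; ring.
move=> rr; pose h0 := \row_j rr (wc i j) *m invmx (K i (ext (y i))).
exists (fun b => h0 0 b) => j jc; have jE : wc i (Ordinal jc) = j by apply: val_inj.
have := congr1 (fun M : 'rV_ _ => M 0 (Ordinal jc)) (mulmxKV (yK i) (\row_j rr (wc i j))).
rewrite -/h0 [in RHS]mxE jE => <-; rewrite [RHS]mxE.
under [RHS]eq_bigr do rewrite [K _ _ _ _]mxE mulr_sumr.
rewrite [RHS]exchange_big; apply: eq_bigr => p _ /=.
under [RHS]eq_bigr do rewrite mulr_sumr.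
rewrite [RHS]exchange_big; apply: eq_bigr => q _ /=.
rewrite jE mulr_sumr mulr_suml -big_split mulr_sumr; apply: eq_bigr => b _ /=; ring.
Qed.

End QuadricBound.

(** * The bound without coordinates *)

Section Functionals.
Import VectorInternalTheory.
Variable k : fieldType.

(** A linear form, as a predicate on functions: it composes with maps that are
only known to be linear by a proof. *)
Definition functional (V : lmodType k) (phi : V -> k) :=
  forall a u v, phi (a *: u + v) = a * phi u + phi v.

Section OneFunctional.
Variables (V : lmodType k) (phi : V -> k).
Hypothesis Hphi : functional phi.

Lemma functional0 : phi 0 = 0.
Proof.
have := Hphi 1 0 0; rewrite scaler0 addr0 mul1r => /eqP.
by rewrite -subr_eq subrr eq_sym => /eqP.
Qed.
Lemma functionalZ a u : phi (a *: u) = a * phi u.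
Proof. by rewrite -[a *: u]addr0 Hphi functional0 addr0. Qed.
Lemma functionalD u v : phi (u + v) = phi u + phi v.
Proof. by rewrite -[u]scale1r Hphi mul1r scale1r. Qed.
Lemma functionalN u : phi (- u) = - phi u.
Proof. by rewrite -scaleN1r functionalZ mulN1r. Qed.
Lemma functional_sum (I : finType) (F : I -> V) : phi (\sum_i F i) = \sum_i phi (F i).
Proof.
rewrite !unlock; elim: (index_enum I) => [|i s IHs] /=; first exact: functional0.
by rewrite functionalD IHs.
Qed.
End OneFunctional.

Section LinearProp.
Variables (V W : lmodType k) (L : V -> W).
Hypothesis HL : linear L.
Lemma lin0 : L 0 = 0.
Proof.
have := HL 1 0 0; rewrite scaler0 addr0 scale1r => /eqP.
by rewrite -subr_eq subrr eq_sym => /eqP.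
Qed.
Lemma linZ a u : L (a *: u) = a *: L u.
Proof. by rewrite -[a *: u]addr0 HL lin0 addr0. Qed.
Lemma linD u v : L (u + v) = L u + L v.
Proof. by rewrite -[u]scale1r HL !scale1r. Qed.
Lemma linN u : L (- u) = - L u.
Proof. by rewrite -!scaleN1r linZ. Qed.
Lemma linB u v : L (u - v) = L u - L v.
Proof. by rewrite linD linN. Qed.
Lemma lin_sum (I : finType) (F : I -> V) : L (\sum_i F i) = \sum_i L (F i).
Proof.
rewrite !unlock; elim: (index_enum I) => [|i s IHs] /=; first exact: lin0.
by rewrite linD IHs.
Qed.
End LinearProp.

Lemma lin_comp (U V W : lmodType k) (F : V -> W) (G : U -> V) :
  linear F -> linear G -> linear (fun u => F (G u)).
Proof. by move=> HF HG a u v; rewrite HG HF. Qed.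
Lemma lin_sub (V W : lmodType k) (F G : V -> W) :
  linear F -> linear G -> linear (fun v => F v - G v).
Proof. by move=> HF HG a u v; rewrite HF HG scalerBr opprD addrACA. Qed.

Definition bilin (V V' W : lmodType k) (B : V -> V' -> W) :=
  (forall v', linear (B^~ v')) /\ (forall v, linear (B v)).

Lemma functional_linear (V W : lmodType k) (L : V -> W) phi :
  linear L -> functional phi -> functional (phi \o L).
Proof. by move=> HL Hphi a u v /=; rewrite HL Hphi. Qed.

Definition crd (V : vectType k) (v : V) (j : 'I_(dim V)) : k := v2r v 0 j.
Definition cbas (V : vectType k) (j : 'I_(dim V)) : V := r2v (delta_mx 0 j).

Lemma crd_functional (V : vectType k) j : functional (fun v : V => crd v j).
Proof. by move=> a u v; rewrite /crd linearP !mxE. Qed.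

Lemma crd_sum (V : vectType k) (v : V) : v = \sum_j crd v j *: cbas j.
Proof.
rewrite -[v in LHS]v2rK [v2r v]row_sum_delta linear_sum.
by apply: eq_bigr => j _; rewrite linearZ.
Qed.

Lemma eq_crd (V : vectType k) (u v : V) : (forall j, crd u j = crd v j) -> u = v.
Proof. by move=> H; rewrite [u]crd_sum [v]crd_sum; apply: eq_bigr => j _; rewrite H. Qed.

Definition of_crd (V : vectType k) (y : 'I_(dim V) -> k) : V := \sum_j y j *: cbas j.

Lemma crd_of_crd (V : vectType k) (y : 'I_(dim V) -> k) j : crd (of_crd y) j = y j.
Proof.
rewrite /of_crd (functional_sum (@crd_functional V j)) (bigD1 j) //= big1 ?addr0 => [|j' jj'].
  by rewrite (functionalZ (@crd_functional V j)) /crd r2vK mxE !eqxx mulr1.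
by rewrite (functionalZ (@crd_functional V j)) /crd r2vK mxE eqxx eq_sym (negPf jj') mulr0.
Qed.

Lemma lin_crd (V : vectType k) (W : lmodType k) (L : V -> W) u :
  linear L -> L u = \sum_i crd u i *: L (cbas i).
Proof.
move=> HL; rewrite {1}[u]crd_sum (lin_sum HL).
by apply: eq_bigr => i _; rewrite (linZ HL).
Qed.

Lemma bilin_crd (V V' : vectType k) (W : lmodType k) (B : V -> V' -> W) phi u v :
  bilin B -> functional phi ->
  phi (B u v) = \sum_i \sum_j (crd u i * crd v j) * phi (B (cbas i) (cbas j)).
Proof.
move=> [B1 B2] Hphi; have /= -> := lin_crd u (B1 v).
rewrite (functional_sum Hphi); apply: eq_bigr => i _.
rewrite (functionalZ Hphi) (lin_crd v (B2 _)) (functional_sum Hphi) mulr_sumr.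
by apply: eq_bigr => j _; rewrite (functionalZ Hphi) mulrA.
Qed.
End Functionals.

Section PolyMaps.
Variable k : closedFieldType.

Definition epoly (E : vectType k) (F : E -> k) :=
  exists x : pex k, forall v, F v = pev x (ext (crd v)).
(** Testing against linear forms spares the choice of coordinates of the target;
linear and bilinear maps then preserve polynomiality. *)
Definition vpoly (E : vectType k) (V : lmodType k) (F : E -> V) :=
  forall phi, functional phi -> epoly (phi \o F).

(** [sjet f a b]: the function f is a polynomial with expansion a + b t + ...; the
polynomial is determined by f, so a and b are as well. *)
Definition sjet (f : k -> k) (a b : k) :=
  exists q : {poly k}, [/\ forall t, f t = q.[t], q`_0 = a & q`_1 = b].
Definition vjet (V : lmodType k) (F : k -> V) (a b : V) :=
  forall phi, functional phi -> sjet (phi \o F) (phi a) (phi b).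

Section EPoly.
Variable E : vectType k.
Implicit Types F G : E -> k.

Lemma eq_epoly F G : F =1 G -> epoly F -> epoly G.
Proof. by move=> FG [x Fx]; exists x => v; rewrite -FG. Qed.
Lemma epoly_const (c : k) : epoly (fun _ : E => c).
Proof. by exists (PCst c). Qed.
Lemma epolyD F G : epoly F -> epoly G -> epoly (fun v => F v + G v).
Proof. by move=> [x Fx] [y Gy]; exists (PAdd x y) => v; rewrite Fx Gy. Qed.
Lemma epolyM F G : epoly F -> epoly G -> epoly (fun v => F v * G v).
Proof. by move=> [x Fx] [y Gy]; exists (PMul x y) => v; rewrite Fx Gy. Qed.
Lemma epoly_sum (I : finType) (F : I -> E -> k) :
  (forall i, epoly (F i)) -> epoly (fun v => \sum_i F i v).
Proof.
move=> H; rewrite unlock; elim: (index_enum I) => [|i s IHs] /=.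
  exact: epoly_const.
exact: epolyD.
Qed.
Lemma epoly_prod (I : finType) (F : I -> E -> k) :
  (forall i, epoly (F i)) -> epoly (fun v => \prod_i F i v).
Proof.
move=> H; rewrite unlock; elim: (index_enum I) => [|i s IHs] /=.
  exact: epoly_const.
exact: epolyM.
Qed.
Lemma epoly_det n (F : E -> 'M[k]_n) :
  (forall i j, epoly (fun e => F e i j)) -> epoly (fun e => \det (F e)).
Proof.
move=> H; apply: epoly_sum => s; apply: epolyM; first exact: epoly_const.
exact: epoly_prod.
Qed.
Lemma epoly_functional phi : functional phi -> epoly (phi : E -> k).
Proof.
move=> Hphi; apply: (@eq_epoly (fun v => \sum_j crd v j * phi (cbas j))).
  move=> v; rewrite [v in RHS]crd_sum (functional_sum Hphi).
  by apply: eq_bigr => j _; rewrite (functionalZ Hphi).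
apply: epoly_sum => j; apply: epolyM; last exact: epoly_const.
by exists (PVar j) => v; rewrite /pev /= ext_ord.
Qed.

Lemma eq_vpoly (V : lmodType k) (F G : E -> V) : F =1 G -> vpoly F -> vpoly G.
Proof. by move=> FG HF phi Hphi; apply: eq_epoly (HF phi Hphi) => v /=; rewrite FG. Qed.
Lemma vpoly_const (V : lmodType k) (c : V) : vpoly (fun _ : E => c).
Proof. by move=> phi _; apply: epoly_const. Qed.
Lemma vpoly_id : vpoly (fun v : E => v).
Proof. by move=> phi /epoly_functional. Qed.
Lemma vpoly_lin (V W : lmodType k) (L : V -> W) (F : E -> V) :
  linear L -> vpoly F -> vpoly (fun v => L (F v)).
Proof. by move=> HL HF phi Hphi; apply: (HF (phi \o L)); apply: functional_linear. Qed.
Lemma vpolyD (V : lmodType k) (F G : E -> V) :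
  vpoly F -> vpoly G -> vpoly (fun v => F v + G v).
Proof.
move=> HF HG phi Hphi; apply: eq_epoly (epolyD (HF phi Hphi) (HG phi Hphi)) => v /=.
by rewrite (functionalD Hphi).
Qed.
Lemma vpolyZ (V : lmodType k) (f : E -> k) (F : E -> V) :
  epoly f -> vpoly F -> vpoly (fun v => f v *: F v).
Proof.
move=> Hf HF phi Hphi; apply: eq_epoly (epolyM Hf (HF phi Hphi)) => v /=.
by rewrite (functionalZ Hphi).
Qed.
Lemma vpoly_bilin (V V' : vectType k) (W : lmodType k) (B : V -> V' -> W) (F : E -> V) (G : E -> V') :
  bilin B -> vpoly F -> vpoly G -> vpoly (fun v : E => B (F v) (G v)).
Proof.
move=> HB HF HG phi Hphi.
apply: (@eq_epoly (fun v => \sum_i \sum_j (crd (F v) i * crd (G v) j) * phi (B (cbas i) (cbas j)))).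
  by move=> v /=; rewrite (bilin_crd _ _ HB Hphi).
apply: epoly_sum => i; apply: epoly_sum => j; apply: epolyM; last exact: epoly_const.
by apply: epolyM; [apply: (HF _ (@crd_functional k V i))|apply: (HG _ (@crd_functional k V' j))].
Qed.
End EPoly.

Section Jets1.
Lemma eq_sjet f g a b : f =1 g -> sjet f a b -> sjet g a b.
Proof. by move=> fg [q [H ? ?]]; exists q; split=> // t; rewrite -fg. Qed.
Lemma sjet_inj f a b a' b' : sjet f a b -> sjet f a' b' -> a = a' /\ b = b'.
Proof.
move=> [q [H <- <-]] [q' [H' <- <-]]; suff -> : q = q' by [].
by apply/eqP; rewrite -subr_eq0; apply/eqP/poly_eq0_horner => t; rewrite hornerD hornerN -H -H' subrr.
Qed.
Lemma sjet_affine a b : sjet (fun t => a + t * b) a b.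
Proof.
exists (a%:P + b *: 'X); split=> [t||].
- by rewrite hornerD hornerC hornerZ hornerX mulrC.
- by rewrite coefD coefC coefZ coefX mulr0 addr0.
- by rewrite coefD coefC coefZ coefX mulr1 add0r.
Qed.
Lemma sjetD f g a b a' b' : sjet f a b -> sjet g a' b' ->
  sjet (fun t => f t + g t) (a + a') (b + b').
Proof.
move=> [q [H <- <-]] [q' [H' <- <-]]; exists (q + q'); split=> [t||].
- by rewrite hornerD H H'.
- by rewrite coefD.
- by rewrite coefD.
Qed.
Lemma sjetM f g a b a' b' : sjet f a b -> sjet g a' b' ->
  sjet (fun t => f t * g t) (a * a') (a * b' + b * a').
Proof.
move=> [q [H <- <-]] [q' [H' <- <-]]; exists (q * q'); split=> [t||].
- by rewrite hornerM H H'.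
- by rewrite coefM big_ord1.
- by rewrite coefM big_ord_recl big_ord1.
Qed.
Lemma sjet_const a : sjet (fun=> a) a 0.
Proof. by apply: eq_sjet (sjet_affine a 0) => t; rewrite mulr0 addr0. Qed.
Lemma sjet_sum (I : finType) (f : I -> k -> k) a b :
  (forall i, sjet (f i) (a i) (b i)) ->
  sjet (fun t => \sum_i f i t) (\sum_i a i) (\sum_i b i).
Proof.
move=> H; rewrite !unlock; elim: (index_enum I) => [|i s IHs] /=.
  exact: sjet_const.
exact: sjetD.
Qed.

Lemma vjet_affine (V : lmodType k) (a b : V) : vjet (fun t => a + t *: b) a b.
Proof.
move=> phi Hphi; apply: eq_sjet (sjet_affine _ _) => t /=.
by rewrite (functionalD Hphi) (functionalZ Hphi).
Qed.
Lemma vjet_const (V : lmodType k) (a : V) : vjet (fun=> a) a 0.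
Proof. by move=> phi Hphi; rewrite (functional0 Hphi); apply: sjet_const. Qed.
Lemma vjetD (V : lmodType k) (F G : k -> V) a b a' b' : vjet F a b -> vjet G a' b' ->
  vjet (fun t => F t + G t) (a + a') (b + b').
Proof.
move=> HF HG phi Hphi; rewrite !(functionalD Hphi).
by apply: eq_sjet (sjetD (HF _ Hphi) (HG _ Hphi)) => t; rewrite /= (functionalD Hphi).
Qed.
Lemma vjetZ (V : lmodType k) f (F : k -> V) a b a' b' : sjet f a b -> vjet F a' b' ->
  vjet (fun t => f t *: F t) (a *: a') (a *: b' + b *: a').
Proof.
move=> Hf HF phi Hphi; rewrite (functionalD Hphi) !(functionalZ Hphi).
by apply: eq_sjet (sjetM Hf (HF _ Hphi)) => t; rewrite /= (functionalZ Hphi).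
Qed.
Lemma eq_vjet (V : lmodType k) (F G : k -> V) a b a' b' :
  vjet F a b -> F =1 G -> a = a' -> b = b' -> vjet G a' b'.
Proof.
move=> HF FG <- <- phi Hphi; apply: eq_sjet (HF _ Hphi) => t /=; by rewrite FG.
Qed.
Lemma vjet_lin (V W : lmodType k) (L : V -> W) F a b :
  linear L -> vjet F a b -> vjet (fun t => L (F t)) (L a) (L b).
Proof. by move=> HL HF phi Hphi; apply: (HF (phi \o L)); apply: functional_linear. Qed.
Lemma vjet_bilin (V V' : vectType k) (W : lmodType k) (B : V -> V' -> W) F G a b a' b' :
  bilin B -> vjet F a b -> vjet G a' b' ->
  vjet (fun t => B (F t) (G t)) (B a a') (B a b' + B b a').
Proof.
move=> HB HF HG phi Hphi; rewrite (functionalD Hphi) !(bilin_crd _ _ HB Hphi).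
apply: (@eq_sjet (fun t => \sum_i \sum_j (crd (F t) i * crd (G t) j) * phi (B (cbas i) (cbas j)))).
  by move=> t; rewrite /= (bilin_crd _ _ HB Hphi).
rewrite -big_split; apply: sjet_sum => i /=; rewrite -big_split; apply: sjet_sum => j /=.
have := sjetM (sjetM (HF _ (@crd_functional k V i)) (HG _ (@crd_functional k V' j)))
  (sjet_const (phi (B (cbas i) (cbas j)))).
by rewrite mulr0 add0r mulrDl.
Qed.

Lemma pevX_coef01 x (e : nat -> {poly k}) :
  (pevX x e)`_0 = pev x (fun i => (e i)`_0) /\
  (pevX x e)`_1 = pdv x (fun i => (e i)`_0) (fun i => (e i)`_1).
Proof.
rewrite /pev; elim: x => /= [c|i|a [a0 a1] b [b0 b1]|a [a0 a1] b [b0 b1]] //.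
- by rewrite /pevX /= !coefC.
- by rewrite /pevX /= -/(pevX a e) -/(pevX b e) !coefD a0 a1 b0 b1.
- rewrite /pevX /= -/(pevX a e) -/(pevX b e) !coefM big_ord1 big_ord_recl big_ord1.
  by rewrite /= a0 a1 b0 b1 addrC.
Qed.

Lemma sjet_line (E : vectType k) x (v z : E) :
  sjet (fun t => pev x (ext (crd (v + t *: z)))) (pev x (ext (crd v)))
    (pdv x (ext (crd v)) (ext (crd z))).
Proof.
pose e i : {poly k} := (ext (crd v) i)%:P + ext (crd z) i *: 'X.
have e0 i : (e i)`_0 = ext (crd v) i.
  by rewrite coefD coefC coefZ coefX mulr0 addr0.
have e1 i : (e i)`_1 = ext (crd z) i.
  by rewrite coefD coefC coefZ coefX mulr1 add0r.
have [H0 H1] := pevX_coef01 x e.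
exists (pevX x e); split=> [t||].
- rewrite horner_pevX; apply: eq_pex_eval => i; rewrite /e hornerD hornerC hornerZ hornerX.
  rewrite /ext; case: insubP => [j _ _|_]; last by rewrite mul0r addr0.
  have phi := @crd_functional k E j; by rewrite (functionalD phi) (functionalZ phi) mulrC.
- by rewrite H0; apply: eq_pex_eval.
- by rewrite H1; apply: eq_pdv.
Qed.

Lemma sjet_epoly (E : vectType k) (F : E -> k) (v z : E) :
  epoly F -> exists b, sjet (fun t => F (v + t *: z)) (F v) b.
Proof.
move=> [x Fx]; exists (pdv x (ext (crd v)) (ext (crd z))).
by rewrite Fx; apply: eq_sjet (sjet_line x v z) => t; rewrite Fx.
Qed.
End Jets1.

(** A polynomial function that vanishes where another one does not vanish is
zero: restrict to a line through a nonzero of the second. *)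
Lemma epoly_density (E : vectType k) (D F : E -> k) g0 : epoly D -> epoly F ->
  D g0 != 0 -> (forall g, D g != 0 -> F g = 0) -> forall g, F g = 0.
Proof.
move=> HD HF D0 H g.
have [b [qD [qDE qD0 _]]] := sjet_epoly g0 (g - g0) HD.
have [b' [qF [qFE _ _]]] := sjet_epoly g0 (g - g0) HF.
have : qD * qF = 0.
  apply: poly_eq0_horner => t; rewrite hornerM -qDE -qFE.
  by have [->|/H->] := eqVneq (D (g0 + t *: (g - g0))) 0; rewrite ?mul0r ?mulr0.
move/eqP; rewrite mulf_eq0 => /orP[/eqP qD00|/eqP qF0].
  by move: D0; rewrite -qD0 qD00 coef0 eqxx.
by have := qFE 1; rewrite scale1r addrC subrK qF0 horner0.
Qed.

Section OrbitsBound.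
Variables (V T : vectType k) (c0 : T) (L : V -> T) (Q : V -> V -> T).
Hypotheses (HL : linear L) (HQ : bilin Q).
Variables (r : nat) (E : 'I_r -> vectType k).
Variables (D : forall i, E i -> k) (N : forall i, E i -> V) (g0 : forall i, E i) (p : 'I_r -> V).
Arguments D : clear implicits.
Arguments N : clear implicits.
Arguments g0 : clear implicits.
Hypothesis Dpoly : forall i, epoly (D i).
Hypothesis Npoly : forall i, vpoly (N i).
Hypothesis D0 : forall i, D i (g0 i) != 0.
Hypothesis N0 : forall i, N i (g0 i) = D i (g0 i) *: p i.
Hypothesis eqn : forall i g, D i g != 0 ->
  let v := (D i g)^-1 *: N i g in c0 + L v + Q v v = 0.
Hypothesis tangent : forall i v, L v + Q (p i) v + Q v (p i) = 0 ->
  exists z d1, sjet (fun t => D i (g0 i + t *: z)) (D i (g0 i)) d1 /\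
    vjet (fun t => N i (g0 i + t *: z)) (N i (g0 i)) (D i (g0 i) *: v + d1 *: p i).
Hypothesis sep : forall i j, i != j -> forall g g', D i g != 0 -> D j g' != 0 ->
  (D i g)^-1 *: N i g <> (D j g')^-1 *: N j g'.

Let n := dim V.
(** The equations made homogeneous of degree 2 with coordinate 0. *)
Let f (l : 'I_(dim T)) (a b : 'I_n.+1) : k :=
  match unlift ord0 a, unlift ord0 b with
  | None, None => crd c0 l
  | None, Some j => crd (L (@cbas k V j)) l
  | Some _, None => 0
  | Some i, Some j => crd (Q (@cbas k V i) (@cbas k V j)) l
  end.
Let vec (X : 'I_n.+1 -> k) : V := of_crd (fun j => X (lift ord0 j)).

Let fE l (X Y : 'I_n.+1 -> k) :
  \sum_a \sum_b f l a b * (X a * Y b) =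
  crd (X ord0 * Y ord0 *: c0 + X ord0 *: L (vec Y) + Q (vec X) (vec Y)) l.
Proof.
have phi := @crd_functional k T l.
rewrite !(functionalD phi) !(functionalZ phi) (bilin_crd _ _ HQ phi).
rewrite big_ord_recl; congr (_ + _).
  rewrite big_ord_recl /f unlift_none; congr (_ + _); first by rewrite mulrC.
  rewrite (lin_crd (vec Y) HL) (functional_sum phi) mulr_sumr.
  apply: eq_bigr => j _; rewrite liftK (functionalZ phi) crd_of_crd; ring.
apply: eq_bigr => i _; rewrite big_ord_recl /f liftK unlift_none mul0r add0r.
apply: eq_bigr => j _; rewrite liftK /vec !crd_of_crd; ring.
Qed.

(** [quadric_families_bound] for an inhomogeneous quadratic map c0 + L v + Q v v on
a vector space. The i-th family is g |-> N g / D g; D serves as the homogenising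
coordinate. The tangency hypothesis asks that every solution v of the equation
linearised at [p i] is the velocity of N / D along some line, which after
clearing the denominator reads N' = D v + D' p. *)
Lemma quadratic_families_bound : (r <= 2 ^ minn (dim V) (dim T))%N.
Proof.
pose Pv i (a : 'I_n.+1) (g : E i) : k :=
  if unlift ord0 a is Some j then crd (N i g) j else D i g.
have Pvp i a : epoly (Pv i a).
  rewrite /Pv; case: unliftP => [j _|_]; last exact: Dpoly.
  by apply: eq_epoly (Npoly i (@crd_functional k V j)).
have /choice[P PE] : forall i, exists P : 'I_n.+1 -> pex k, forall a g,
    Pv i a g = pev (P a) (ext (crd g)).
  move=> i; suff /choice[P HP] : forall a, exists x : pex k, forall g,
    Pv i a g = pev x (ext (crd g)) by exists P.
  by move=> a; apply: Pvp.
have PE' i a (y : 'I_(dim (E i)) -> k) : pev (P i a) (ext y) = Pv i a (of_crd y).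
  rewrite PE; apply: eq_pex_eval => t; rewrite /ext; case: insubP => // t' _ _.
  by rewrite crd_of_crd.
have Pv0 i g : Pv i ord0 g = D i g by rewrite /Pv unlift_none.
have PvS i g j : Pv i (lift ord0 j) g = crd (N i g) j by rewrite /Pv liftK.
have vecP i g : vec (fun a => Pv i a g) = N i g.
  by apply: eq_crd => j; rewrite crd_of_crd PvS.
have eqnD i g : D i g != 0 ->
    D i g * D i g *: c0 + D i g *: L (N i g) + Q (N i g) (N i g) = 0.
  move=> Dg; have := congr1 (fun v => D i g * D i g *: v) (eqn Dg).
  have -> : N i g = D i g *: ((D i g)^-1 *: N i g) by rewrite scalerA mulfV // scale1r.
  set v := _^-1 *: N i g; rewrite scalerK // scaler0 !scalerDr => <-.
  by rewrite (linZ HL) (linZ (HQ.1 _)) (linZ (HQ.2 _)) !scalerA.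
have Pquad i g l : \sum_a \sum_b f l a b * (Pv i a g * Pv i b g) = 0.
  rewrite fE vecP !Pv0.
  pose F g := crd (D i g * D i g *: c0 + D i g *: L (N i g) + Q (N i g) (N i g)) l.
  apply: (@epoly_density _ (D i) F (g0 i)) => //.
    apply: (@vpolyD _ _ _ _ _ _ (fun v => crd v l)); last exact: crd_functional.
      apply: vpolyD; apply: vpolyZ => //; first exact: epolyM.
        exact: vpoly_const.
      exact: vpoly_lin.
    exact: vpoly_bilin.
  move=> g' Dg; rewrite /F eqnD //; exact: functional0 (@crd_functional k T l).
apply: (@quadric_families_bound k n (dim T) r f (fun i => dim (E i)) P (fun i => crd (g0 i))).
- by move=> i; rewrite -PE Pv0.
- move=> i y l; rewrite -[RHS](Pquad i (of_crd y) l).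
  by apply: eq_bigr => a _; apply: eq_bigr => b _; rewrite !PE'.
- move=> i X HX.
  (* X and v differ by a multiple of the radial direction, which is tangent because
  p i solves the equation. *)
  pose v := vec X - X ord0 *: p i.
  have [|z [d1 [jD jN]]] := tangent (i := i) (v := v).
    apply: eq_crd => l; have := HX l.
    rewrite (eq_bigr (fun a => \sum_b f l a b * (Pv i a (g0 i) * X b)
                             + \sum_b f l a b * (X a * Pv i b (g0 i)))); last first.
      by move=> a _; rewrite -big_split; apply: eq_bigr => b _; rewrite -!PE mulrDr.
    rewrite big_split /= !fE vecP Pv0 N0.
    have phi := @crd_functional k T l.
    rewrite -(functionalD phi) (functional0 phi) => H.
    have : D i (g0 i) * crd (L v + Q (p i) v + Q v (p i)) l = 0; last first.
      by move/eqP; rewrite mulf_eq0 (negPf (D0 i)) => /eqP.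
    have := eqn (D0 i); rewrite N0 scalerK //= => E0.
    rewrite -(functionalZ phi) -[RHS]H; congr (crd _ l).
    have E1 : X ord0 *: (c0 + L (p i) + Q (p i) (p i)) = 0 by rewrite E0 scaler0.
    rewrite /v (linB HL) (linB (HQ.1 _)) (linB (HQ.2 _)) !(linZ HL).
    rewrite !(linZ (HQ.1 _)) !(linZ (HQ.2 _)).
    move: E1; rewrite !scalerDr !scalerA.
    move: (L (vec X)) (Q (p i) (vec X)) (Q (vec X) (p i)) (L (p i)) (Q (p i) (p i)).
    move=> A B C G H' E1.
    apply: eq_crd => l'; have phi' := @crd_functional k T l'.
    have := congr1 (fun u => crd u l') E1.
    rewrite !scalerN !(functionalD phi') !(functionalN phi') !(functionalZ phi') (functional0 phi') => E2.
    apply/eqP; rewrite -subr_eq0; apply/eqP.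
    transitivity (- 2%:R * D i (g0 i) * (X ord0 * crd c0 l' + X ord0 * crd G l'
       + X ord0 * crd H' l')); last by rewrite E2 mulr0.
    ring.
  pose dd := D i (g0 i).
  have pdE a : pdv (P i a) (ext (crd (g0 i))) (ext (crd z)) =
      if unlift ord0 a is Some j then dd * crd v j + d1 * crd (p i) j else d1.
    have J := sjet_line (P i a) (g0 i) z.
    have PvJ : sjet (fun t => Pv i a (g0 i + t *: z)) (Pv i a (g0 i))
      (if unlift ord0 a is Some j then dd * crd v j + d1 * crd (p i) j else d1).
      rewrite /Pv; case: unliftP => [j _|_] //.
      have phi := @crd_functional k V j; have := jN _ phi.
      by rewrite (functionalD phi) !(functionalZ phi).
    have J' := eq_sjet (fun t => esym (PE i a _)) J.
    by case: (sjet_inj J' PvJ).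
  exists ((X ord0 - d1 / dd) / dd), (fun j => dd^-1 * crd z j) => a.
  have -> : pdv (P i a) (ext (crd (g0 i))) (ext (fun j => dd^-1 * crd z j)) =
            dd^-1 * pdv (P i a) (ext (crd (g0 i))) (ext (crd z)).
    rewrite -pdvZ; apply: eq_pdv => // t; rewrite /ext.
    by case: insubP => // _; rewrite mulr0.
  rewrite pdE -PE /Pv; case: unliftP => [j ->|->].
    rewrite N0 (functionalZ (@crd_functional k V j)) -/dd.
    have -> : X (lift ord0 j) = crd v j + X ord0 * crd (p i) j.
      have phi := @crd_functional k V j.
      by rewrite /v (functionalD phi) (functionalN phi) (functionalZ phi) crd_of_crd subrK.
    by field; apply: D0.
  by rewrite -/dd; field; apply: D0.
move=> i j ij y y'.
rewrite !PE' !Pv0 => Dy Dy'.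
apply: contrapT => H; apply: (sep ij Dy Dy'); apply: eq_crd => l.
have phi := @crd_functional k V l; rewrite !(functionalZ phi).
apply/eqP/negPn/negP => HH; apply: H; exists (lift ord0 l); rewrite !PE' !PvS.
apply: contra_neq HH => HH; apply: (mulfI Dy); apply: (mulfI Dy').
rewrite mulVKf // mulrCA mulVKf // mulrC HH mulrC //.
Qed.
End OrbitsBound.
End PolyMaps.

Section MoreJets.
Variable k : closedFieldType.

(** A polynomial map multiplied by t^2 does not affect first-order
expansions. *)
Lemma vjet_sq (E : vectType k) (V : lmodType k) (F : E -> V) (v z : E) : vpoly F ->
  vjet (fun t => (t * t) *: F (v + t *: z)) 0 0.
Proof.
move=> HF phi Hphi; have [b Hb] := sjet_epoly v z (HF phi Hphi).
have id0 := sjet_affine 0 (1 : k).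
rewrite (functional0 Hphi); have := sjetM (sjetM id0 id0) Hb.
rewrite !(mul0r, mulr0, addr0) => H; apply: eq_sjet H => t /=.
by rewrite add0r mulr1 (functionalZ Hphi).
Qed.

Lemma pair_linl (V W : lmodType k) : linear (fun u : V => (u, 0 : W)).
Proof. by move=> a u v; apply: injective_projections; rewrite /= ?scaler0 ?addr0. Qed.
Lemma pair_linr (V W : lmodType k) : linear (fun u : W => (0 : V, u)).
Proof. by move=> a u v; apply: injective_projections; rewrite /= ?scaler0 ?addr0. Qed.

Lemma pair_split (V W : lmodType k) (u : V) (w : W) : (u, w) = (u, 0) + (0, w).
Proof. by apply: injective_projections; rewrite /= ?addr0 ?add0r. Qed.

Lemma vpoly_pair (E : vectType k) (V W : lmodType k) (F : E -> V) (G : E -> W) :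
  vpoly F -> vpoly G -> vpoly (fun g => (F g, G g)).
Proof.
move=> HF HG phi Hphi.
apply: eq_epoly (vpolyD (vpoly_lin (@pair_linl V W) HF) (vpoly_lin (@pair_linr V W) HG) Hphi) => g /=.
by rewrite -pair_split.
Qed.

Lemma vjet_pair (V W : lmodType k) (F : k -> V) (G : k -> W) a b a' b' :
  vjet F a b -> vjet G a' b' -> vjet (fun t => (F t, G t)) (a, a') (b, b').
Proof.
move=> HF HG.
apply: eq_vjet (vjetD (vjet_lin (@pair_linl V W) HF) (vjet_lin (@pair_linr V W) HG)) _ _ _.
- by move=> t; rewrite -pair_split.
- by rewrite -pair_split.
- by rewrite -pair_split.
Qed.
End MoreJets.

Local Open Scope mor_scope.
Local Open Scope obj_scope.

(** * Monoidal categories *)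

Section Linearity.
Variables (k : fieldType) (C : lincat k).
Implicit Types (A B D : C).

Lemma compDl A B D (g g' : hom B D) (f : hom A B) : (g + g') ∘ f = g ∘ f + g' ∘ f.
Proof. by have := comp_linl f 1 g g'; rewrite !scale1r. Qed.
Lemma compDr A B D (g : hom B D) (f f' : hom A B) : g ∘ (f + f') = g ∘ f + g ∘ f'.
Proof. by have := comp_linr g 1 f f'; rewrite !scale1r. Qed.
Lemma comp0m A B D (f : hom A B) : (0 : hom B D) ∘ f = 0.
Proof. by apply: (addrI (0 ∘ f)); rewrite -compDl !addr0. Qed.
Lemma compm0 A B D (g : hom B D) : g ∘ (0 : hom A B) = 0.
Proof. by apply: (addrI (g ∘ 0)); rewrite -compDr !addr0. Qed.
Lemma compZl A B D a (g : hom B D) (f : hom A B) : (a *: g) ∘ f = a *: (g ∘ f).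
Proof. by have := comp_linl f a g 0; rewrite !addr0 comp0m addr0. Qed.
Lemma compZr A B D a (g : hom B D) (f : hom A B) : g ∘ (a *: f) = a *: (g ∘ f).
Proof. by have := comp_linr g a f 0; rewrite !addr0 compm0 addr0. Qed.
Lemma compNl A B D (g : hom B D) (f : hom A B) : (- g) ∘ f = - (g ∘ f).
Proof. by rewrite -scaleN1r compZl scaleN1r. Qed.
Lemma compNr A B D (g : hom B D) (f : hom A B) : g ∘ (- f) = - (g ∘ f).
Proof. by rewrite -scaleN1r compZr scaleN1r. Qed.
End Linearity.

Section Monoidal.
Variables (k : fieldType) (C : moncat k).
Implicit Types (A B D E : C).

Lemma tensDl A A' B B' (f f' : hom A A') (g : hom B B') :
  (f + f') ⊠ g = f ⊠ g + f' ⊠ g.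
Proof. by have := tensm_linl g 1 f f'; rewrite !scale1r. Qed.
Lemma tensDr A A' B B' (f : hom A A') (g g' : hom B B') :
  f ⊠ (g + g') = f ⊠ g + f ⊠ g'.
Proof. by have := tensm_linr f 1 g g'; rewrite !scale1r. Qed.
Lemma tens0m A A' B B' (g : hom B B') : (0 : hom A A') ⊠ g = 0.
Proof. by apply: (addrI (0 ⊠ g)); rewrite -tensDl !addr0. Qed.
Lemma tensm0 A A' B B' (f : hom A A') : f ⊠ (0 : hom B B') = 0.
Proof. by apply: (addrI (f ⊠ 0)); rewrite -tensDr !addr0. Qed.
Lemma tensZl A A' B B' a (f : hom A A') (g : hom B B') : (a *: f) ⊠ g = a *: (f ⊠ g).
Proof. by have := tensm_linl g a f 0; rewrite !addr0 tens0m addr0. Qed.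
Lemma tensZr A A' B B' a (f : hom A A') (g : hom B B') : f ⊠ (a *: g) = a *: (f ⊠ g).
Proof. by have := tensm_linr f a g 0; rewrite !addr0 tensm0 addr0. Qed.

Lemma tensNl A A' B B' (f : hom A A') (g : hom B B') : (- f) ⊠ g = - (f ⊠ g).
Proof. by rewrite -scaleN1r tensZl scaleN1r. Qed.
Lemma tensNr A A' B B' (f : hom A A') (g : hom B B') : f ⊠ (- g) = - (f ⊠ g).
Proof. by rewrite -scaleN1r tensZr scaleN1r. Qed.

Lemma whiskl A B B' B'' (g : hom B' B'') (f : hom B B') :
  idm A ⊠ (g ∘ f) = (idm A ⊠ g) ∘ (idm A ⊠ f).
Proof. by rewrite -tensm_comp comp1m. Qed.
Lemma whiskr A A' A'' B (g : hom A' A'') (f : hom A A') :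
  (g ∘ f) ⊠ idm B = (g ⊠ idm B) ∘ (f ⊠ idm B).
Proof. by rewrite -tensm_comp comp1m. Qed.
Lemma tens_lr A A' B B' (f : hom A A') (g : hom B B') :
  f ⊠ g = (f ⊠ idm B') ∘ (idm A ⊠ g).
Proof. by rewrite -tensm_comp comp1m compm1. Qed.
Lemma tens_rl A A' B B' (f : hom A A') (g : hom B B') :
  f ⊠ g = (idm A' ⊠ g) ∘ (f ⊠ idm B).
Proof. by rewrite -tensm_comp comp1m compm1. Qed.

(** Rewriting inside a left-nested composition. *)
Lemma comp_swap A B B' D E (x : hom D E) (a : hom B D) (b : hom A B) (c : hom B' D) (d : hom A B') :
  a ∘ b = c ∘ d -> x ∘ a ∘ b = x ∘ c ∘ d.
Proof. by move=> H; rewrite -!compA H. Qed.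
Lemma comp_merge A B D E (x : hom D E) (a : hom B D) (b : hom A B) (c : hom A D) :
  a ∘ b = c -> x ∘ a ∘ b = x ∘ c.
Proof. by move=> H; rewrite -!compA H. Qed.

Lemma cancel_r A B D (e : hom A B) (e' : hom B A) (f g : hom B D) :
  e ∘ e' = idm B -> f ∘ e = g ∘ e -> f = g.
Proof. by move=> ee fg; rewrite -(compm1 f) -ee compA fg -compA ee compm1. Qed.
Lemma cancel_l A B D (e : hom B D) (e' : hom D B) (f g : hom A B) :
  e' ∘ e = idm B -> e ∘ f = e ∘ g -> f = g.
Proof. by move=> ee fg; rewrite -(comp1m f) -ee -compA fg compA ee comp1m. Qed.

Lemma tens1_inj A B (f g : hom A B) : idm one ⊠ f = idm one ⊠ g -> f = g.
Proof.
move=> H; apply: (cancel_r (lunitVK A)).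
by rewrite -!lunit_nat H.
Qed.
Lemma tensr1_inj A B (f g : hom A B) : f ⊠ idm one = g ⊠ idm one -> f = g.
Proof.
move=> H; apply: (cancel_r (runitVK A)).
by rewrite -!runit_nat H.
Qed.

Lemma lunitV_nat A A' (f : hom A A') : (idm one ⊠ f) ∘ lunitV A = lunitV A' ∘ f.
Proof.
apply: (cancel_l (lunitK A')); rewrite compA lunit_nat -compA lunitVK compm1.
by rewrite compA lunitVK comp1m.
Qed.
Lemma runitV_nat A A' (f : hom A A') : (f ⊠ idm one) ∘ runitV A = runitV A' ∘ f.
Proof.
apply: (cancel_l (runitK A')); rewrite compA runit_nat -compA runitVK compm1.
by rewrite compA runitVK comp1m.
Qed.
Lemma assocV_nat A A' B B' D D' (f : hom A A') (g : hom B B') (h : hom D D') :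
  assocV A' B' D' ∘ (f ⊠ (g ⊠ h)) = (f ⊠ g ⊠ h) ∘ assocV A B D.
Proof.
apply: (cancel_l (assocK A' B' D')); rewrite !compA assocVK comp1m assoc_nat.
by rewrite -compA assocVK compm1.
Qed.

(** Kelly's argument: after tensoring with the unit on the left, which is
faithful, both sides are compared through the pentagon and the triangle. *)
Lemma lunit_assoc A B : lunit (A ⊗ B) ∘ assoc one A B = lunit A ⊠ idm B.
Proof.
apply: tens1_inj.
apply: (@cancel_r _ _ _ (assoc one (one ⊗ A) B) (assocV one (one ⊗ A) B)); first exact: assocVK.
apply: (@cancel_r _ _ _ (assoc one one A ⊠ idm B) (assocV one one A ⊠ idm B)).
  by rewrite -whiskr assocVK tensm1.
transitivity ((idm one ⊠ lunit (A ⊗ B)) ∘ (assoc one one (A ⊗ B) ∘ assoc (one ⊗ one) A B)).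
  by rewrite pentagon whiskl !compA.
rewrite -assoc_nat -(compA (assoc _ _ _)) -whiskr triangle assoc_nat tensm1 -triangle.
by rewrite compA.
Qed.

(** The mirror image of [lunit_assoc]. *)
Lemma runit_assoc A B : (idm A ⊠ runit B) ∘ assoc A B one = runit (A ⊗ B).
Proof.
apply: tensr1_inj.
apply: (@cancel_l _ _ _ (assoc A B one) (assocV A B one)); first exact: assocK.
transitivity ((idm A ⊠ (idm B ⊠ lunit one)) ∘ (assoc A B (one ⊗ one) ∘ assoc (A ⊗ B) one one)).
  rewrite pentagon whiskr !compA assoc_nat -whiskl triangle.
  by [].
by rewrite compA -assoc_nat -compA tensm1 triangle.
Qed.

(** By [lunit_assoc] and the triangle both become equal after tensoring with the
unit, as naturality identifies the two ways of removing a unit from 1 (x) 1. *)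
Lemma lunit_runit_one : lunit one = runit (one : C).
Proof.
apply: tensr1_inj; rewrite -lunit_assoc -triangle; congr (_ ∘ _).
apply: (cancel_l (lunitK _)); by rewrite lunit_nat.
Qed.

Lemma lunitV_runitV_one : lunitV one = runitV (one : C).
Proof.
apply: (cancel_l (lunitK _)); rewrite lunitVK.
by rewrite lunit_runit_one runitVK.
Qed.

Lemma lunitV_assoc A B : assoc one A B ∘ (lunitV A ⊠ idm B) = lunitV (A ⊗ B).
Proof.
apply: (cancel_l (lunitK _)); rewrite compA lunit_assoc lunitVK -whiskr lunitVK.
exact: tensm1.
Qed.

Lemma runitV_assoc A B : assoc A B one ∘ runitV (A ⊗ B) = idm A ⊠ runitV B.
Proof.
apply: (@cancel_l _ _ _ (idm A ⊠ runit B) (idm A ⊠ runitV B)).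
  by rewrite -whiskl runitK tensm1.
by rewrite compA runit_assoc runitVK -whiskl runitVK tensm1.
Qed.

Lemma triangleV A B : assoc A one B ∘ (runitV A ⊠ idm B) = idm A ⊠ lunitV B.
Proof.
apply: (@cancel_l _ _ _ (idm A ⊠ lunit B) (idm A ⊠ lunitV B)).
  by rewrite -whiskl lunitK tensm1.
by rewrite compA triangle -whiskr runitVK -whiskl lunitVK !tensm1.
Qed.
End Monoidal.

(** * Global elements and inner automorphisms *)

Section GlobalElements.
Variables (k : fieldType) (C : moncat k) (X : algebra C).
Local Notation m := (amul X).
Local Notation e := (aunit X).

Lemma amulA : m ∘ (m ⊠ idm X) = m ∘ (idm X ⊠ m) ∘ assoc X X X.
Proof. exact: smulA. Qed.
Lemma amul1m : m ∘ (e ⊠ idm X) = lunit X. Proof. exact: smul1m. Qed.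
Lemma amulm1 : m ∘ (idm X ⊠ e) = runit X. Proof. exact: smulm1. Qed.

(** Multiplications by a global element. Statements about Gamma(X) and its action
on X reduce to the algebra of these endomorphisms. *)
Definition lmul (u : hom one X) : hom X X := m ∘ (u ⊠ idm X) ∘ lunitV X.
Definition rmul (u : hom one X) : hom X X := m ∘ (idm X ⊠ u) ∘ runitV X.

Lemma lmul_unit : lmul e = idm X.
Proof. by rewrite /lmul amul1m lunitVK. Qed.
Lemma rmul_unit : rmul e = idm X.
Proof. by rewrite /rmul amulm1 runitVK. Qed.

Lemma lmulE u v : lmul u ∘ v = star u v.
Proof.
rewrite /lmul /star -!compA -lunitV_nat; congr (_ ∘ _).
by rewrite compA -tens_lr. Qed.
Lemma rmulE u v : rmul v ∘ u = star u v.
Proof.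
rewrite /rmul /star -!compA -runitV_nat lunitV_runitV_one; congr (_ ∘ _).
by rewrite compA -tens_rl.
Qed.

Lemma lmul_amul u : lmul u ∘ m = m ∘ (lmul u ⊠ idm X).
Proof.
rewrite /lmul !whiskr !compA amulA.
rewrite (comp_swap _ (assoc_nat _ _ _)) (comp_merge _ (lunitV_assoc _ _)) tensm1.
rewrite (comp_swap _ (esym (lunitV_nat _))); congr (_ ∘ _).
by rewrite -!compA -tens_lr -tens_rl.
Qed.

Lemma rmul_amul u : rmul u ∘ m = m ∘ (idm X ⊠ rmul u).
Proof.
rewrite /rmul !whiskl !compA.
rewrite (comp_swap _ (esym (runitV_nat _))) -(comp_merge _ (runitV_assoc _ _)).
rewrite (comp_swap _ (esym (assoc_nat _ _ _))) -amulA tensm1; congr (_ ∘ _).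
by rewrite -!compA -tens_lr -tens_rl.
Qed.

(** (a u) b = a (u b). *)
Lemma amul_middle u : m ∘ (rmul u ⊠ idm X) = m ∘ (idm X ⊠ lmul u).
Proof.
rewrite /rmul /lmul !whiskr !whiskl -triangleV !compA amulA.
by rewrite (comp_swap _ (assoc_nat _ _ _)).
Qed.

Lemma lmul_rmul u v : lmul u ∘ rmul v = rmul v ∘ lmul u.
Proof.
rewrite [in LHS]/rmul [LHS]compA [X in X ∘ _]compA lmul_amul -(compA m) -tens_lr tens_rl compA.
by rewrite (comp_swap _ (runitV_nat _)).
Qed.

Lemma lmul_star u v : lmul (star u v) = lmul u ∘ lmul v.
Proof. by rewrite [lmul v]/lmul [RHS]compA [X in X ∘ _]compA lmul_amul -(compA m) -whiskr lmulE. Qed.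
Lemma rmul_star u v : rmul (star u v) = rmul v ∘ rmul u.
Proof. by rewrite [rmul u in RHS]/rmul [RHS]compA [X in X ∘ _]compA rmul_amul -(compA m) -whiskl rmulE. Qed.

Lemma starA (u v w : hom one X) : star u (star v w) = star (star u v) w.
Proof. by rewrite -(lmulE u (star v w)) -(lmulE v w) compA -lmul_star lmulE. Qed.
Lemma star1e (u : hom one X) : star e u = u.
Proof. by rewrite -lmulE lmul_unit comp1m. Qed.
Lemma stare1 (u : hom one X) : star u e = u.
Proof. by rewrite -rmulE rmul_unit comp1m. Qed.

Lemma conj_byE (u v : hom one X) : conj_by u v = rmul v ∘ lmul u.
Proof.
rewrite /conj_by [_ ⊠ v]tens_rl !compA.
have -> : m ∘ (m ⊠ idm X) ∘ (idm (X ⊗ X) ⊠ v) = m ∘ (idm X ⊠ v) ∘ (m ⊠ idm one).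
  by rewrite -!compA -tens_lr -tens_rl.
rewrite (comp_swap _ (runitV_nat (lunitV X))) (comp_swap _ (runitV_nat (u ⊠ idm X))).
by rewrite (comp_swap _ (runitV_nat m)).
Qed.

(** (u a v) (u b v) = u a b v, since v u = 1. *)
Lemma conj_by_alg u v : star_inverse u v -> @alg_hom k C X X (conj_by u v).
Proof.
move=> [uv vu]; rewrite conj_byE; split.
  have E : amul X ∘ (rmul v ⊠ lmul u) = amul X.
    rewrite tens_lr compA amul_middle -compA -whiskl -lmul_star vu lmul_unit.
    by rewrite tensm1 compm1.
  rewrite -{3}lmul_rmul tensm_comp compA E -compA lmul_amul compA rmul_amul.
  by rewrite -compA -tens_rl.
by rewrite -compA lmulE stare1 rmulE uv.
Qed.

Lemma conj_by_star (u v u' v' : hom one X) :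
  conj_by u' v' ∘ conj_by u v = conj_by (star u' u) (star v v').
Proof.
rewrite !conj_byE lmul_star rmul_star -(compA (rmul v')) (compA (lmul u')) lmul_rmul.
by rewrite !compA.
Qed.

Lemma conj_by_unit : conj_by (aunit X) (aunit X) = idm X.
Proof. by rewrite conj_byE lmul_unit rmul_unit comp1m. Qed.

Lemma star_inverse_comp (u v u' v' : hom one X) : star_inverse u v -> star_inverse u' v' ->
  star_inverse (star u' u) (star v v').
Proof.
move=> [uv vu] [uv' vu']; split.
  by rewrite -starA (starA u) uv star1e.
by rewrite -starA (starA v') vu' star1e.
Qed.

(** If the unit is 0, so is the identity of X. *)
Lemma alg_unit0 : aunit X = 0 -> forall B (f : hom B X), f = 0.
Proof.
move=> e0 B f; rewrite -(comp1m f) -(lunitVK X) -amul1m e0 tens0m compm0 !comp0m //.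
Qed.

End GlobalElements.

(** * Transport of algebra structures *)

Section Transport.
Variables (k : fieldType) (C : moncat k) (A : algebra C) (B : C).
Variables (g : hom A B) (g' : hom B A).
Hypotheses (gK : g' ∘ g = idm A) (g'K : g ∘ g' = idm B).

Definition tr_mul : hom (B ⊗ B) B := g ∘ amul A ∘ (g' ⊠ g').
Definition tr_unit : hom one B := g ∘ aunit A.

Lemma tr_mulA : tr_mul ∘ (tr_mul ⊠ idm B) = tr_mul ∘ (idm B ⊠ tr_mul) ∘ assoc B B B.
Proof.
have E : g' ∘ tr_mul = amul A ∘ (g' ⊠ g') by rewrite /tr_mul !compA gK comp1m.
have E1 : tr_mul ∘ (tr_mul ⊠ idm B) = g ∘ (amul A ∘ (amul A ⊠ idm A)) ∘ (g' ⊠ g' ⊠ g').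
  rewrite {1}/tr_mul -(compA _ (g' ⊠ g')) -tensm_comp E compm1.
  by rewrite -!compA -tensm_comp comp1m.
have E2 : tr_mul ∘ (idm B ⊠ tr_mul) = g ∘ (amul A ∘ (idm A ⊠ amul A)) ∘ (g' ⊠ (g' ⊠ g')).
  rewrite {1}/tr_mul -(compA _ (g' ⊠ g')) -tensm_comp E compm1.
  by rewrite -!compA -tensm_comp comp1m.
by rewrite E1 E2 amulA -!compA assoc_nat.
Qed.

Lemma tr_mul1m : tr_mul ∘ (tr_unit ⊠ idm B) = lunit B.
Proof.
rewrite /tr_mul /tr_unit -compA -tensm_comp compA gK comp1m compm1.
by rewrite [aunit A ⊠ g']tens_lr compA -(compA g) amul1m -(compA g) lunit_nat compA g'K comp1m.
Qed.

Lemma tr_mulm1 : tr_mul ∘ (idm B ⊠ tr_unit) = runit B.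
Proof.
rewrite /tr_mul /tr_unit -compA -tensm_comp compA gK comp1m compm1.
by rewrite [g' ⊠ aunit A]tens_rl compA -(compA g) amulm1 -(compA g) runit_nat compA g'K comp1m.
Qed.

(** The structure on B that makes the isomorphism g an algebra isomorphism. *)
Definition transport : alg_struct B := AlgStruct tr_mulA tr_mul1m tr_mulm1.

Lemma transport_hom : @alg_hom k C A (Algebra transport) g.
Proof.
split=> //; rewrite /amul /= -/(amul A) /tr_mul.
by rewrite -[RHS]compA -tensm_comp gK tensm1 compm1.
Qed.

Lemma transport_homV : @alg_hom k C (Algebra transport) A g'.
Proof.
split; rewrite /amul /aunit /= -/(amul A) -/(aunit A) /tr_mul /tr_unit !compA gK comp1m //.
Qed.

Lemma transport_iso : @alg_iso k C A (Algebra transport) g.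
Proof.
by split; [exact: transport_hom|exists g'; split=> //; exact: transport_homV].
Qed.
End Transport.

Section AlgIso.
Variables (k : fieldType) (C : moncat k).
Implicit Types A B D : algebra C.

Lemma alg_hom_id A : @alg_hom k C A A (idm A).
Proof. by split; rewrite ?tensm1 ?comp1m ?compm1. Qed.
Lemma alg_hom_comp A B D (g : hom B D) (f : hom A B) :
  alg_hom g -> alg_hom f -> alg_hom (g ∘ f).
Proof.
move=> [g1 g2] [f1 f2]; split; last by rewrite -compA f2 g2.
by rewrite -compA f1 compA g1 -compA -tensm_comp.
Qed.
Lemma alg_iso_id A : @alg_iso k C A A (idm A).
Proof.
split; first exact: alg_hom_id.
by exists (idm A); split; rewrite ?comp1m //; apply: alg_hom_id.
Qed.
Lemma alg_iso_comp A B D (g : hom B D) (f : hom A B) :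
  alg_iso g -> alg_iso f -> alg_iso (g ∘ f).
Proof.
move=> [hg [g' [hg' gK g'K]]] [hf [f' [hf' fK f'K]]].
split; first exact: alg_hom_comp.
exists (f' ∘ g'); split; first exact: alg_hom_comp.
- by rewrite compA -(compA f') gK compm1 fK.
- by rewrite compA -(compA g) f'K compm1 g'K.
Qed.
Lemma alg_iso_inv A B (f : hom A B) : alg_iso f ->
  exists f', [/\ alg_iso f', f' ∘ f = idm A & f ∘ f' = idm B].
Proof. by move=> [hf [f' [hf' fK f'K]]]; exists f'; split=> //; split=> //; exists f. Qed.

Lemma separable_iso A B (f : hom A B) : alg_iso f -> separable_alg A -> separable_alg B.
Proof.
move=> [[fm fe] [f' [[f'm f'e] fK f'K]]] [s [s1 s2 s3]].
exists ((f ⊠ f) ∘ s ∘ f'); split.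
- by rewrite !compA -fm -(compA f) s1 compm1 f'K.
- rewrite -compA f'm !compA -(compA (f ⊠ f)) s2 /outer_left !compA.
  have E : (f ⊠ f) ∘ (amul A ⊠ idm A) = (amul B ⊠ idm B) ∘ (f ⊠ f ⊠ f).
    by rewrite -!tensm_comp fm compm1 comp1m.
  rewrite E -(comp_swap _ (assocV_nat _ _ _)) -!compA -!tensm_comp; congr (_ ∘ (_ ∘ _)).
  by rewrite ?comp1m f'K !compA.
rewrite -compA f'm !compA -(compA (f ⊠ f)) s3 /outer_right !compA.
have E : (f ⊠ f) ∘ (idm A ⊠ amul A) = (idm B ⊠ amul B) ∘ (f ⊠ (f ⊠ f)).
  by rewrite -!tensm_comp fm compm1 comp1m.
rewrite E -(comp_swap _ (assoc_nat _ _ _)) -!compA -!tensm_comp; congr (_ ∘ (_ ∘ _)).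
by rewrite ?comp1m f'K !compA.
Qed.
End AlgIso.

(** * Vanishing cohomology of a separable algebra *)

Section Cohomology.
Variables (k : fieldType) (C : moncat k) (A : algebra C).
Local Notation m := (amul A).
Local Notation e := (aunit A).
Hypothesis sepA : separable_alg A.

(** H^2(A, A) = 0. Writing the section as s(a) = a_1 (x) a_2, put
T(a, b) = a_1 mu(a_2, b) and psi(b) = T(1, b). Left linearity of s gives
T(a, b) = a psi(b). Applying the cocycle identity to (c_2, a, b), multiplying by
c_1 and using that s is a right linear section gives
T(c a, b) + T(c, a) b = T(c, a b) + c mu(a, b); now take c = 1. *)
Lemma cocycle2_trivial (mu : hom (A ⊗ A) A) :
  mu ∘ (m ⊠ idm A) + m ∘ (mu ⊠ idm A) =
    mu ∘ (idm A ⊠ m) ∘ assoc A A A + m ∘ (idm A ⊠ mu) ∘ assoc A A A ->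
  exists psi : hom A A, mu = m ∘ (idm A ⊠ psi) + m ∘ (psi ⊠ idm A) - psi ∘ m.
Proof.
move=> Z; have [s [s1 s2 s3]] := sepA.
have [T TD] : exists T : hom (A ⊗ A) A,
    T = m ∘ (idm A ⊠ mu) ∘ assoc A A A ∘ (s ⊠ idm A) by eexists.
have [psi psiD] : exists psi, psi = T ∘ (e ⊠ idm A) ∘ lunitV A by eexists.
have X1 D D' (f : hom D D') (g : hom (A ⊗ A) A) :
    (idm A ⊠ f) ∘ (g ⊠ idm D) = (g ⊠ idm D') ∘ (idm (A ⊗ A) ⊠ f).
  by rewrite -tens_lr -tens_rl.
have X2 D D' (f : hom D D') :
    assoc A A D' ∘ (idm (A ⊗ A) ⊠ f) = (idm A ⊠ (idm A ⊠ f)) ∘ assoc A A D.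
  by rewrite -tensm1 assoc_nat.
have TL : T ∘ (m ⊠ idm A) = m ∘ (idm A ⊠ T) ∘ assoc A A A.
  rewrite TD -(compA _ (s ⊠ _)) -whiskr s2 /outer_left !whiskr !compA.
  rewrite (comp_swap _ (assoc_nat m (idm A) (idm A))) tensm1 (comp_swap _ (X1 _ _ mu m)) amulA.
  rewrite (comp_swap _ (X2 _ _ mu)) (comp_swap _ (pentagon _ _ _ _)) !compA.
  have X3 : (assoc A A A ⊠ idm A) ∘ (assocV A A A ⊠ idm A) = idm _.
    by rewrite -whiskr assocVK tensm1.
  by rewrite (comp_merge _ X3) compm1 (comp_swap _ (assoc_nat _ _ _)) !whiskl !compA.
have TE : T = m ∘ (idm A ⊠ psi).
  apply: (@cancel_r _ _ _ _ _ (idm A ⊠ lunit A) (idm A ⊠ lunitV A)).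
    by rewrite -whiskl lunitVK tensm1.
  apply: (@cancel_r _ _ _ _ _ (assoc A one A) (assocV A one A)); first exact: assocVK.
  rewrite -[LHS]compA triangle -amulm1 whiskr compA TL.
  rewrite (comp_swap _ (assoc_nat _ _ _)) -!compA; congr (_ ∘ _).
  rewrite !compA -!whiskl; congr (_ ⊠ _ ∘ _).
  by rewrite psiD -!compA lunitK compm1.
(* kap sends c (x) a (x) b to c_1 (x) (c_2 (x) a (x) b). *)
have [kap kapD] : exists kap, kap =
    assoc A (A ⊗ A) A ∘ (assoc A A A ⊠ idm A) ∘ (s ⊠ idm A ⊠ idm A) by eexists.
have H1 : m ∘ (idm A ⊠ (mu ∘ (m ⊠ idm A))) ∘ kap = T ∘ (m ⊠ idm A).
  rewrite kapD TD whiskl !compA (comp_swap _ (esym (assoc_nat _ _ _))).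
  rewrite -!(compA (_ ∘ assoc A A A)) -!whiskr; congr (_ ∘ (_ ⊠ _)).
  by rewrite s3 /outer_right.
have H2 : m ∘ (idm A ⊠ (m ∘ (mu ⊠ idm A))) ∘ kap = m ∘ (T ⊠ idm A).
  rewrite kapD TD whiskl !compA (comp_swap _ (esym (assoc_nat _ _ _))) -amulA.
  by rewrite !whiskr !compA.
have kapE : (idm A ⊠ assoc A A A) ∘ kap = assoc A A (A ⊗ A) ∘ (s ⊠ idm (A ⊗ A)) ∘ assoc A A A.
  rewrite kapD !compA -pentagon -!compA; congr (_ ∘ _).
  by rewrite assoc_nat tensm1.
have slide D (f : hom (A ⊗ A) D) : (idm (A ⊗ A) ⊠ f) ∘ (s ⊠ idm (A ⊗ A)) =
    (s ⊠ idm D) ∘ (idm A ⊠ f) by rewrite -tens_lr -tens_rl.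
have H3 : m ∘ (idm A ⊠ (mu ∘ (idm A ⊠ m) ∘ assoc A A A)) ∘ kap
     = T ∘ (idm A ⊠ m) ∘ assoc A A A.
  rewrite TD !whiskl !compA -(compA _ (idm A ⊠ assoc A A A)) kapE !compA.
  rewrite -(compA _ (idm A ⊠ (idm A ⊠ m))) -X2 !compA.
  by rewrite (comp_swap _ (slide _ m)).
have H4 : m ∘ (idm A ⊠ (m ∘ (idm A ⊠ mu) ∘ assoc A A A)) ∘ kap
     = m ∘ (idm A ⊠ mu) ∘ assoc A A A.
  rewrite !whiskl !compA -(compA _ (idm A ⊠ assoc A A A)) kapE !compA.
  rewrite -(comp_swap _ (X2 _ _ mu)) -amulA (comp_swap _ (slide _ mu)).
  by rewrite -(compA _ (m ⊠ idm A)) -whiskr s1 tensm1 compm1.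
have H : T ∘ (m ⊠ idm A) + m ∘ (T ⊠ idm A)
       = T ∘ (idm A ⊠ m) ∘ assoc A A A + m ∘ (idm A ⊠ mu) ∘ assoc A A A.
  rewrite -H1 -H2 -H3 -H4 -!compDl -!compDr -!tensDr; congr (_ ∘ _).
  by rewrite Z.
exists psi.
have := congr1 (fun f => f ∘ (e ⊠ idm A ⊠ idm A) ∘ (lunitV A ⊠ idm A)) H.
rewrite !compDl.
have -> : T ∘ (m ⊠ idm A) ∘ (e ⊠ idm A ⊠ idm A) ∘ (lunitV A ⊠ idm A) = T.
  by rewrite -!compA -!whiskr compA amul1m lunitVK tensm1 compm1.
have -> : m ∘ (T ⊠ idm A) ∘ (e ⊠ idm A ⊠ idm A) ∘ (lunitV A ⊠ idm A) = m ∘ (psi ⊠ idm A).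
  by rewrite psiD !whiskr !compA.
have unitE D (f : hom A D) : (idm A ⊠ f) ∘ (e ⊠ idm A) = (e ⊠ idm D) ∘ (idm one ⊠ f).
  by rewrite -tens_lr -tens_rl.
have red (f : hom (A ⊗ A) A) : (idm A ⊠ f) ∘ assoc A A A ∘ (e ⊠ idm A ⊠ idm A)
    ∘ (lunitV A ⊠ idm A) = (e ⊠ idm A) ∘ lunitV A ∘ f.
  rewrite (comp_swap _ (assoc_nat _ _ _)) (comp_merge _ (lunitV_assoc _ _)) tensm1.
  rewrite (comp_swap _ (esym (lunitV_nat f))); congr (_ ∘ _); by rewrite -tens_lr -tens_rl.
have -> : T ∘ (idm A ⊠ m) ∘ assoc A A A ∘ (e ⊠ idm A ⊠ idm A) ∘ (lunitV A ⊠ idm A)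
    = psi ∘ m.
  by rewrite -!(compA T) red psiD !compA.
have -> : m ∘ (idm A ⊠ mu) ∘ assoc A A A ∘ (e ⊠ idm A ⊠ idm A) ∘ (lunitV A ⊠ idm A) = mu.
  by rewrite -!(compA m) red !compA amul1m lunitVK comp1m.
by rewrite TE => ->; rewrite addrC addKr.
Qed.

(** H^1(A, X) = 0 for the bimodule structure on X given by i. With
s(a) = a_1 (x) a_2, the map K(a) = D(a_1) i(a_2) satisfies K(c a) = K(c) i(a) and
K(a c) = i(a) K(c) + D(a) i(c); take c = 1 and x = K(1). *)
Lemma derivation_inner (X : algebra C) (i D : hom A X) :
  alg_hom i -> D ∘ m = amul X ∘ (i ⊠ D) + amul X ∘ (D ⊠ i) ->
  exists x, D = lmul x ∘ i - rmul x ∘ i.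
Proof.
move=> [im ie] HD; have [s [s1 s2 s3]] := sepA.
have [K KD] : exists K, K = amul X ∘ (D ⊠ i) ∘ s by eexists.
have KR : K ∘ m = amul X ∘ (K ⊠ i).
  rewrite KD -compA s3 /outer_right !compA -(compA (amul X)) -tensm_comp compm1 im.
  rewrite -[D ⊠ _]/(D ⊠ (amul X ∘ (i ⊠ i))) -[D in D ⊠ _](comp1m D) tensm_comp !compA.
  rewrite -(comp_swap _ (assoc_nat _ _ _)) -amulA -!compA; congr (_ ∘ _).
  by rewrite -!tensm_comp !comp1m compm1 !compA.
have KL : K ∘ m = amul X ∘ (i ⊠ K) + amul X ∘ (D ⊠ i).
  rewrite {1}KD -compA s2 /outer_left !compA -(compA (amul X)) -tensm_comp compm1 HD.
  rewrite tensDl compDr !compDl.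
  have half (a b : hom A X) : amul X ∘ ((amul X ∘ (a ⊠ b)) ⊠ i) ∘ assocV A A A ∘ (idm A ⊠ s)
     = amul X ∘ (a ⊠ (amul X ∘ (b ⊠ i) ∘ s)).
    rewrite -{1}[i]comp1m tensm_comp compA amulA -!compA (compA (a ⊠ b ⊠ i)) -assocV_nat.
    rewrite !compA (comp_merge _ (assocVK _ _ _)) compm1.
    by rewrite -!compA -!tensm_comp !comp1m compm1.
  by rewrite !half -KD -im -(compA i) s1 compm1.
have [x xD] : exists x, x = K ∘ e by eexists.
exists x.
have KL' : K = lmul x ∘ i.
  have := congr1 (fun f => f ∘ (e ⊠ idm A) ∘ lunitV A) KR.
  rewrite -(compA K) amul1m -(compA K) lunitVK compm1 => ->.
  by rewrite -(compA (amul X)) -tensm_comp compm1 -xD /lmul -!compA -lunitV_nat (compA (x ⊠ _)) -tens_lr.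
have KR' : K = rmul x ∘ i + D.
  have := congr1 (fun f => f ∘ (idm A ⊠ e) ∘ runitV A) KL.
  rewrite -(compA K) amulm1 -(compA K) runitVK compm1 => ->.
  rewrite !compDl; congr (_ + _).
    by rewrite -(compA (amul X)) -tensm_comp compm1 -xD /rmul -!compA -runitV_nat (compA (_ ⊠ x)) -tens_rl.
  rewrite -(compA (amul X)) -tensm_comp compm1 ie tens_rl compA amulm1 -compA.
  by rewrite runitV_nat compA runitVK comp1m.
by rewrite -KL' {1}KR' addrC addKr.
Qed.
End Cohomology.

(** * Adjugates in finite-dimensional algebras *)

Section Adjugate.
Variables (k : closedFieldType) (E : vectType k) (mul : E -> E -> E) (one : E).
Hypothesis mulB : bilin mul.
Hypothesis mulA : associative mul.
Hypothesis mul1 : left_id one mul.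
Hypothesis mulr1 : right_id one mul.

(** The matrix of right multiplication by g. *)
Definition rmx (g : E) : 'M[k]_(dim E) := \matrix_(i, j) crd (mul (cbas i) g) j.
Definition adet (g : E) : k := \det (rmx g).
(** The polynomial map that equals det(g) g^-1 on invertible elements. *)
Definition aadj (g : E) : E := of_crd (fun j => ((\row_i crd one i) *m \adj (rmx g)) 0 j).

Let crd_mul g h : \row_j crd (mul h g) j = (\row_j crd h j) *m rmx g.
Proof.
apply/rowP => j; rewrite !mxE (lin_crd h (mulB.1 g)) (functional_sum (@crd_functional k E j)).
by apply: eq_bigr => i _; rewrite (functionalZ (@crd_functional k E j)) !mxE.
Qed.

Lemma rmx_poly i j : epoly (fun g => rmx g i j).
Proof.
apply: (@eq_epoly _ _ (fun g => crd (mul (cbas i) g) j)); first by move=> g; rewrite mxE.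
by apply: epoly_functional; apply: (functional_linear (mulB.2 _) (@crd_functional k E j)).
Qed.

Lemma adet_poly : epoly adet.
Proof. by apply: epoly_det => i j; apply: rmx_poly. Qed.

Lemma aadj_poly : vpoly aadj.
Proof.
move=> phi Hphi; apply: (@eq_epoly _ _ (fun g => \sum_j ((\row_i crd one i) *m \adj (rmx g)) 0 j * phi (cbas j))).
  by move=> g /=; rewrite /aadj /of_crd (functional_sum Hphi); apply: eq_bigr => j _; rewrite (functionalZ Hphi).
apply: epoly_sum => j; apply: epolyM; last exact: epoly_const.
apply: (@eq_epoly _ _ (fun g => \sum_i crd one i * \adj (rmx g) i j)).
  by move=> g; rewrite mxE; apply: eq_bigr => i _; rewrite !mxE.
apply: epoly_sum => i; apply: epolyM; first exact: epoly_const.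
apply: (@eq_epoly _ _ (fun g => cofactor (rmx g) j i)); first by move=> g; rewrite mxE.
apply: epolyM; first exact: epoly_const.
apply: epoly_det => a b; apply: (@eq_epoly _ _ (fun g => rmx g (lift j a) (lift i b))).
  by move=> g; rewrite !mxE.
exact: rmx_poly.
Qed.

Lemma aadj_mul g : mul (aadj g) g = adet g *: one.
Proof.
apply: eq_crd => j.
have := congr1 (fun M : 'rV_ _ => M 0 j) (crd_mul g (aadj g)); rewrite mxE => ->.
have -> : \row_j crd (aadj g) j = (\row_i crd one i) *m \adj (rmx g).
  by apply/rowP => i; rewrite mxE /aadj crd_of_crd.
rewrite -mulmxA mul_adj_mx mul_mx_scalar !mxE -(functionalZ (@crd_functional k E j)) //.
Qed.

(** Right multiplication by g is injective, so the left inverse is two-sided. *)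
Lemma mul_aadj g : adet g != 0 -> mul g (aadj g) = adet g *: one.
Proof.
move=> dg.
have inj h h' : mul h g = mul h' g -> h = h'.
  move=> H; have : (\row_j crd h j) *m rmx g = (\row_j crd h' j) *m rmx g.
    by rewrite -!crd_mul H.
  have ug : rmx g \in unitmx by rewrite unitmxE unitfE.
  move/(congr1 (fun M => M *m invmx (rmx g))); rewrite !mulmxK // => /rowP E'.
  by apply: eq_crd => j; have := E' j; rewrite !mxE.
apply: inj; rewrite -mulA aadj_mul (linZ (mulB.2 g)) mulr1.
by rewrite (linZ (mulB.1 g)) mul1.
Qed.

Lemma adet1 : adet one = 1.
Proof.
rewrite /adet (_ : rmx one = 1%:M) ?det1 //; apply/matrixP => i j.
by rewrite !mxE mulr1 /crd /cbas VectorInternalTheory.r2vK mxE eqxx eq_sym.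
Qed.

Lemma aadj1 : aadj one = one.
Proof. by rewrite -[aadj one]mulr1 aadj_mul adet1 scale1r. Qed.

(** To first order adj(1 + t z) = det(1 + t z) (1 - t z), because
(1 + t z) (1 - t z) = 1 - t^2 z^2. *)
Lemma adj_jets z : exists d1,
  sjet (fun t => adet (one + t *: z)) 1 d1 /\
  vjet (fun t => aadj (one + t *: z)) one (d1 *: one - z).
Proof.
have [d1 Hd] := sjet_epoly one z adet_poly; rewrite adet1 in Hd.
exists d1; split=> //.
have lin2 : linear (fun a => mul a (mul z z)) := mulB.1 _.
have jsq := vjet_sq one z (vpoly_lin lin2 aadj_poly).
apply: eq_vjet (vjetD (vjetZ Hd (vjet_affine one (- z))) jsq) _ _ _ => [t||].
- set g := one + t *: z.
  have gz : mul g (one - t *: z) = one - (t * t) *: mul z z.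
    rewrite (linB (mulB.2 g)) mulr1 (linZ (mulB.2 g)) /g (linD (mulB.1 z)) mul1 (linZ (mulB.1 z)).
    by rewrite scalerDr opprD !addrA addrK scalerA.
  have : mul (mul (aadj g) g) (one - t *: z) = mul (aadj g) (mul g (one - t *: z)).
    by rewrite mulA.
  rewrite aadj_mul gz (linZ (mulB.1 _)) mul1 (linB (mulB.2 _)) mulr1 (linZ (mulB.2 _)).
  by rewrite scalerN => /eqP; rewrite eq_sym subr_eq => /eqP <-.
- by rewrite scale1r addr0.
- by rewrite addr0 scale1r addrC.
Qed.
End Adjugate.

(** * Separable structures on a fixed object *)

Section Dims.
Variable k : closedFieldType.
Lemma linear_inj_dim (V W : vectType k) (L : V -> W) : linear L -> injective L ->
  (dim V <= dim W)%N.
Proof.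
move=> HL inj.
pose M : 'M[k]_(dim V, dim W) := \matrix_(i, j) crd (L (cbas i)) j.
suff : row_free M by rewrite -row_leq_rank => /leq_trans; apply; apply: rank_leq_col.
apply: inj_row_free => v vM.
have L0 : L (of_crd (fun i => v 0 i)) = 0.
  apply: eq_crd => j; have := congr1 (fun A : 'rV_ _ => A 0 j) vM.
  rewrite !mxE (functional0 (@crd_functional k W j)) => E; rewrite -[RHS]E.
  rewrite (lin_crd _ HL) (functional_sum (@crd_functional k W j)); apply: eq_bigr => i _.
  by rewrite (functionalZ (@crd_functional k W j)) mxE crd_of_crd.
have V0 : of_crd (fun i => v 0 i) = 0 by apply: inj; rewrite L0 (lin0 HL).
apply/rowP => i; rewrite -(crd_of_crd (fun i => v 0 i)) V0 mxE.
exact: functional0 (@crd_functional k V i).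
Qed.

Lemma homdimE (C : lincat k) (A B : C) : homdim A B = dim (hom A B).
Proof. exact: dimvf. Qed.

Lemma homdim_isol (C : lincat k) (A A' B : C) (f : hom A A') (g : hom A' A) :
  compose g f = idm A -> compose f g = idm A' -> homdim A B = homdim A' B.
Proof.
move=> gf fg; rewrite !homdimE; apply/eqP; rewrite eqn_leq.
rewrite (linear_inj_dim (@comp_linl k C _ _ B g)) ?(linear_inj_dim (@comp_linl k C _ _ B f)) //.
  by move=> u v /= E; rewrite -(compm1 u) -fg compA E -compA fg compm1.
by move=> u v /= E; rewrite -(compm1 u) -gf compA E -compA gf compm1.
Qed.

End Dims.

Lemma bilin_comp (k : fieldType) (C : lincat k) (A B D : C) :
  bilin (fun (g : hom B D) (f : hom A B) => g ∘ f).
Proof. by split=> [f|g]; [apply: comp_linl|apply: comp_linr]. Qed.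
Lemma bilin_tens (k : fieldType) (C : moncat k) (A A' B B' : C) :
  bilin (fun (f : hom A A') (g : hom B B') => f ⊠ g).
Proof. by split=> [f|g]; [apply: tensm_linl|apply: tensm_linr]. Qed.

Lemma alg_iso_eq (k : fieldType) (C : moncat k) (B : C) (s s' : alg_struct B) :
  smul s = smul s' -> sunit s = sunit s' ->
  @alg_iso k C (Algebra s) (Algebra s') (idm B).
Proof.
move=> em eu.
have H (t t' : alg_struct B) : smul t = smul t' -> sunit t = sunit t' ->
    @alg_hom k C (Algebra t) (Algebra t') (idm B).
  by move=> E1 E2; split; rewrite /amul /aunit /= ?tensm1 ?comp1m ?compm1.
split; first exact: H.
by exists (idm B); split; rewrite ?comp1m //; apply: H.
Qed.

Lemma cocycle_shuffle (V : zmodType) (a b c d : V) : a - b + (c - d) = 0 -> c + a = d + b.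
Proof. by move=> E; apply/eqP; rewrite -subr_eq0 -E opprD addrACA addrC. Qed.

Lemma addr3_cancel (V : zmodType) (a b c : V) : a + b + c - a - b - c = 0.
Proof. by rewrite -(addrA a b c) (addrC a) addrK (addrC b) addrK subrr. Qed.

Lemma derivation_shuffle (V : zmodType) (w p q r s : V) :
  w - p - q - (r - p) - (s - q) = 0 -> w = r + s.
Proof.
have -> : w - p - q - (r - p) - (s - q) = w - r - s.
  by rewrite !opprB (addrAC w (- p)) subrKA (addrAC w) subrKA.
by move=> E; apply/eqP; rewrite -subr_eq0 opprD addrA E.
Qed.

Section Structures.
Variables (k : closedFieldType) (C : moncat k) (B : C).

Let V : vectType k := (hom (B ⊗ B) B * hom one B)%type.
Let T : vectType k := (hom (B ⊗ B ⊗ B) B * hom (one ⊗ B) B * hom (B ⊗ one) B)%type.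

Definition alg_eqn_const : T := (0, - lunit B, - runit B).
(** The quadratic parts of associativity and of the two unit laws; the unit laws
have the constant parts [alg_eqn_const]. *)
Definition alg_eqn_quad (u v : V) : T :=
  (u.1 ∘ (v.1 ⊠ idm B) - u.1 ∘ (idm B ⊠ v.1) ∘ assoc B B B,
   u.1 ∘ (v.2 ⊠ idm B), u.1 ∘ (idm B ⊠ v.2)).

Lemma alg_eqn_quad_bilin : bilin alg_eqn_quad.
Proof.
split=> [v a u u'|u a v v']; rewrite /alg_eqn_quad /=.
  apply: injective_projections; rewrite /=; last first.
    by rewrite compDl compZl.
  apply: injective_projections; rewrite /=; last first.
    by rewrite compDl compZl.
  by rewrite !(compDl, compZl) scalerBr opprD addrACA.
apply: injective_projections; rewrite /=; last first.
  by rewrite tensDr tensZr compDr compZr.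
apply: injective_projections; rewrite /=; last first.
  by rewrite tensDl tensZl compDr compZr.
rewrite !(tensDr, tensZr, tensDl, tensZl) !(compDl, compZl, compDr, compZr).
by rewrite scalerBr opprD addrACA.
Qed.

Let det := adet (@compose k C B B B).
Let adj := aadj (@compose k C B B B) (idm B).
Let cB := @bilin_comp k C B B B.

(** The structure transported along g is g m (g^-1 (x) g^-1), g e. Writing
g^-1 = adj(g) / det(g) makes it a quotient with denominator det(g)^2. *)
Definition str_den (g : hom B B) : k := det g * det g.
Definition str_num (s : alg_struct B) (g : hom B B) : V :=
  ((g ∘ smul s) ∘ (adj g ⊠ adj g), str_den g *: (g ∘ sunit s)).

Lemma str_den_poly : epoly str_den.
Proof. by apply: epolyM; apply: adet_poly. Qed.

Lemma str_num_poly s : vpoly (str_num s).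
Proof.
apply: vpoly_pair.
  apply: (vpoly_bilin (@bilin_comp k C _ _ _)).
    exact: (vpoly_lin (@comp_linl k C _ _ _ _) (@vpoly_id k _)).
  by apply: (vpoly_bilin (@bilin_tens k C _ _ _ _)); apply: aadj_poly.
apply: vpolyZ; first exact: str_den_poly.
exact: (vpoly_lin (@comp_linl k C _ _ _ _) (@vpoly_id k _)).
Qed.

Lemma adj_inv g : det g != 0 ->
  (det g)^-1 *: adj g ∘ g = idm B /\ g ∘ ((det g)^-1 *: adj g) = idm B.
Proof.
move=> dg; rewrite compZl compZr.
rewrite [adj g ∘ g](@aadj_mul _ _ _ (idm B) cB).
rewrite [g ∘ adj g](@mul_aadj _ _ _ (idm B) cB _ _ _ _ dg); last first.
- by move=> f; rewrite compm1.
- by move=> f; rewrite comp1m.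
- by move=> f1 f2 f3; rewrite compA.
by rewrite !scalerA mulVf // !scale1r.
Qed.

Lemma str_frac s g (dg : det g != 0) :
  (str_den g)^-1 *: str_num s g =
  (@tr_mul k C (Algebra s) B g ((det g)^-1 *: adj g), @tr_unit k C (Algebra s) B g).
Proof.
rewrite /str_num /tr_mul /tr_unit /str_den; apply: injective_projections => /=.
  by rewrite tensZl tensZr scalerA compZr invfM.
by rewrite scalerA mulVf ?scale1r // mulf_neq0.
Qed.

(** The orbit of a structure under invertible g is a family with denominator
[str_den]. A tangent vector (mu, ep) at a separable structure is a Hochschild
2-cocycle mu together with the variation ep of the unit; [cocycle2_trivial]
exhibits it as the velocity in the direction - psi. Two orbits that meet give
isomorphic algebras. *)
Lemma structures_bound r (s : 'I_r -> alg_struct B) :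
  (forall i, separable_alg (Algebra (s i))) ->
  (forall i j, i != j -> ~ exists h, @alg_iso k C (Algebra (s i)) (Algebra (s j)) h) ->
  (r <= 2 ^ minn (homdim (B ⊗ B) B + homdim one B)
                 (homdim (B ⊗ B ⊗ B) B + 2 * homdim B B))%N.
Proof.
move=> sep noniso.
have -> : (homdim (B ⊗ B) B + homdim one B = dim V)%N by rewrite !homdimE.
have -> : (homdim (B ⊗ B ⊗ B) B + 2 * homdim B B = dim T)%N.
  rewrite mul2n -addnn -{1}(homdim_isol B (lunitK B) (lunitVK B)).
  by rewrite -(homdim_isol B (runitK B) (runitVK B)) addnA !homdimE.
have den1 : str_den (idm B) = 1.
  by rewrite /str_den /det adet1 ?mulr1 // => f; rewrite compm1.
have adj1 : adj (idm B) = idm B.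
  by rewrite /adj aadj1 // => f; rewrite ?comp1m ?compm1.
apply: (@quadratic_families_bound k V T alg_eqn_const (fun=> 0) alg_eqn_quad _ alg_eqn_quad_bilin r
  (fun=> hom B B) (fun=> str_den) (fun i => str_num (s i)) (fun=> idm B)
  (fun i => (smul (s i), sunit (s i)))).
- by move=> a u v; rewrite scaler0 addr0.
- by move=> i; apply: str_den_poly.
- by move=> i; apply: str_num_poly.
- by move=> i; rewrite den1 oner_eq0.
- move=> i; rewrite /str_num adj1 den1 tensm1 !comp1m compm1 !scale1r //.
- move=> i g Dg; have dg : det g != 0 by move: Dg; rewrite mulf_eq0 => /norP[].
  have [gK g'K] := adj_inv dg.
  rewrite str_frac //= addr0 /alg_eqn_const /alg_eqn_quad /=.
  rewrite (@tr_mulA k C (Algebra (s i)) _ _ _ gK) subrr.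
  rewrite (@tr_mul1m k C (Algebra (s i)) _ _ _ gK g'K) (@tr_mulm1 k C (Algebra (s i)) _ _ _ gK g'K).
  by apply: injective_projections; rewrite /= ?addNr //;
     apply: injective_projections; rewrite /= ?addNr ?addr0.
- move=> i [mu ep]; rewrite add0r /alg_eqn_quad /= => /pair_equal_spec[/pair_equal_spec[/= E1 E2] _].
  set A := Algebra (s i).
  have [psi psiE] : exists psi : hom B B, mu = smul (s i) ∘ (idm B ⊠ psi)
      + smul (s i) ∘ (psi ⊠ idm B) - psi ∘ smul (s i).
    apply: (@cocycle2_trivial k C A (sep i) mu).
    exact: cocycle_shuffle E1.
  (* The unit is determined by the product, hence so is its variation. *)
  have epE : ep = - (psi ∘ aunit A).
    have Ee : ep = - (mu ∘ (aunit A ⊠ aunit A) ∘ lunitV one).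
      have := congr1 (fun f => f ∘ (idm one ⊠ aunit A) ∘ lunitV one) E2.
      rewrite !compDl !comp0m -!(compA _ (_ ⊠ _) (_ ⊠ _)) -!tens_lr.
      by rewrite -[_ ∘ _ ∘ _]/(@star k C A ep (aunit A)) stare1 => /eqP; rewrite addr_eq0 => /eqP.
    rewrite Ee psiE !compDl !compNl -!(compA _ (_ ⊠ _) (_ ⊠ _)) -!tensm_comp !comp1m.
    rewrite -[amul A ∘ (aunit A ⊠ _) ∘ _]/(@star k C A (aunit A) (psi ∘ aunit A)) star1e.
    rewrite -[amul A ∘ (_ ⊠ aunit A) ∘ _]/(@star k C A (psi ∘ aunit A) (aunit A)) stare1.
    rewrite -!(compA psi) -[amul A ∘ _ ∘ _]/(@star k C A (aunit A) (aunit A)) stare1.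
    by rewrite addrK.
  have [d1 [jd ja]] := @adj_jets k _ _ (idm B) cB (fun _ _ _ => compA _ _ _)
     (fun f => comp1m f) (fun f => compm1 f) (- psi).
  (* Conjugating m by 1 - t psi changes it by t (m (1 (x) psi) + m (psi (x) 1) - psi m),
  up to order 2, which is t mu. *)
  exists (- psi), (1 * d1 + d1 * 1); split.
    by rewrite den1; have := sjetM jd jd; rewrite mulr1.
  have jm := vjet_lin (@comp_linl k C _ _ _ (smul (s i))) (vjet_affine (idm B) (- psi)).
  have je := vjet_lin (@comp_linl k C _ _ _ (sunit (s i))) (vjet_affine (idm B) (- psi)).
  have jt := vjet_bilin (@bilin_tens k C _ _ _ _) ja ja.
  have j1 := vjet_bilin (@bilin_comp k C _ _ _) jm jt.
  have j2 := vjetZ (sjetM jd jd) je.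
  apply: eq_vjet (vjet_pair j1 j2) _ _ _ => //.
    by rewrite /str_num adj1 den1 !comp1m !mulr1.
  rewrite den1 scale1r; apply: injective_projections; rewrite /=.
    rewrite tensm1 !comp1m compm1 !(tensDl, tensDr, tensZl, tensZr) tensm1.
    rewrite !opprK mul1r mulr1 scalerDl !(compDr, compZr) compm1 compNl psiE.
    by rewrite addrACA [_ + (_ ∘ _ + _)]addrC addrAC.
  by rewrite !mul1r !mulr1 scale1r comp1m compNl epE.
move=> i j ij g g' Dg Dg'.
have dg : det g != 0 by move: Dg; rewrite mulf_eq0 => /norP[].
have dg' : det g' != 0 by move: Dg'; rewrite mulf_eq0 => /norP[].
rewrite !str_frac // => /pair_equal_spec[Em Eu].
have [gK gK'] := adj_inv dg; have [g'K g'K'] := adj_inv dg'.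
have iso1 := @transport_iso k C (Algebra (s i)) B g _ gK gK'.
have iso2 := @transport_iso k C (Algebra (s j)) B g' _ g'K g'K'.
have [h [iso2' _ _]] := alg_iso_inv iso2.
apply: (noniso i j ij).
exists (h ∘ (idm B ∘ g)); apply: (alg_iso_comp iso2').
by apply: (alg_iso_comp _ iso1); apply: alg_iso_eq.
Qed.
End Structures.

(** * Algebra maps out of a separable algebra *)

Section Homs.
Variables (k : closedFieldType) (C : moncat k) (A X : algebra C).
Hypothesis sepA : separable_alg A.

Let G : vectType k := hom one X.

Lemma bilin_star : bilin (@star k C X : G -> G -> G).
Proof.
split=> [v a u u'|u a v v']; rewrite /star.
  by rewrite tensDl tensZl compDr compZr compDl compZl.
by rewrite tensDr tensZr compDr compZr compDl compZl.
Qed.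

Lemma lmul_linear : linear (@lmul k C X : G -> hom X X).
Proof. by move=> a u v; rewrite /lmul tensDl tensZl compDr compZr compDl compZl. Qed.
Lemma rmul_linear : linear (@rmul k C X : G -> hom X X).
Proof. by move=> a u v; rewrite /rmul tensDr tensZr compDr compZr compDl compZl. Qed.

Let det := adet (@star k C X : G -> G -> G).
Let adj := aadj (@star k C X : G -> G -> G) (aunit X).
Let starB := bilin_star.
Let sA : associative (@star k C X : G -> G -> G) := fun u v w => starA u v w.
Let s1 : left_id (aunit X : G) (@star k C X : G -> G -> G) := fun u => star1e u.
Let sr1 : right_id (aunit X : G) (@star k C X : G -> G -> G) := fun u => stare1 u.

Definition conj_num (i : hom A X) (u : G) : hom A X := rmul (adj u) ∘ lmul u ∘ i.

Lemma conj_num_poly i : vpoly (conj_num i).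
Proof.
apply: (vpoly_lin (@comp_linl k C _ _ _ i)).
apply: (vpoly_bilin (@bilin_comp k C _ _ _)).
  by apply: (vpoly_lin rmul_linear); apply: aadj_poly.
exact: (vpoly_lin lmul_linear (@vpoly_id k _)).
Qed.

Lemma adj_star_inverse u : det u != 0 -> star_inverse u ((det u)^-1 *: adj u).
Proof.
move=> du; split.
  by rewrite (linZ (starB.2 u)) (mul_aadj starB sA s1 sr1 du) scalerA mulVf // scale1r.
by rewrite (linZ (starB.1 u)) (aadj_mul (aunit X) starB) scalerA mulVf // scale1r.
Qed.

Lemma conj_num_frac i u : det u != 0 ->
  (det u)^-1 *: conj_num i u = conj_by u ((det u)^-1 *: adj u) ∘ i.
Proof. by move=> du; rewrite /conj_num conj_byE (linZ rmul_linear) !compZl. Qed.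

(** The unknown is the difference w of an algebra map with a fixed one. It
satisfies the linear condition w e = 0, which lowers the dimension by one unless
X = 0. The orbits of conjugation by invertible elements of Gamma(X) are families
with denominator det; a tangent vector is a derivation, hence inner by
[derivation_inner], and is the velocity of conjugation by 1 + t x. *)
Lemma homs_bound r (i : 'I_r -> hom A X) :
  (forall a, alg_hom (i a)) ->
  (forall a b, a != b -> ~ exists u v : hom one X,
     star_inverse u v /\ conj_by u v ∘ i a = i b) ->
  (r <= 2 ^ minn (homdim A X).-1 (homdim (A ⊗ A) X))%N.
Proof.
case: r i => [//|r] i hi sepi.
pose i0 := i ord0; have [i0m i0e] := hi ord0.
pose ev : {linear hom A X -> hom one X} :=
  HB.pack (fun w : hom A X => w ∘ aunit A)
   (GRing.isLinear.Build k _ _ _ (fun w : hom A X => w ∘ aunit A) (@comp_linl k C _ _ _ (aunit A))).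
pose K := lker (linfun ev).
have memK w : (w \in K) = (w ∘ aunit A == 0) by rewrite memv_ker lfunE.
pose V : vectType k := subvs_of K.
pose T : vectType k := hom (A ⊗ A) X.
pose val (w : V) : hom A X := vsval w.
have valL : linear val by exact: linearP.
have prL : linear (vsproj K) by exact: linearP.
have valK w : w ∘ aunit A = 0 -> val (vsproj K w) = w.
  by move=> w0; apply: vsprojK; rewrite memK w0.
have valE (w : V) : val w ∘ aunit A = 0 by apply/eqP; rewrite -memK; apply: subvsP.
have dimV : (dim V <= (homdim A X).-1)%N.
  have -> : dim V = \dim K by [].
  have := limg_ker_dim (linfun ev) fullv; rewrite capfv -/K => E.
  (* If the unit of X is 0, all maps to X are 0; otherwise i0 is not in the kernel of
  evaluation at the unit, and the dimension drops. *)
  have [e0|e0] := eqVneq (aunit X) 0.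
    have : (dim (hom A X) <= dim 'rV[k]_0)%N.
      apply: (@linear_inj_dim _ _ _ (fun=> 0)) => [a u v|u v _].
        by rewrite scaler0 addr0.
      by rewrite [u](alg_unit0 e0) [v](alg_unit0 e0).
    rewrite leqn0 => /eqP dim0; move: E.
    by rewrite dimvf dim0 => /eqP; rewrite addn_eq0 => /andP[/eqP-> _].
  suff : (0 < \dim (limg (linfun ev)))%N by rewrite homdimE -dimvf -E; lia.
  rewrite lt0n dimv_eq0; apply: contraNneq e0 => L0; rewrite -i0e.
  have : linfun ev i0 \in limg (linfun ev) by rewrite memv_img ?memvf.
  by rewrite L0 memv0 lfunE.
apply: (@leq_trans (2 ^ minn (dim V) (dim T))); last first.
  rewrite leq_pexp2l // leq_min !geq_min dimV /= homdimE leqnn orbT //.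
pose m := amul X.
pose L (w : V) : T := val w ∘ amul A - m ∘ (i0 ⊠ val w) - m ∘ (val w ⊠ i0).
pose Q (w w' : V) : T := - (m ∘ (val w ⊠ val w')).
have HL : linear L.
  apply: lin_sub; first apply: lin_sub.
  - exact: (lin_comp (@comp_linl k C _ _ _ (amul A)) valL).
  - exact: (lin_comp (@comp_linr k C _ _ _ m) (lin_comp (@tensm_linr k C _ _ _ _ i0) valL)).
  - exact: (lin_comp (@comp_linr k C _ _ _ m) (lin_comp (@tensm_linl k C _ _ _ _ i0) valL)).
have HQ : bilin Q.
  split=> [w a u v|w a u v]; rewrite /Q valL !(tensDl, tensDr, tensZl, tensZr) !(compDr, compZr).
    by rewrite opprD scalerN.
  by rewrite opprD scalerN.
have mult (w : V) : alg_hom (i0 + val w) -> 0 + L w + Q w w = 0.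
  move=> [+ _]; rewrite add0r /L /Q compDl !(tensDl, tensDr) !compDr i0m -!addrA.
  by move/addrI => ->; rewrite !addrA addr3_cancel.
have den1 : det (aunit X) = 1 by rewrite /det adet1 // => u; rewrite stare1.
have adj1 : adj (aunit X) = aunit X.
  by rewrite /adj aadj1 // => u; rewrite ?star1e ?stare1.
have fracE a u (du : det u != 0) : (det u)^-1 *: vsproj K (conj_num (i a) u - det u *: i0)
    = vsproj K (conj_by u ((det u)^-1 *: adj u) ∘ i a - i0).
  by rewrite -(linZ prL) scalerBr scalerA mulVf // scale1r conj_num_frac.
have ui_alg a u (du : det u != 0) : alg_hom (conj_by u ((det u)^-1 *: adj u) ∘ i a).
  by apply: alg_hom_comp (hi a); apply: conj_by_alg; apply: adj_star_inverse.
have valfrac a u (du : det u != 0) :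
    i0 + val (vsproj K (conj_by u ((det u)^-1 *: adj u) ∘ i a - i0))
    = conj_by u ((det u)^-1 *: adj u) ∘ i a.
  rewrite valK ?(addrC i0) ?subrK // compDl compNl i0e.
  by case: (ui_alg a u du) => _ ->; rewrite subrr.
apply: (@quadratic_families_bound k V T 0 L Q HL HQ r.+1 (fun=> G) (fun=> det)
  (fun a u => vsproj K (conj_num (i a) u - det u *: i0)) (fun=> aunit X)
  (fun a => vsproj K (i a - i0))).
- by move=> a; apply: adet_poly.
- move=> a; apply: (vpoly_lin prL); apply: vpolyD; first exact: conj_num_poly.
  apply: eq_vpoly (vpolyZ (adet_poly starB) (@vpoly_const k G _ (- i0))) => u.
  by rewrite scalerN.
- by move=> a; rewrite den1 oner_eq0.
- by move=> a; rewrite den1 /conj_num adj1 lmul_unit rmul_unit !comp1m !scale1r.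
- move=> a u du v; apply: mult; rewrite /v fracE // valfrac //.
  exact: ui_alg.
- move=> a w Hw.
  have ia0 : (i a - i0) ∘ aunit A = 0.
    by rewrite compDl compNl i0e; case: (hi a) => _ ->; rewrite subrr.
  have [x xE] : exists x, val w = lmul x ∘ i a - rmul x ∘ i a.
    apply: (@derivation_inner k C A sepA X (i a) (val w) (hi a)).
    move: Hw; rewrite /L /Q (valK _ ia0) !(tensDl, tensDr, compDr).
    rewrite !(tensNl, tensNr) !compNr; exact: derivation_shuffle.
  have [d1 [jd ja]] := adj_jets starB sA s1 sr1 x.
  exists x, d1; split; first by rewrite den1.
  have jl := vjet_lin lmul_linear (vjet_affine (aunit X : G) x).
  have jr := vjet_lin rmul_linear ja.
  have jc := vjet_lin (@comp_linl k C _ _ _ (i a)) (vjet_bilin (@bilin_comp k C _ _ _) jr jl).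
  have j0 := vjetZ jd (vjet_const (- i0)).
  apply: eq_vjet (vjet_lin prL (vjetD jc j0)) _ _ _ => [t||].
  + by rewrite scalerN.
  + by rewrite den1 /conj_num adj1 scalerN.
  rewrite den1 scale1r; apply: val_inj => /=.
  rewrite lmul_unit rmul_unit comp1m compm1 add0r.
  rewrite -/(val _) -/(val _) -/(val _) (valK _ ia0) scale1r.
  have -> : (lmul x + rmul (d1 *: aunit X - x)) ∘ i a + d1 *: - i0 = val w + d1 *: (i a - i0).
    rewrite (linB rmul_linear) (linZ rmul_linear) rmul_unit !(compDl, compNl, compZl) comp1m.
    by rewrite xE scalerBr scalerN [d1 *: i a - _]addrC !addrA.
  by rewrite valK // compDl compZl ia0 valE scaler0 addr0.
move=> a b ab u u' du du'; rewrite !fracE // => E.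
have {E}E := congr1 (fun w => i0 + val w) E; rewrite /= !valfrac // in E.
apply: (sepi a b ab).
have H := adj_star_inverse du; have [H1 H2] := adj_star_inverse du'.
exists (star ((det u')^-1 *: adj u') u), (star ((det u)^-1 *: adj u) u'); split.
  by apply: (star_inverse_comp H).
by rewrite -conj_by_star -compA E compA conj_by_star H2 conj_by_unit comp1m.
Qed.
End Homs.

(** * Counting separable algebra subobjects *)

Section FixedObject.
Variables (k : closedFieldType) (C : moncat k) (X : algebra C) (B : C).

(** At most 2^min(a + u, t + 2 E) isomorphism types of structures occur, and the
maps attached to one type become, after composition with isomorphisms from a
representative, pairwise non-conjugate maps out of one separable algebra. *)
Lemma fixed_object_bound q (s : 'I_q -> alg_struct B) (i : 'I_q -> hom B X) :
  (forall t, separable_alg (Algebra (s t))) ->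
  (forall t, @alg_hom k C (Algebra (s t)) X (i t)) ->
  (forall t t', t != t' -> ~ exists u v : hom one X, star_inverse u v /\
     exists h, @alg_iso k C (Algebra (s t)) (Algebra (s t')) h /\
       conj_by u v ∘ i t = i t' ∘ h) ->
  (q <= 2 ^ class_exponent X B)%N.
Proof.
move=> sep hi nonconj.
pose iso t t' := `[< exists h, @alg_iso k C (Algebra (s t)) (Algebra (s t')) h >].
have isoR t : iso t t by apply/asboolP; exists (idm B); apply: alg_iso_id.
have isoS t t' : iso t t' -> iso t' t.
  by move=> /asboolP[h /alg_iso_inv[h' [H _ _]]]; apply/asboolP; exists h'.
have isoT t1 t2 t3 : iso t1 t2 -> iso t2 t3 -> iso t1 t3.
  move=> /asboolP[h H] /asboolP[h' H']; apply/asboolP; exists (h' ∘ h).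
  exact: alg_iso_comp H' H.
(* The choice depends only on the isomorphism type. *)
pose rep t := odflt t [pick t' | iso t t'].
have repP t : iso t (rep t) by rewrite /rep; case: pickP => //= /(_ t); rewrite isoR.
have repE t t' : iso t t' -> rep t = rep t'.
  move=> tt'; rewrite /rep.
  have E : iso t =1 iso t'.
    by move=> t2; apply/idP/idP; apply: isoT => //; apply: isoS.
  by rewrite (eq_pick E); case: pickP => //= /(_ t'); rewrite isoR.
rewrite -[q]card_ord expnD; apply: (@card_fibers _ _ rep).
  set I := [set rep t | t : 'I_q].
  apply: (@structures_bound k C B #|I| (fun a => s (enum_val a))) => [a|a b ab]; first exact: sep.
  move=> [h H]; case/negP: ab; apply/eqP/enum_val_inj.
  have /imsetP[t _ E] := enum_valP a; have /imsetP[t' _ E'] := enum_valP b.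
  have : iso (enum_val a) (enum_val b) by apply/asboolP; exists h.
  rewrite E E' => H'; apply: repE.
  exact: isoT (repP t) (isoT _ _ _ H' (isoS _ _ (repP t'))).
move=> t0; set I := [set t | rep t == t0].
have /choice[h Hh] : forall a : 'I_#|I|, exists h : hom B B,
    @alg_iso k C (Algebra (s t0)) (Algebra (s (enum_val a))) h.
  move=> a; have := enum_valP a; rewrite inE => /eqP <-.
  exact/asboolP/isoS/repP.
apply: (@homs_bound k C (Algebra (s t0)) X (sep t0) _ (fun a => i (enum_val a) ∘ h a)) => [a|a b ab].
  by apply: (@alg_hom_comp k C (Algebra (s t0)) (Algebra (s (enum_val a))) X); [apply: hi|case: (Hh a)].
move=> [u [v [uv E]]].
apply: (nonconj (enum_val a) (enum_val b)).
  by apply: contraNneq ab => /enum_val_inj ->.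
exists u, v; split=> //.
have [h' [isoh' h'K hK']] := alg_iso_inv (Hh a).
exists (h b ∘ h'); split; first exact: alg_iso_comp (Hh b) isoh'.
by rewrite compA -E -!compA hK' compm1.
Qed.
End FixedObject.

Section Relations.
Variables (k : closedFieldType) (C : moncat k) (X : algebra C).
Implicit Types S U W : alg_subobject X.

Lemma inner_conjugate_sym S U : inner_conjugate S U -> inner_conjugate U S.
Proof.
move=> [u [v [[uv vu] [h [isoh E]]]]].
have [h' [isoh' h'K hK']] := alg_iso_inv isoh.
exists v, u; split=> //; exists h'; split=> //.
have -> : sub_incl U = conj_by u v ∘ sub_incl S ∘ h' by rewrite E -compA hK' compm1.
by rewrite compA [X in X ∘ _]compA conj_by_star vu conj_by_unit comp1m.
Qed.

Lemma inner_conjugate_trans S U W :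
  inner_conjugate S U -> inner_conjugate U W -> inner_conjugate S W.
Proof.
move=> [u [v [uv [h [isoh E]]]]] [u' [v' [uv' [h' [isoh' E']]]]].
exists (star u' u), (star v v'); split; first exact: star_inverse_comp.
exists (h' ∘ h); split; first exact: alg_iso_comp.
by rewrite -conj_by_star -compA E compA E' compA.
Qed.

Lemma equivalent_over_sym S U : equivalent_over S U -> equivalent_over U S.
Proof.
move=> [h [isoh E]]; have [h' [isoh' h'K hK']] := alg_iso_inv isoh.
by exists h'; split=> //; rewrite E -compA hK' compm1.
Qed.

Lemma equivalent_over_trans S U W :
  equivalent_over S U -> equivalent_over U W -> equivalent_over S W.
Proof.
move=> [h [isoh E]] [h' [isoh' E']]; exists (h' ∘ h); split; first exact: alg_iso_comp.
by rewrite E E' compA.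
Qed.

(** All elements of Gamma(X) are scalar multiples of the unit. *)
Lemma connected_conj (u v : hom one X) : connected_alg X -> star_inverse u v ->
  conj_by u v = idm X.
Proof.
rewrite /connected_alg /homdim => d1 [uv _].
have e0 : aunit X != 0.
  apply/eqP => e0; have F0 : fullv = 0%VS :> {vspace hom one X}.
    by apply/eqP; rewrite -subv0; apply/subvP => w _; rewrite (alg_unit0 e0 w) mem0v.
  by move: d1; rewrite F0 dimv0.
have scal (w : hom one X) : exists a, w = a *: aunit X.
  have : w \in fullv by apply: memvf.
  have /eqP <- : <[aunit X]>%VS == fullv.
    by rewrite eqEdim subvf dim_vline e0 d1.
  by move/vlineP.
have [a ua] := scal u; have [b vb] := scal v.
have ab : a * b = 1.
  move: uv; rewrite ua vb (linZ ((bilin_star X).1 _)) (linZ ((bilin_star X).2 _)) star1e scalerA.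
  move/eqP; rewrite -subr_eq0 -{2}[aunit X]scale1r -scalerBl scaler_eq0 (negPf e0) orbF.
  by rewrite subr_eq0 => /eqP.
rewrite conj_byE ua vb (linZ (@rmul_linear k C X)) (linZ (@lmul_linear k C X)).
by rewrite lmul_unit rmul_unit compZl compZr comp1m scalerA mulrC ab scale1r.
Qed.

Lemma transport_subobject S (B : C) : isomorphic (sub_alg S) B ->
  exists (s : alg_struct B) (i : hom B X) (f : hom (sub_alg S) B),
    [/\ @alg_iso k C (sub_alg S) (Algebra s) f, @alg_mono k C (Algebra s) X i
      & sub_incl S = i ∘ f].
Proof.
move=> [g [g' [gK g'K]]].
have [ih im] := sub_mono S.
exists (transport gK g'K), (sub_incl S ∘ g'), g; split.
- exact: transport_iso.
- split; first by apply: alg_hom_comp ih _; apply: transport_homV.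
  move=> Z f1 f2; rewrite -!compA => /im H.
  by rewrite -(comp1m f1) -g'K -compA H compA g'K comp1m.
by rewrite -compA gK compm1.
Qed.
End Relations.

Section Main.
Variables (k : closedFieldType) (C : moncat k) (X : algebra C).
Variables (M : nat) (Y : 'I_M -> C) (hY : subobject_representatives X Y).

(** Every algebra subobject is transported to the representative of its
isomorphism class of objects, and the classes are counted there. *)
Lemma family_bound r (S : 'I_r -> alg_subobject X) :
  inequivalent (@separable_subobject k C X) (@inner_conjugate k C X) S ->
  (r <= \sum_(j < M | `[< admits_alg_mono X (Y j) >]) 2 ^ class_exponent X (Y j))%N.
Proof.
move=> [sepS nonconj]; have [_ _ allY] := hY.
have /choice[jj Hjj] : forall a, exists j, isomorphic (sub_alg (S a)) (Y j).
  by move=> a; apply: allY; exists (sub_incl (S a)); case: (sub_mono (S a)).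
have adm a : `[< admits_alg_mono X (Y (jj a)) >].
  by apply/asboolP; have [s [i [f [_ Hi _]]]] := transport_subobject (Hjj a); exists s, i.
rewrite -[X in (X <= _)%N]card_ord -sum1_card.
rewrite (partition_big jj (fun j => `[< admits_alg_mono X (Y j) >])) /=; last by move=> a _; apply: adm.
apply: leq_sum => j _; set I := [set a | jj a == j].
rewrite (eq_bigl (fun a => a \in I)) => [|a]; last by rewrite inE.
rewrite sum1_card.
have /choice[s /choice[i Hi]] : forall t : 'I_#|I|, exists (s : alg_struct (Y j))
    (i : hom (Y j) X) (f : hom (sub_alg (S (enum_val t))) (Y j)),
    [/\ @alg_iso k C _ (Algebra s) f, @alg_mono k C (Algebra s) X i
      & sub_incl (S (enum_val t)) = i ∘ f].
  move=> t; apply: transport_subobject; have := Hjj (enum_val t).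
  by have := enum_valP t; rewrite inE => /eqP ->.
apply: (@fixed_object_bound k C X (Y j) #|I| s i).
- by move=> t; case: (Hi t) => f [isof _ _]; apply: separable_iso isof (sepS _).
- by move=> t; case: (Hi t) => f [_ []].
move=> t t' tt' [u [v [uv [h [isoh E]]]]].
apply: (nonconj (enum_val t) (enum_val t')).
  by apply: contraNneq tt' => /enum_val_inj ->.
exists u, v; split=> //.
have [f [isof _ Sf]] := Hi t; have [f' [isof' _ Sf']] := Hi t'.
have [g [isog gK Kg]] := alg_iso_inv isof'.
exists (g ∘ (h ∘ f)); split.
  by apply: alg_iso_comp isog _; apply: alg_iso_comp isoh isof.
by rewrite Sf Sf' !compA E -(compA (i t')) Kg compm1.
Qed.
End Main.

Local Close Scope obj_scope.
Local Close Scope mor_scope.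
Local Close Scope ring_scope.

Theorem theorem7p4 (k : closedFieldType) (C : moncat k) (X : algebra C)
    (M : nat) (Y : 'I_M -> C) (hY : subobject_representatives X Y) :
  let bound :=
    \sum_(j < M | `[< admits_alg_mono X (Y j) >]) 2 ^ class_exponent X (Y j) in
  num_classes_le (@separable_subobject k C X) (@inner_conjugate k C X) bound
  /\ (connected_alg X ->
      num_classes_le (@separable_subobject k C X) (@equivalent_over k C X)
        bound).
Proof.
move=> bound; split=> [|conn].
  apply: num_classes_le_family => [S U|S U W|r S].
  - exact: inner_conjugate_sym.
  - exact: inner_conjugate_trans.
  - exact: family_bound.
apply: num_classes_le_family => [S U|S U W|r S [sepS noneq]].
- exact: equivalent_over_sym.
- exact: equivalent_over_trans.
apply: (family_bound hY (S := S)); split=> // a b ab [u [v [uv [h [isoh E]]]]].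
apply: (noneq a b ab); exists h; split=> //.
by rewrite -E connected_conj // comp1m.
Qed.
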